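(* Let $F$ be a non-abelian free group of finite rank. The following hold: (1) $\mathrm{AComm}(F)$ is simple and is equal to the monolith of $\mathrm{Comm}(F)$. (2) $\mathrm{AComm}(F)$ has infinite index in $\mathrm{Comm}(F)$. In particular, $\mathrm{Comm}(F)$ is not virtually simple.
   Context: For an abstract group $G$, a virtual isomorphism of $G$ is a group isomorphism $f:U\to V$ between finite index subgroups $U,V$ of $G$. Two virtual isomorphisms are equivalent if they coincide on some finite index subgroup of $G$; the class of $f$ is denoted $[f]$. The commensurator $\mathrm{Comm}(G)$ is the group of equivalence classes with product $[f_1][f_2]=[f_1\circ f_2]$, where for $f_i:U_i\to V_i$ the composition $f_1\circ f_2$ is defined on $f_2^{-1}(V_2\cap U_1)$. For a finite index subgroup $H$ of $G$, every automorphism of $H$ is a virtual isomorphism of $G$, which gives a canonical homomorphism $\mathrm{Aut}(H)\to\mathrm{Comm}(G)$. $\mathrm{AComm}(G)$ denotes the subgroup of $\mathrm{Comm}(G)$ generated by the canonical images of the groups $\mathrm{Aut}(H)$, where $H$ ranges over all finite index subgroups of $G$. A group is monolithic if the intersection of all its non-trivial normal subgroups is non-trivial; in that case this intersection is called the monolith. A group is virtually simple if it has a simple subgroup of finite index. *)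

(* Defs.v *)
From HB Require Import structures.
From mathcomp Require Import all_boot.
From mathcomp Require Import boolp classical_sets functions cardinality.

Set Implicit Arguments.
Unset Strict Implicit.
Unset Printing Implicit Defensive.

Local Open Scope classical_set_scope.
Local Open Scope group_scope.
Local Open Scope quotient_scope.

(* [groupType] carries a [choiceType] structure, but this is no restriction:
   classically every type has one ([boolp.gen_choiceMixin]). *)

Section Subgroups.
Variable G : groupType.
Implicit Types H K N S : set G.

Definition subgroup H : Prop :=
  [/\ H 1, (forall x y, H x -> H y -> H (x * y)) & forall x, H x -> H x^-1].

Definition left_coset H (g : G) : set G := [set g * h | h in H].

Definition finite_index H : Prop := finite_set (range (left_coset H)).

Definition fi_subgroup H : Prop := subgroup H /\ finite_index H.

Definition normal_in S N : Prop :=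
  [/\ subgroup N, N `<=` S & forall s x, S s -> N x -> N (x ^ s)].

Definition simple S : Prop :=
  [/\ subgroup S, S <> [set 1] &
      forall N, normal_in S N -> N = [set 1] \/ N = S].

Definition generated (A : set G) : set G := smallest subgroup A.

End Subgroups.

Definition monolith (G : groupType) : set G :=
  \bigcap_(N in [set N | normal_in setT N /\ N <> [set 1]]) N.

Arguments monolith : clear implicits.

Definition monolithic (G : groupType) : Prop := monolith G <> [set 1].

Definition virtually_simple (G : groupType) : Prop :=
  exists S : set G, simple S /\ finite_index S.

Definition free_basis (F : groupType) (I : Type) (b : I -> F) : Prop :=
  forall (H : groupType) (h : I -> H),
    exists phi : {multiplicative F -> H},
      (forall i, phi (b i) = h i) /\
      forall psi : {multiplicative F -> H},
        (forall i, psi (b i) = h i) -> psi =1 phi.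

Definition free_of_finite_rank (F : groupType) : Prop :=
  exists (n : nat) (b : 'I_n -> F), free_basis b.

Definition nonabelian (F : groupType) : Prop :=
  ~ forall x y : F, commute x y.

(* The underlying map [vfun] is total; its values outside [vdom] are junk and
   are never used. *)
Record viso (G : groupType) := Viso {
  vdom : set G;
  vcod : set G;
  vfun : G -> G;
  vdom_fi : fi_subgroup vdom;
  vcod_fi : fi_subgroup vcod;
  vfunM : forall x y, vdom x -> vdom y -> vfun (x * y) = vfun x * vfun y;
  vfun_bij : set_bij vdom vcod vfun
}.

Section SubgroupTheory.
Variable G : groupType.
Implicit Types H K : set G.

(* [invgM] specialized to [groupType], so that it rewrites without leaving a
   [starMonoidType] structure in the goal. *)
Lemma invgMG (x y : G) : (x * y)^-1 = y^-1 * x^-1.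
Proof. exact: invgM. Qed.

Lemma subgroupT : subgroup (@setT G). Proof. by []. Qed.

Lemma subgroupI H K : subgroup H -> subgroup K -> subgroup (H `&` K).
Proof.
move=> [H1 HM HV] [K1 KM KV]; split=> //.
- by move=> x y [Hx Kx] [Hy Ky]; split; [exact: HM | exact: KM].
- by move=> x [Hx Kx]; split; [exact: HV | exact: KV].
Qed.

Lemma finite_indexP H : subgroup H ->
  finite_index H <->
  exists s : seq G, forall g, exists2 r, r \in s & H (r^-1 * g).
Proof.
move=> [H1 HM HV]; split.
  move=> /finite_seqP[s Es]; exists [seq xget 1 A | A <- s] => g.
  have gs : left_coset H g \in s.
    have : range (left_coset H) (left_coset H g) by exists g.
    by rewrite Es.
  exists (xget 1 (left_coset H g)); first exact: map_f.
  have : left_coset H g (xget 1 (left_coset H g)).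
    by apply: (@xgetPex _ 1 (left_coset H g)); exists (g * 1); exists 1.
  by move=> [h Hh <-]; rewrite invgMG mulgVK; exact: HV.
move=> [s Ps]; apply: (@sub_finite_set _ _ (left_coset H @` [set` s])).
  move=> _ [g _ <-]; have [r rs Hr] := Ps g.
  exists r => //; rewrite /left_coset; apply/seteqP; split=> x [h Hh <-].
    exists ((r^-1 * g)^-1 * h); first by apply: HM => //; exact: HV.
    by rewrite invgMG invgK !mulgA mulgV mul1g.
  by exists ((r^-1 * g) * h); [exact: HM | rewrite !mulgA mulgV mul1g].
exact/finite_image/finite_seq.
Qed.

Lemma fi_subgroupT : fi_subgroup (@setT G).
Proof.
split=> //; apply/finite_indexP => //.
by exists [:: 1] => g; exists 1; rewrite ?inE.
Qed.

Lemma fi_subgroup_preim U W (f : G -> G) :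
    fi_subgroup U -> fi_subgroup W ->
    (forall x y, U x -> U y -> f (x * y) = f x * f y) ->
  fi_subgroup (U `&` f @^-1` W).
Proof.
move=> [sU iU] [sW iW] fM; have [U1 UM UV] := sU; have [W1 WM WV] := sW.
have f1 : f 1 = 1 by apply: (@mulgI _ (f 1)); rewrite -fM // !mulg1.
have fV x : U x -> f x^-1 = (f x)^-1.
  move=> Ux; apply: (@mulgI _ (f x)).
  by rewrite -fM ?mulgV //; exact: UV.
have sP : subgroup (U `&` f @^-1` W).
  split; first by split=> //=; rewrite f1.
  - move=> x y [Ux Wx] [Uy Wy]; split; first exact: UM.
    by rewrite /= fM //; exact: WM.
  - by move=> x [Ux Wx]; split; [exact: UV | rewrite /= fV //; exact: WV].
split=> //; apply/finite_indexP => //.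
move/(finite_indexP sU): iU => [s Ps]; move/(finite_indexP sW): iW => [t Pt].
pose D b := [set u | U u /\ W (b^-1 * f u)].
pose c b := xget 1 (D b).
exists [seq r * c b | r <- s, b <- t] => g.
have [r rs Ur] := Ps g; have [b bt Wb] := Pt (f (r^-1 * g)).
exists (r * c b); first exact: allpairs_f.
have [Uc Wc] : D b (c b) by apply: (@xgetPex _ 1 (D b)); exists (r^-1 * g).
rewrite invgMG -mulgA; split; first by apply: UM => //; exact: UV.
rewrite /= fM //; last exact: UV.
rewrite fV //; have -> : (f (c b))^-1 * f (r^-1 * g) =
    (b^-1 * f (c b))^-1 * (b^-1 * f (r^-1 * g)).
  by rewrite invgMG invgK !mulgA mulgK.
by apply: WM => //; exact: WV.
Qed.

Lemma fi_subgroupI H K :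
  fi_subgroup H -> fi_subgroup K -> fi_subgroup (H `&` K).
Proof. by move=> iH iK; exact: (@fi_subgroup_preim H K id). Qed.

End SubgroupTheory.

Section VirtualIsomorphisms.
Variable G : groupType.
Implicit Types f g h : viso G.

Lemma vfun_cod f x : vdom f x -> vcod f (vfun f x).
Proof. by have [+ _ _] := vfun_bij f; exact. Qed.

Lemma vfun_inj f x y :
  vdom f x -> vdom f y -> vfun f x = vfun f y -> x = y.
Proof. by move=> fx fy; have [_ + _] := vfun_bij f; apply; rewrite inE. Qed.

Lemma vfun_surj f y : vcod f y -> exists2 x, vdom f x & vfun f x = y.
Proof. by have [_ _ +] := vfun_bij f; exact. Qed.

Lemma vid_bij : set_bij (@setT G) (@setT G) id.
Proof. by split=> // x _; exists x. Qed.

Definition vid : viso G := @Viso G setT setT id (fi_subgroupT G)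
  (fi_subgroupT G) (fun _ _ _ _ => erefl) vid_bij.

Definition vinv_fun f : G -> G :=
  fun y => xget 1 [set x | vdom f x /\ vfun f x = y].

Lemma vinv_funP f y :
  vcod f y -> vdom f (vinv_fun f y) /\ vfun f (vinv_fun f y) = y.
Proof.
move=> /vfun_surj[x fx fxy].
by apply: (@xgetPex _ 1 [set x | vdom f x /\ vfun f x = y]); exists x.
Qed.

Lemma vinv_funK f x : vdom f x -> vinv_fun f (vfun f x) = x.
Proof.
move=> fx; have [d e] := vinv_funP (vfun_cod fx).
exact: vfun_inj e.
Qed.

Lemma vinvM f x y : vcod f x -> vcod f y ->
  vinv_fun f (x * y) = vinv_fun f x * vinv_fun f y.
Proof.
move=> /vinv_funP[dx ex] /vinv_funP[dy ey].
have [[_ dM _] _] := vdom_fi f.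
by rewrite -{1}ex -{1}ey -vfunM // vinv_funK //; exact: dM.
Qed.

Lemma vinv_bij f : set_bij (vcod f) (vdom f) (vinv_fun f).
Proof.
split.
- by move=> y /vinv_funP[].
- move=> x y; rewrite !inE => /vinv_funP[_ ex] /vinv_funP[_ ey] exy.
  by rewrite -ex exy.
- by move=> x fx; exists (vfun f x); [exact: vfun_cod | exact: vinv_funK].
Qed.

Definition vinv f : viso G :=
  Viso (vcod_fi f) (vdom_fi f) (@vinvM f) (vinv_bij f).

(* [vcomp f1 f2] is f1 o f2, from f2^-1(V2 `&` U1) to f1(V2 `&` U1). *)
Definition vcomp_dom f1 f2 : set G :=
  vdom f2 `&` vfun f2 @^-1` (vcod f2 `&` vdom f1).

Definition vcomp_cod f1 f2 : set G := vfun f1 @` (vcod f2 `&` vdom f1).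

Lemma vcomp_dom_fi f1 f2 : fi_subgroup (vcomp_dom f1 f2).
Proof.
apply: fi_subgroup_preim; [exact: vdom_fi| |exact: vfunM].
by apply: fi_subgroupI; [exact: vcod_fi | exact: vdom_fi].
Qed.

Lemma vcomp_codE f1 f2 :
  vcomp_cod f1 f2 = vcod f1 `&` vinv_fun f1 @^-1` (vcod f2 `&` vdom f1).
Proof.
apply/seteqP; split=> y.
  move=> [x [c2 d1] <-]; split; first exact: vfun_cod.
  by rewrite /= vinv_funK.
by move=> [/vinv_funP[d e] c]; exists (vinv_fun f1 y).
Qed.

Lemma vcomp_cod_fi f1 f2 : fi_subgroup (vcomp_cod f1 f2).
Proof.
rewrite vcomp_codE; apply: fi_subgroup_preim; [exact: vcod_fi| |exact: vinvM].
by apply: fi_subgroupI; [exact: vcod_fi | exact: vdom_fi].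
Qed.

Lemma vcompM f1 f2 x y : vcomp_dom f1 f2 x -> vcomp_dom f1 f2 y ->
  (vfun f1 \o vfun f2) (x * y) =
  (vfun f1 \o vfun f2) x * (vfun f1 \o vfun f2) y.
Proof. by move=> [dx [_ ex]] [dy [_ ey]] /=; rewrite !vfunM. Qed.

Lemma vcomp_bij f1 f2 :
  set_bij (vcomp_dom f1 f2) (vcomp_cod f1 f2) (vfun f1 \o vfun f2).
Proof.
split.
- by move=> x [d c]; exists (vfun f2 x).
- move=> x y; rewrite !inE => -[dx [_ ex]] [dy [_ ey]] /= e.
  by apply: (vfun_inj dx dy); exact: vfun_inj e.
- move=> _ [z [c d] <-]; have [x dx e] := vfun_surj c.
  by exists x; rewrite /= ?e //; split=> //=; rewrite e.
Qed.

Definition vcomp f1 f2 : viso G :=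
  Viso (vcomp_dom_fi f1 f2) (vcomp_cod_fi f1 f2)
       (@vcompM f1 f2) (vcomp_bij f1 f2).

Definition viso_equiv f g : Prop :=
  exists W : set G, [/\ fi_subgroup W, W `<=` vdom f, W `<=` vdom g &
                        forall x, W x -> vfun f x = vfun g x].

Lemma viso_equiv_refl f : viso_equiv f f.
Proof. by exists (vdom f); split=> //; exact: vdom_fi. Qed.

Lemma viso_equiv_sym f g : viso_equiv f g -> viso_equiv g f.
Proof. by move=> [W [iW Wf Wg e]]; exists W; split=> // x /e. Qed.

Lemma viso_equiv_trans g f h :
  viso_equiv f g -> viso_equiv g h -> viso_equiv f h.
Proof.
move=> [W [iW Wf Wg e]] [W' [iW' Wg' Wh e']]; exists (W `&` W'); split.
- exact: fi_subgroupI.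
- by move=> x [/Wf].
- by move=> x [_ /Wh].
- by move=> x [/e-> /e'].
Qed.

Lemma vcomp_equiv f f' g g' : viso_equiv f f' -> viso_equiv g g' ->
  viso_equiv (vcomp f g) (vcomp f' g').
Proof.
move=> [W [iW Wf Wf' e]] [X [iX Xg Xg' e']].
exists (X `&` vfun g @^-1` W); split.
- by apply: fi_subgroup_preim => // x y /Xg gx /Xg gy; exact: vfunM.
- move=> x [Xx Wx]; split; [exact: Xg | split; last exact: Wf].
  exact/vfun_cod/Xg.
- move=> x [Xx Wx]; split; [exact: Xg' | split].
    exact/vfun_cod/Xg'.
  by rewrite /= -e' //; exact: Wf'.
- by move=> x [Xx Wx] /=; rewrite -e' // e.
Qed.

Lemma vinv_equiv f f' : viso_equiv f f' -> viso_equiv (vinv f) (vinv f').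
Proof.
move=> [W [iW Wf Wf' e]]; exists (vcod f `&` vinv_fun f @^-1` W).
have P y : (vcod f `&` vinv_fun f @^-1` W) y ->
    vcod f' y /\ vinv_fun f y = vinv_fun f' y.
  move=> [/vinv_funP[d ey] Wy]; have ey' := e _ Wy; rewrite ey in ey'.
  split; first by rewrite ey'; exact/vfun_cod/Wf'.
  by rewrite {2}ey' vinv_funK //; exact: Wf'.
split.
- by apply: fi_subgroup_preim => //; [exact: vcod_fi | exact: vinvM].
- by move=> y [].
- by move=> y /P[].
- by move=> y /P[].
Qed.

End VirtualIsomorphisms.

HB.instance Definition _ (G : groupType) := gen_eqMixin (viso G).
HB.instance Definition _ (G : groupType) := gen_choiceMixin (viso G).

Section Commensurator.
Variable G : groupType.
Implicit Types f g : viso G.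

Definition viso_rel : rel (viso G) := fun f g => `[< viso_equiv f g >].

Lemma viso_rel_refl : reflexive viso_rel.
Proof. by move=> f; apply/asboolP; exact: viso_equiv_refl. Qed.

Lemma viso_rel_sym : symmetric viso_rel.
Proof. by move=> f g; apply/asboolP/asboolP; exact: viso_equiv_sym. Qed.

Lemma viso_rel_trans : transitive viso_rel.
Proof.
move=> g f h /asboolP fg /asboolP gh; apply/asboolP.
exact: viso_equiv_trans gh.
Qed.

Canonical viso_equiv_rel :=
  EquivRel viso_rel viso_rel_refl viso_rel_sym viso_rel_trans.

Definition Comm : Type := {eq_quot viso_equiv_rel}.
HB.instance Definition _ := Choice.on Comm.
HB.instance Definition _ := EqQuotient.on Comm.

Definition vclass f : Comm := \pi_Comm f.

Lemma vclassP f g : vclass f = vclass g <-> viso_equiv f g.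
Proof.
have E : reflect (vclass f = vclass g) (viso_rel f g).
  exact: (@eqquotP _ _ {eq_quot viso_equiv_rel} f g).
by split=> [/E/asboolP | /asboolP/E].
Qed.

Definition comm_one : Comm := vclass (vid G).
Definition comm_mul (a b : Comm) : Comm := vclass (vcomp (repr a) (repr b)).
Definition comm_inv (a : Comm) : Comm := vclass (vinv (repr a)).

Lemma vclass_repr a : vclass (repr a) = a. Proof. exact: reprK. Qed.

Lemma comm_mulE f g : comm_mul (vclass f) (vclass g) = vclass (vcomp f g).
Proof. by apply/vclassP/vcomp_equiv; apply/vclassP; exact: vclass_repr. Qed.

Lemma comm_invE f : comm_inv (vclass f) = vclass (vinv f).
Proof. by apply/vclassP/vinv_equiv/vclassP; exact: vclass_repr. Qed.

Lemma comm_mulA : associative comm_mul.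
Proof.
move=> a b c; rewrite -(vclass_repr a) -(vclass_repr b) -(vclass_repr c).
rewrite !comm_mulE; apply/vclassP.
set f := repr a; set g := repr b; set h := repr c.
exists (vcomp_dom (vcomp f g) h); split=> //; first exact: vcomp_dom_fi.
move=> x [dx [cx [dy [cy dz]]]]; split=> //; split=> //.
by exists (vfun h x).
Qed.

Lemma comm_mul1g : left_id comm_one comm_mul.
Proof.
move=> a; rewrite -(vclass_repr a) comm_mulE; apply/vclassP.
exists (vdom (repr a)); split=> //; first exact: vdom_fi.
by move=> x dx; split=> //; split=> //; exact: vfun_cod.
Qed.

Lemma comm_mulg1 : right_id comm_one comm_mul.
Proof.
move=> a; rewrite -(vclass_repr a) comm_mulE; apply/vclassP.
by exists (vdom (repr a)); split=> //; exact: vdom_fi.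
Qed.

Lemma comm_mulVg : left_inverse comm_one comm_inv comm_mul.
Proof.
move=> a; rewrite -(vclass_repr a) comm_invE comm_mulE; apply/vclassP.
exists (vdom (repr a)); split=> //; first exact: vdom_fi.
  by move=> x dx; split=> //; split=> /=; exact: vfun_cod.
by move=> x dx /=; rewrite vinv_funK.
Qed.

Lemma comm_mulgV : right_inverse comm_one comm_inv comm_mul.
Proof.
move=> a; rewrite -(vclass_repr a) comm_invE comm_mulE; apply/vclassP.
exists (vcod (repr a)); split=> //; first exact: vcod_fi.
  by move=> x /[dup] cx /vinv_funP[dx e].
by move=> x /vinv_funP[_ e].
Qed.

HB.instance Definition _ :=
  isGroup.Build Comm comm_mulA comm_mul1g comm_mulg1 comm_mulVg comm_mulgV.

Lemma vclassM f g : vclass f * vclass g = vclass (vcomp f g).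
Proof. exact: comm_mulE. Qed.

(* The automorphisms of a finite index subgroup H are the virtual isomorphisms
   from H to H, so this is the image of Aut(H) -> Comm(G). *)
Definition aut_image (H : set G) : set Comm :=
  [set vclass f | f in [set f | vdom f = H /\ vcod f = H]].

Definition AComm : set Comm :=
  generated (\bigcup_(H in [set H | fi_subgroup H]) aut_image H).

End Commensurator.

Arguments AComm : clear implicits.

(* Main.v *)
From HB Require Import structures.
From mathcomp Require Import all_boot all_fingroup all_solvable integral_char.
From mathcomp Require Import ssralg ssrint zify.
Require Import Defs.
From mathcomp Require Import boolp classical_sets functions cardinality.

(** Write [inner g] for the class in Comm(F) of the conjugation by g; then
    c * inner g * c^-1 = inner (f g) whenever f represents c and is defined at g.

    Simplicity and the monolith. Let N be a non-trivial subgroup of Comm(F)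
    normalized by AComm(F). Commutators [c, inner g] = inner (f g * g^-1) show
    that N contains some [inner h] with h <> 1 ([meets_inner]). Spell a
    conjugate of h as a reduced word whose end letters avoid a generator b_i.
    The path of this word, with a b_i-loop at both ends, extends to a finite
    permutation representation of F, and Schreier's theorem gives a finite
    index subgroup U with a free basis containing both b_i and its conjugate by
    h ([moved_basis_element]). So N contains [inner] of a quotient of two basis
    elements of U, and transvections of U spread this to [inner] of all of U.
    Some power b_j^p lies in U; it is a basis element of a cyclic cover of
    degree p in which b_i, i <> j, is a basis element too, so N contains every
    [inner g] ([all_inner_in_N]).

    Now let H be free of finite index with basis b. In the double cover where
    b_j is unwrapped, an automorphism of H fixing b_j and preserving the
    subgroup spanned by the other b_i is s * (inner b_j * s * (inner b_j)^-1),
    where s acts like it on one sheet and is trivial on the other one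
    ([sheet_factorization]). If s is an involution this is a commutator with
    [inner b_j], so inversions and transpositions of basis elements are in N.
    For a transvection s, the commutator [s, inner b_j] is in N, and commuting
    it with one more transvection isolates a single transvection of the cover,
    conjugate to the inverse of s. By Nielsen's theorem N contains Aut(H) when
    the rank of H is at least 3. Finally every automorphism of a finite index
    subgroup restricts to a characteristic subgroup of large rank, so AComm(F)
    lies in N ([AComm_sub_normal]). For N normal in AComm(F) this is simplicity;
    for N normal in Comm(F) it says that the monolith contains AComm(F), which
    is itself normal ([AComm_normal]).

    Infinite index. For a finite group G let l(G) be the largest number of
    non-solvable factors in a subnormal series; l is additive on extensions
    ([length_morphim]). For W of finite index and a finite quotient p of F with
    kernel inside W, the number e(W) = l(p F) - l(p W) is independent of p, and
    e(W) - e(U) depends only on the isomorphism type of the inclusion of W in U.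
    Therefore an isomorphism U -> V has a well-defined charge e(V) - e(U), which
    is a homomorphism from Comm(F) to the integers and vanishes on each Aut(H).
    It does not vanish on an isomorphism from a point stabilizer of a surjection
    F -> S_5 to a normal subgroup of index 5: both have index 5, hence the same
    rank, but S_5 is not solvable ([comm_char_nontrivial]). So no power of that
    class is in AComm(F). A simple subgroup S of finite index in Comm(F) would
    meet AComm(F) in 1, which is excluded by the powers of [inner b_j], or be
    contained in AComm(F), which has infinite index. *)

Set Implicit Arguments.
Unset Strict Implicit.
Unset Printing Implicit Defensive.

Local Open Scope classical_set_scope.
Local Open Scope group_scope.

(** * Partial homomorphisms and free bases of subgroups *)

Definition group_simp (G : groupType) :=
  (@invgMG G, @invgK G, @mulgA G, @mulgK G, @mulgVK G, @mulgV G, @mulVg G,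
   @mul1g G, @mulg1 G, @invg1 G).

Definition mul_on (F K : groupType) (H : set F) (f : F -> K) :=
  forall x y, H x -> H y -> f (x * y) = f x * f y.

Section MulOn.
Variables (F K : groupType) (H : set F) (f : F -> K).
Hypotheses (sH : subgroup H) (fM : mul_on H f).

Lemma mul_on1 : f 1 = 1.
Proof.
have [H1 _ _] := sH.
by apply: (@mulgI _ (f 1)); rewrite -fM // !mulg1.
Qed.

Lemma mul_onV x : H x -> f x^-1 = (f x)^-1.
Proof.
have [_ _ HV] := sH => Hx; apply: (@mulgI _ (f x)).
by rewrite -fM ?mulgV ?mul_on1 //; exact: HV.
Qed.

Lemma mul_onX x n : H x -> H (x ^+ n) /\ f (x ^+ n) = f x ^+ n.
Proof.
have [H1 HM _] := sH => Hx; elim: n => [|n [IH e]].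
  by rewrite !expg0 mul_on1.
by rewrite !expgS fM ?e //; split=> //; exact: HM.
Qed.

Lemma subgroup_preim (A : set K) :
  subgroup A -> subgroup [set x | H x /\ A (f x)].
Proof.
move=> [A1 AM AV]; have [H1 HM HV] := sH; split.
- by rewrite /= mul_on1.
- move=> x y [Hx Ax] [Hy Ay]; split; first exact: HM.
  by rewrite fM //; exact: AM.
- by move=> x [Hx Ax]; split; [exact: HV | rewrite mul_onV //; exact: AV].
Qed.

End MulOn.

Lemma subgroupX (F : groupType) (H : set F) x n :
  subgroup H -> H x -> H (x ^+ n).
Proof. by move=> sH Hx; have [] := @mul_onX _ _ H id sH (fun _ _ _ _ => erefl) x n Hx. Qed.

Lemma mul_onS (F K : groupType) (H L : set F) (f : F -> K) :
  L `<=` H -> mul_on H f -> mul_on L f.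
Proof. by move=> LH fM x y /LH Hx /LH Hy; exact: fM. Qed.

(** Freeness of a subgroup is expressed inside the ambient group, with maps that
   are multiplicative on that subgroup only: nested subgroups and restrictions
   then need no change of type. The first three clauses say that b generates
   H, which makes the extension in the last one unique on H. *)
Definition free_on (F : groupType) (H : set F) (I : Type) (b : I -> F) :=
  [/\ subgroup H, (forall i, H (b i)),
      (forall A, subgroup A -> (forall i, A (b i)) -> H `<=` A) &
      forall (K : groupType) (h : I -> K),
        exists2 f : F -> K, mul_on H f & forall i, f (b i) = h i].

Section SubgroupType.
Variables (F : groupType) (A : set F) (sA : subgroup A).

Definition subgroup_type := {x : F | `[<A x>]}.
Definition in_subgroup (x : F) (Ax : `[<A x>]) : subgroup_type := exist _ x Ax.
HB.instance Definition _ := Choice.on subgroup_type.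

Let A1 : `[<A 1>]. Proof. by have [A1 _ _] := sA; apply/asboolP. Qed.

Let AM (x y : subgroup_type) : `[<A (val x * val y)>].
Proof.
have [_ AM _] := sA; have /asboolP Ax := valP x; have /asboolP Ay := valP y.
by apply/asboolP; exact: AM.
Qed.

Let AV (x : subgroup_type) : `[<A (val x)^-1>].
Proof.
have [_ _ AV] := sA; have /asboolP Ax := valP x.
by apply/asboolP; exact: AV.
Qed.

Definition subgroup_one : subgroup_type := in_subgroup A1.
Definition subgroup_mul (x y : subgroup_type) : subgroup_type :=
  in_subgroup (AM x y).
Definition subgroup_inv (x : subgroup_type) : subgroup_type := in_subgroup (AV x).

Lemma subgroup_mulA : associative subgroup_mul.
Proof. by move=> x y z; apply: val_inj; rewrite /= mulgA. Qed.
Lemma subgroup_mul1g : left_id subgroup_one subgroup_mul.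
Proof. by move=> x; apply: val_inj; rewrite /= mul1g. Qed.
Lemma subgroup_mulg1 : right_id subgroup_one subgroup_mul.
Proof. by move=> x; apply: val_inj; rewrite /= mulg1. Qed.
Lemma subgroup_mulVg : left_inverse subgroup_one subgroup_inv subgroup_mul.
Proof. by move=> x; apply: val_inj; rewrite /= mulVg. Qed.
Lemma subgroup_mulgV : right_inverse subgroup_one subgroup_inv subgroup_mul.
Proof. by move=> x; apply: val_inj; rewrite /= mulgV. Qed.

Definition subgroup_groupType : groupType := HB.pack subgroup_type
  (isGroup.Build subgroup_type subgroup_mulA subgroup_mul1g subgroup_mulg1
    subgroup_mulVg subgroup_mulgV).

Definition subgroup_val (x : subgroup_groupType) : F := val (x : subgroup_type).

Lemma subgroup_valP x : A (subgroup_val x).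
Proof. by apply/asboolP; exact: (valP (x : subgroup_type)). Qed.

End SubgroupType.

(** Generation comes from the uniqueness clause: the endomorphism of F that
   factors through a subgroup A containing the basis is the identity. *)
Lemma free_on_basis (F : groupType) (I : Type) (b : I -> F) :
  free_basis b -> free_on setT b.
Proof.
move=> hb; split=> // [A sA Ab x _|K h].
  have Ab' i : `[<A (b i)>] by apply/asboolP.
  have [phi [phib _]] := hb _ (fun i => in_subgroup (Ab' i) : subgroup_groupType sA).
  have [rho [_ rhoU]] := hb _ b.
  pose psi := @subgroup_val _ _ sA \o phi.
  have psiM : {morph psi : x y / x * y}.
    by move=> u v; rewrite /psi /= gmulfM.
  pose psim : {multiplicative F -> F} := HB.pack psi
    (isMultiplicative.Build _ _ psi psiM).
  pose idm : {multiplicative F -> F} := [the {multiplicative F -> F} of idfun].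
  have e1 : psim =1 rho by apply: rhoU => i; rewrite /= /psi /= phib.
  have e2 : idm =1 rho by apply: rhoU.
  have <- : psi x = x by have /= -> := e1 x; rewrite -(e2 x).
  exact: subgroup_valP.
have [phi [phib _]] := hb _ h.
by exists phi => // x y _ _; exact: gmulfM.
Qed.

Lemma free_on_agree (F K : groupType) (H : set F) (I : Type) (b : I -> F)
    (f g : F -> K) :
  free_on H b -> mul_on H f -> mul_on H g -> (forall i, f (b i) = g (b i)) ->
  forall x, H x -> f x = g x.
Proof.
move=> [sH Hb Hgen _] fM gM fg x Hx; have [H1 HM HV] := sH.
suff: [set x | H x /\ f x = g x] x by case.
apply: Hgen x Hx; last by move=> i; split.
split; first by split=> //; rewrite !(@mul_on1 _ _ H).
- move=> x y [Hx ex] [Hy ey]; split; first exact: HM.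
  by rewrite fM // gM // ex ey.
- move=> x [Hx ex]; split; first exact: HV.
  by rewrite (mul_onV sH fM) // (mul_onV sH gM) // ex.
Qed.

(** * The Reidemeister-Schreier theorem *)

Section Wreath.
Variables (K : groupType) (S : finType).

(** The permutational wreath product: functions on S times permutations of S,
   where permutations act on the right. *)
Definition wreath := ({ffun S -> K} * {perm S})%type.
HB.instance Definition _ := Choice.on wreath.

Implicit Types u v w : wreath.
Definition wreath_one : wreath := ([ffun => 1], 1).
Definition wreath_mul u v : wreath :=
  ([ffun s => u.1 s * v.1 (u.2 s)], u.2 * v.2).
Definition wreath_inv u : wreath := ([ffun s => (u.1 (u.2^-1 s))^-1], u.2^-1).

Lemma wreath_mulA : associative wreath_mul.
Proof.
move=> u v w; congr pair; rewrite /= ?mulgA //.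
by apply/ffunP => s; rewrite !ffunE permM mulgA.
Qed.
Lemma wreath_mul1g : left_id wreath_one wreath_mul.
Proof.
move=> [u p]; congr pair; rewrite /= ?mul1g //.
by apply/ffunP => s; rewrite !ffunE perm1 mul1g.
Qed.
Lemma wreath_mulg1 : right_id wreath_one wreath_mul.
Proof.
move=> [u p]; congr pair; rewrite /= ?mulg1 //.
by apply/ffunP => s; rewrite !ffunE mulg1.
Qed.
Lemma wreath_mulVg : left_inverse wreath_one wreath_inv wreath_mul.
Proof.
move=> [u p]; congr pair; rewrite /= ?mulVg //.
by apply/ffunP => s; rewrite !ffunE /= mulVg.
Qed.
Lemma wreath_mulgV : right_inverse wreath_one wreath_inv wreath_mul.
Proof.
move=> [u p]; congr pair; rewrite /= ?mulgV //.
by apply/ffunP => s; rewrite !ffunE /= permK mulgV.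
Qed.

HB.instance Definition _ := isGroup.Build wreath wreath_mulA wreath_mul1g
  wreath_mulg1 wreath_mulVg wreath_mulgV.

Lemma wreathM1 u v s : (u * v).1 s = u.1 s * v.1 (u.2 s).
Proof. by rewrite /= ffunE. Qed.
End Wreath.

Section Schreier.
Variables (F : groupType) (H : set F) (I : finType) (b : I -> F).
Hypothesis Hb : free_on H b.
Variables (S : finType) (r : S) (rho : F -> {perm S}).
Hypothesis rhoM : mul_on H rho.

Definition stabilizer : set F := [set x | H x /\ rho x r = r].

(** E is the edge set of a spanning tree, rooted at r, of the graph with an
   edge from s to [rho (b i) s] for all s and i; [t s] is the label of the tree
   path from r to s, and may cross edges in both directions; [dep] makes the
   recursion along these paths well-founded. *)
Definition schreier_tree (t : S -> F) (E : {set S * I}) (dep : S -> nat) :=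
  [/\ t r = 1, (forall s, H (t s)),
      (forall s i, (s, i) \in E -> t s * b i = t (rho (b i) s)) &
      forall s, s <> r -> exists s' i, dep s' < dep s /\
        ([/\ (s', i) \in E, s = rho (b i) s' & t s = t s' * b i] \/
         [/\ (s, i) \in E, s' = rho (b i) s & t s = t s' * (b i)^-1])].

Lemma rhoE x y s : H x -> H y -> rho (x * y) s = rho y (rho x s).
Proof. by move=> Hx Hy; rewrite rhoM // permM. Qed.

Lemma rhoVE x s : H x -> rho x^-1 s = (rho x)^-1 s.
Proof. by have [sH _ _ _] := Hb => Hx; rewrite (mul_onV sH rhoM). Qed.

Lemma subgroup_stabilizer : subgroup stabilizer.
Proof.
have [sH _ _ _] := Hb; have [H1 HM HV] := sH; split.
- by split=> //; rewrite (mul_on1 sH rhoM) perm1.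
- move=> x y [Hx ex] [Hy ey]; split; first exact: HM.
  by rewrite rhoE // ex.
- move=> x [Hx ex]; split; first exact: HV.
  by rewrite rhoVE // -{1}ex permK.
Qed.

Variables (t : S -> F) (E : {set S * I}) (dep : S -> nat).
Hypothesis tree : schreier_tree t E dep.

Definition schreier_gen (e : S * I) : F :=
  t e.1 * b e.2 * (t (rho (b e.2) e.1))^-1.

Lemma schreier_tP s : rho (t s) r = s.
Proof.
have [sH bH _ _] := Hb; have [H1 HM HV] := sH.
have [t1 tH tE tree'] := tree.
have [n] := ubnP (dep s); elim: n s => // n IH s /ltnSE ds.
have [->|/eqP/tree'[s' [i [d]]]] := eqVneq s r.
  by rewrite t1 (mul_on1 sH rhoM) perm1.
have IHs' : rho (t s') r = s' by apply: IH; exact: leq_trans ds.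
case=> [] [_ es ->].
  by rewrite rhoE // IHs' -es.
by rewrite rhoE ?rhoVE ?IHs' ?es ?permK //; exact: HV.
Qed.

Lemma schreier_stab e : stabilizer (schreier_gen e).
Proof.
have [sH bH _ _] := Hb; have [H1 HM HV] := sH.
have [t1 tH tE _] := tree; case: e => s i; rewrite /schreier_gen /=.
have HX : H (t s * b i) by apply: HM.
split; first by apply: HM => //; exact: HV.
rewrite rhoE //; last exact: HV.
by rewrite rhoVE // rhoE // schreier_tP -{2}(schreier_tP (rho (b i) s)) permK.
Qed.

(** The elements x such that [t s * x * (t (rho x s))^-1] is in A for every s
   form a subgroup, and it contains the basis b. *)
Lemma schreier_generate A : subgroup A ->
  (forall e, e \notin E -> A (schreier_gen e)) -> stabilizer `<=` A.
Proof.
have [sH bH bgen _] := Hb; have [H1 HM HV] := sH.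
have [t1 tH tE _] := tree => -[A1 AM AV] Ag x [Hx ex].
suff: [set x | H x /\ forall s, A (t s * x * (t (rho x s))^-1)] x.
  by move=> [_ /(_ r)]; rewrite ex t1 !group_simp.
move: x Hx {ex}; apply: bgen => [|i]; last first.
  split=> // s; have [e|e] := boolP ((s, i) \in E); last exact: (Ag _ e).
  by rewrite tE // mulgV.
split.
- by split=> // s; rewrite (mul_on1 sH rhoM) perm1 !group_simp.
- move=> x y [Hx Ax] [Hy Ay]; split=> [|s]; first exact: HM.
  rewrite rhoE //; have := AM _ _ (Ax s) (Ay (rho x s)).
  by rewrite !group_simp.
- move=> x [Hx Ax]; split=> [|s]; first exact: HV.
  have := AV _ (Ax (rho x^-1 s)); rewrite [in rho x _]rhoVE // permKV.
  by rewrite !group_simp.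
Qed.

(** To extend values h given on the edges outside the tree, let tree edges have
   value 1 and map [b i] to the element of the wreath product made of the values
   of all i-edges and the permutation [rho (b i)]. The component at r of the
   resulting map is the product of the edge values along a path from r: it is
   multiplicative on closed paths and trivial on tree paths. *)
Lemma schreier : free_on stabilizer
  (fun e : {e : S * I | e \notin E} => schreier_gen (val e)).
Proof.
have [sH bH bgen bext] := Hb; have [H1 HM HV] := sH.
have [t1 tH tE tree'] := tree; split.
- exact: subgroup_stabilizer.
- by move=> e; exact: schreier_stab.
- move=> A sA Ae; apply: schreier_generate => // e eE.
  exact: (Ae (exist _ e eE)).
move=> K h; pose g e : K := if insub e is Some e' then h e' else 1.
have gE e : e \in E -> g e = 1.
  by move=> eE; rewrite /g insubF // eE.
have [f fM fb] := bext (wreath K S : groupType)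
  (fun i => ([ffun s => g (s, i)], rho (b i)) : wreath K S).
have f2 x : H x -> (f x).2 = rho x.
  apply: (@free_on_agree _ _ _ _ _ (snd \o f) rho Hb) => //.
    by move=> u v Hu Hv /=; rewrite fM.
  by move=> i /=; rewrite fb.
have fbE i s : (f (b i)).1 s = g (s, i) by rewrite fb /= ffunE.
have f1M x y s : H x -> H y -> (f (x * y)).1 s = (f x).1 s * (f y).1 (rho x s).
  by move=> Hx Hy; rewrite fM // wreathM1 f2.
have f1V x s : H x -> (f x^-1).1 (rho x s) = ((f x).1 s)^-1.
  move=> Hx; apply: (@mulgI _ ((f x).1 s)).
  rewrite -f1M //; last exact: HV.
  by rewrite !mulgV (mul_on1 sH fM) /= ffunE.
have ft s : (f (t s)).1 r = 1.
  have [n] := ubnP (dep s); elim: n s => // n IH s /ltnSE ds.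
  have [->|/eqP/tree'[s' [i [d]]]] := eqVneq s r.
    by rewrite t1 (mul_on1 sH fM) /= ffunE.
  have IHs' : (f (t s')).1 r = 1 by apply: IH; exact: leq_trans ds.
  case=> [] [eE es ->].
    by rewrite f1M // IHs' schreier_tP fbE gE // mul1g.
  rewrite f1M //; last exact: HV.
  by rewrite IHs' schreier_tP es f1V // fbE gE // mul1g invg1.
exists (fun x => (f x).1 r).
  by move=> x y [Hx ex] [Hy ey]; rewrite f1M // ex.
move=> [[s i] eE]; rewrite /schreier_gen /=.
have Hs : H (t s * b i) by exact: HM.
rewrite f1M //; last exact: HV.
rewrite f1M // ft schreier_tP fbE rhoE // schreier_tP.
rewrite -{2}(schreier_tP (rho (b i) s)) f1V // ft !group_simp /g insubT /=.
by congr h; apply: val_inj.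
Qed.

End Schreier.

Section FiniteActions.
Variables (F : groupType) (H : set F) (I : finType) (b : I -> F).
Hypothesis Hb : free_on H b.

(** A permutation of a finite set that maps a subset into itself preserves it,
   so a subset closed under all edges would be invariant under H. *)
Lemma exit_edge (S : finType) (r : S) (rho : F -> {perm S}) (A : {set S}) :
    mul_on H rho -> (forall s, exists2 x, H x & rho x r = s) ->
    r \in A -> A != [set: S]%SET ->
  exists s i, s \in A /\ rho (b i) s \notin A.
Proof.
move=> rhoM trans rA AT; apply: contrapT => noexit.
have [sH bH bgen _] := Hb; have [H1 HM HV] := sH.
have stay s i : s \in A -> rho (b i) s \in A.
  by move=> sA; apply: contrapT => /negP e; apply: noexit; exists s, i.
have stayE s i : (rho (b i) s \in A) = (s \in A).
  have e : rho (b i) @: A = A.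
    apply/eqP; rewrite eqEcard card_imset ?leqnn ?andbT; last exact: perm_inj.
    by apply/fintype.subsetP => _ /imsetP[s' s'A ->]; exact: stay.
  by rewrite -{1}e mem_imset //; exact: perm_inj.
have inv x : H x -> forall s, (rho x s \in A) = (s \in A).
  move=> Hx; suff [//] : [set x | H x /\ forall s, (rho x s \in A) = (s \in A)] x.
  move: x Hx; apply: bgen => [|i]; last by split.
  split.
  - by split=> // s; rewrite (mul_on1 sH rhoM) perm1.
  - move=> x y [Hx ex] [Hy ey]; split=> [|s]; first exact: HM.
    by rewrite rhoM // permM ey ex.
  - move=> x [Hx ex]; split=> [|s]; first exact: HV.
    by rewrite (mul_onV sH rhoM) // -ex permKV.
by case/eqP: AT; apply/finset.setP => s; rewrite inE; have [x Hx <-] := trans s; rewrite inv.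
Qed.

(** The tree grows one edge at a time, hence the number of its edges. *)
Lemma schreier_tree_exists (S : finType) (r : S) (rho : F -> {perm S}) :
    mul_on H rho -> (forall s, exists2 x, H x & rho x r = s) ->
  exists t E dep, schreier_tree H b r rho t E dep /\ #|E|.+1 = #|S|.
Proof.
move=> rhoM trans; have [[H1 HM HV] bH _ _] := Hb.
have grow k : k < #|S| -> exists (A : {set S}) t (E : {set S * I}) (dep : S -> nat),
    [/\ #|A| = k.+1, #|E| = k, r \in A, t r = 1 & forall s, H (t s)] /\
    (forall s i, (s, i) \in E ->
      [/\ s \in A, rho (b i) s \in A & t s * b i = t (rho (b i) s)]) /\
    (forall s, s \in A -> s <> r -> exists s' i, [/\ s' \in A, dep s' < dep s,
      (s', i) \in E, s = rho (b i) s' & t s = t s' * b i]).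
  elim: k => [_|k IH kS].
    exists [set r]%SET, (fun=> 1), finset.set0, (fun=> 0).
    rewrite cards1 cards0 inE eqxx; split=> //; split=> [s i|s].
      by rewrite finset.in_set0.
    by rewrite finset.in_set1 => /eqP.
  have [A [t [E [dep [[cA cE rA t1 tH] [EP AP]]]]]] := IH (ltnW kS).
  have AT : A != [set: S]%SET.
    by apply/eqP => e; move: kS; rewrite -cardsT -e cA ltnn.
  have [s0 [i0 [s0A s1A]]] := exit_edge rhoM trans rA AT.
  set s1 := rho (b i0) s0 in s1A.
  have neq s : s \in A -> (s == s1) = false.
    by move=> sA; apply/negbTE; apply: contra s1A => /eqP <-.
  exists (s1 |: A), (fun s => if s == s1 then t s0 * b i0 else t s),
    ((s0, i0) |: E), (fun s => if s == s1 then (dep s0).+1 else dep s).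
  rewrite !cardsU1 s1A cA cE !inE rA orbT neq //.
  have -> : (s0, i0) \notin E by apply/negP => /EP[_]; rewrite (negbTE s1A).
  split; first by split=> // s; case: ifP => // _; exact: HM.
  split=> [s i|s].
    rewrite !inE => /orP[/eqP[-> ->]|/EP[sA s'A e]].
      by rewrite eqxx s0A orbT neq.
    by rewrite sA s'A !orbT !neq.
  rewrite !inE; have [->|s1s /= sA sr] := eqVneq s s1.
    by move=> _ _; exists s0, i0; rewrite !inE s0A orbT eqxx neq.
  have [s' [i [s'A ds' eE es ts]]] := AP s sA sr.
  by exists s', i; rewrite !inE s'A eE !orbT neq.
have S0 : #|S|.-1 < #|S| by rewrite prednK //; apply/card_gt0P; exists r.
have [A [t [E [dep [[cA cE rA t1 tH] [EP AP]]]]]] := grow _ S0.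
have AT s : s \in A.
  have /eqP -> : A == [set: S]%SET; last by rewrite inE.
  by rewrite eqEcard finset.subsetT cardsT cA prednK ?leqnn //; exact: leq_ltn_trans S0.
exists t, E, dep; split; last by rewrite cE prednK //; exact: leq_ltn_trans S0.
split=> // [s i /EP[]//|s sr].
have [s' [i [_ ? ? ? ?]]] := AP s (AT s) sr.
by exists s', i; split=> //; left.
Qed.

Lemma card_schreier_index (S : finType) (E : {set S * I}) :
  #|{: {e : S * I | e \notin E}}| = #|S| * #|I| - #|E|.
Proof.
rewrite card_sig -card_prod -(cardC (mem E)) addKn.
by apply: eq_card => e; rewrite !inE.
Qed.

End FiniteActions.

(** * Finite index subgroups *)

Lemma fi_fiber (F : groupType) (H W : set F) (T : finType) (c : F -> T) :
    fi_subgroup H -> subgroup W ->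
    (forall x y, H x -> H y -> c x = c y -> W (x^-1 * y)) -> fi_subgroup W.
Proof.
move=> [sH /(finite_indexP sH)[s sP]] sW cP; split=> //.
apply/finite_indexP => //.
pose rep a := xget 1 [set x | H x /\ c x = a].
exists [seq r * rep a | r <- s, a <- enum T] => g.
have [r rs Hr] := sP g; set a := c (r^-1 * g).
have [Ha ea] : [set x | H x /\ c x = a] (rep a).
  by apply: (@xgetPex _ 1 [set x | H x /\ c x = a]); exists (r^-1 * g).
exists (r * rep a); first by apply: allpairs_f => //; rewrite mem_enum.
by rewrite invgMG -mulgA; exact: cP.
Qed.

Lemma fi_stabilizer (F : groupType) (H : set F) (S : finType) (r : S)
    (rho : F -> {perm S}) :
  fi_subgroup H -> mul_on H rho -> fi_subgroup (stabilizer H r rho).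
Proof.
move=> fH rhoM; have [sH _] := fH; have [H1 HM HV] := sH.
apply: (fi_fiber (c := rho) fH).
  split.
  - by split=> //; rewrite (mul_on1 sH rhoM) perm1.
  - move=> x y [Hx ex] [Hy ey]; split; first exact: HM.
    by rewrite rhoM // permM ex.
  - move=> x [Hx ex]; split; first exact: HV.
    by rewrite (mul_onV sH rhoM) // -{1}ex permK.
move=> x y Hx Hy exy; split; first by apply: HM => //; exact: HV.
rewrite rhoM //; last exact: HV.
by rewrite (mul_onV sH rhoM) // exy mulVg perm1.
Qed.

Section CosetAction.
Variables (F : groupType) (H W : set F).
Hypotheses (sH : subgroup H) (fW : fi_subgroup W) (WH : W `<=` H).

(** Among the finite lists that meet all right cosets, a shortest one meets each
   of them once. *)
Lemma coset_reps : exists k (rep : 'I_k -> F), (forall i, H (rep i)) /\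
  forall x, H x -> exists i, W (x * (rep i)^-1) /\
    forall j, W (x * (rep j)^-1) -> j = i.
Proof.
have [H1 HM HV] := sH; have [sW /(finite_indexP sW)[s sP]] := fW.
have [W1 WM WV] := sW.
pose P k := `[< exists rep : 'I_k -> F, (forall i, H (rep i)) /\
  forall x, H x -> exists i, W (x * (rep i)^-1) >].
have exP : exists k, P k.
  pose s' := [seq r^-1 | r <- s & `[<H r>]].
  exists (size s'); apply/asboolP; exists (fun i => nth 1 s' i); split=> [i|x Hx].
    have /mapP[r] := mem_nth 1 (ltn_ord i).
    by rewrite mem_filter => /andP[/asboolP Hr _] ->; exact: HV.
  have [r rs Wr] := sP x^-1; have Wxr : W (x * r).
    by have := WV _ Wr; rewrite !group_simp.
  have Hr : H r.
    have -> : r = x^-1 * (x * r) by rewrite mulKg.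
    by apply: HM; [exact: HV | exact: WH].
  have rs' : r^-1 \in s'.
    by apply: map_f; rewrite mem_filter rs andbT; apply/asboolP.
  have ls : index r^-1 s' < size s' by rewrite index_mem.
  by exists (Ordinal ls); rewrite /= nth_index // invgK.
case: (ex_minnP exP) => k /asboolP[rep [Hrep repP]] kmin.
exists k, rep; split=> // x Hx; have [i Wi] := repP x Hx.
exists i; split=> // j Wj; apply: contrapT => ji.
have Wij : W (rep i * (rep j)^-1).
  by have := WM _ _ (WV _ Wi) Wj; rewrite !group_simp.
have k0 : 0 < k by exact: leq_ltn_trans (leq0n i) (ltn_ord i).
suff /kmin : P k.-1 by rewrite -ltnS prednK ?ltnn.
apply/asboolP; exists (fun l => rep (lift i l)); split=> // y Hy.
have [l Wl] := repP y Hy; case: (unliftP i l) => [l' e|e].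
  by exists l'; rewrite -e.
have /eqP ij : i <> j by move=> e'; apply: ji.
have [l' e' _] := unlift_some ij.
exists l'; rewrite -e'; have := WM _ _ Wl Wij.
by rewrite e !group_simp.
Qed.

Lemma coset_action : exists (S : finType) (r : S) (rho : F -> {perm S}),
  [/\ mul_on H rho, (forall s, exists2 x, H x & rho x r = s) &
      W = stabilizer H r rho].
Proof.
have [k [rep [Hrep repP]]] := coset_reps.
have [H1 HM HV] := sH; have [sW _] := fW; have [W1 WM WV] := sW.
have repP' i x : exists j, H x -> W (rep i * x * (rep j)^-1) /\
    forall l, W (rep i * x * (rep l)^-1) -> l = j.
  have [Hx|nHx] := pselect (H x); last by exists i.
  by have [j jP] := repP _ (HM _ _ (Hrep i) Hx); exists j.
have [a aP] := choice (fun ix => repP' ix.1 ix.2).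
pose act x i := a (i, x).
have actP x i : H x -> W (rep i * x * (rep (act x i))^-1).
  by move=> Hx; have [] := aP (i, x) Hx.
have actU x i j : H x -> W (rep i * x * (rep j)^-1) -> j = act x i.
  by move=> Hx; have [_] := aP (i, x) Hx; exact.
have actM x y i : H x -> H y -> act (x * y) i = act y (act x i).
  move=> Hx Hy; symmetry; apply: actU; first exact: HM.
  by have := WM _ _ (actP x i Hx) (actP y (act x i) Hy); rewrite !group_simp.
have act1 i : act 1 i = i by symmetry; apply: actU => //; rewrite !group_simp.
have act_inj x : injective (if `[<H x>] then act x else id).
  case: asboolP => [Hx|_] i j // e.
  by rewrite -(act1 i) -(act1 j) -(mulgV x) !actM ?e //; exact: HV.
pose rho x := perm (@act_inj x).
have rhoE x i : H x -> rho x i = act x i.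
  by move=> Hx; rewrite permE; case: asboolP.
have [r [Wr rU]] := repP 1 H1.
exists [the finType of 'I_k], r, rho; split=> [x y Hx Hy|s|].
- by apply/permP => i; rewrite permM !rhoE ?actM //; exact: HM.
- have Hx : H ((rep r)^-1 * rep s) by apply: HM => //; exact: HV.
  exists ((rep r)^-1 * rep s) => //; rewrite rhoE //; symmetry; apply: actU => //.
  by rewrite !group_simp.
have Wr' : W (rep r) by have := WV _ Wr; rewrite !group_simp.
apply/seteqP; split=> x.
  move=> Wx; have Hx := WH Wx; split=> //; rewrite rhoE //; symmetry.
  by apply: actU => //; exact: (WM _ _ (WM _ _ Wr' Wx) (WV _ Wr')). 
move=> [Hx]; rewrite rhoE // => e; have := actP x r Hx; rewrite e => Wx.
by have := WM _ _ (WM _ _ (WV _ Wr') Wx) Wr'; rewrite !group_simp.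
Qed.

End CosetAction.

Lemma free_fi_subgroup (F : groupType) (H W : set F) (I : finType) (b : I -> F) :
    free_on H b -> fi_subgroup W -> W `<=` H ->
  exists (J : finType) (c : J -> F), free_on W c /\
    (1 < #|I| -> W <> H -> 2 < #|J|).
Proof.
move=> Hb fW WH; have [sH _ _ _] := Hb.
have [S [r [rho [rhoM trans eW]]]] := coset_action sH fW WH.
have [t [E [dep [tree cE]]]] := schreier_tree_exists Hb rhoM trans.
exists [the finType of {e : S * I | e \notin E}]; eexists; split.
  by rewrite eW; exact: (schreier Hb rhoM tree).
move=> I1 WnH; rewrite card_schreier_index.
have S1 : 1 < #|S|.
  rewrite ltnNge; apply/negP => /card_le1P S1; apply: WnH.
  apply/seteqP; split=> // x Hx; rewrite eW; split=> //.
  by have /(_ (rho x r)) := S1 r isT; rewrite !inE => /esym/eqP.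
rewrite ltn_subRL -cE; rewrite -cE ltnS in S1.
apply: (@leq_trans (#|E|.+1 * 2)); last by rewrite leq_mul2l I1 orbT.
by lia.
Qed.

(** * Reduced words *)

(** The complements of A and of its image have the same size; match their
   enumerations. *)
Lemma perm_extend (T : finType) (A : {set T}) (f : T -> T) :
  {in A &, injective f} -> exists s : {perm T}, {in A, s =1 f}.
Proof.
move=> finj; pose B := enum (~: A); pose C := enum (~: f @: A)%SET.
have sBC : size B = size C.
  rewrite -!cardE; apply: (@addnI #|A|).
  by rewrite cardsC -(card_in_imset finj) cardsC.
pose g x := if x \in A then f x else nth x C (index x B).
have gC x : x \notin A -> index x B < size C /\ nth x C (index x B) \in C.
  move=> xA; have xB : x \in B by rewrite mem_enum finset.in_setC.
  have lt : index x B < size C by rewrite -sBC index_mem.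
  by split=> //; exact: mem_nth.
have CA x : x \in C -> x \notin f @: A by rewrite mem_enum finset.in_setC.
have ginj : injective g.
  move=> x y; rewrite /g; case: ifPn => xA; case: ifPn => yA e.
  - exact: finj.
  - by have [_] := gC y yA; rewrite -e => /CA/negP[]; exact: imset_f.
  - by have [_] := gC x xA; rewrite e => /CA/negP[]; exact: imset_f.
  have [lx _] := gC x xA; have [ly _] := gC y yA.
  have /eqP := e; rewrite (set_nth_default y) // nth_uniq ?enum_uniq //.
  have xB : x \in B by rewrite mem_enum finset.in_setC.
  have yB : y \in B by rewrite mem_enum finset.in_setC.
  by move=> /eqP e'; rewrite -(nth_index x xB) e' nth_index.
by exists (perm ginj) => x xA; rewrite permE /g xA.
Qed.

Section Words.
Variable I : eqType.
Implicit Types (l : I * bool) (w : seq (I * bool)).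

(* The letter (i, e) stands for the generator i, inverted when e is true. *)
Definition linv l := (l.1, ~~ l.2).
Definition winv w := rev (map linv w).
Definition reduced w := sorted (fun l l' => l' != linv l) w.

Lemma linvK : involutive linv. Proof. by case=> i e; rewrite /linv negbK. Qed.

Lemma linv_neq l : (l == linv l) = false.
Proof. by case: l => i []; rewrite /linv xpair_eqE andbF. Qed.

Lemma winvK : involutive winv.
Proof.
by move=> w; rewrite /winv map_rev revK -map_comp map_id_in // => l _; exact: linvK.
Qed.

Lemma size_winv w : size (winv w) = size w.
Proof. by rewrite size_rev size_map. Qed.

Lemma winv_cat w w' : winv (w ++ w') = winv w' ++ winv w.
Proof. by rewrite /winv map_cat rev_cat. Qed.

Lemma reduced_winv w : reduced (winv w) = reduced w.
Proof.
rewrite /reduced /winv rev_sorted sorted_map; apply: eq_sorted => l l' /=.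
by rewrite linvK eq_sym.
Qed.

Lemma reduced_cat w w' l0 : reduced (w ++ w') =
  [&& reduced w, reduced w' &
      (w == [::]) || (w' == [::]) || (head l0 w' != linv (last l0 w))].
Proof.
case: w => [|l w] /=; first by rewrite andbT.
rewrite /reduced /= cat_path; case: w' => [|l' w'] /=; first by rewrite !andbT.
by rewrite [X in _ && X]andbC.
Qed.

Lemma reduced_catl w w' : reduced (w ++ w') -> reduced w.
Proof. by case: w => // l w; rewrite /reduced /= cat_path => /andP[]. Qed.

Lemma reduced_catr w w' : reduced (w ++ w') -> reduced w'.
Proof.
by rewrite -reduced_winv winv_cat => /reduced_catl; rewrite reduced_winv.
Qed.

Lemma reduced_glue u v w : v != [::] ->
  reduced (u ++ v) -> reduced (v ++ w) -> reduced (u ++ v ++ w).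
Proof.
case: v => // l v _; have l0 := l.
rewrite (reduced_cat u _ l0) (reduced_cat u (_ ++ _) l0) => /and3P[-> _ /= h] -> /=.
exact: h.
Qed.

Lemma reduced_onth w k l l' :
  reduced w -> onth w k = Some l -> onth w k.+1 = Some l' -> l' != linv l.
Proof.
move=> rw; elim: k w rw => [|k IH] [|l1 w] //=.
  by case: w => // l2 w /= /andP[h _] [<-] [<-].
by move=> /path_sorted rw; exact: IH.
Qed.

End Words.

Arguments reduced_cat {I} w w' l0.

Section Evaluation.
Variables (F : groupType) (I : eqType) (b : I -> F).
Implicit Types (l : I * bool) (w : seq (I * bool)).

Definition lval l : F := if l.2 then (b l.1)^-1 else b l.1.
Definition ev w : F := foldr (fun l x => lval l * x) 1 w.

Lemma ev_cat w w' : ev (w ++ w') = ev w * ev w'.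
Proof. by elim: w => [|l w IH] /=; rewrite ?mul1g // IH mulgA. Qed.

Lemma lval_linv l : lval (linv l) = (lval l)^-1.
Proof. by case: l => i [] /=; rewrite /lval /= ?invgK. Qed.

Lemma ev_rcons w l : ev (rcons w l) = ev w * lval l.
Proof. by rewrite -cats1 ev_cat /= mulg1. Qed.

Lemma ev_winv w : ev (winv w) = (ev w)^-1.
Proof.
elim: w => [|l w IH]; first by rewrite /= invg1.
by rewrite /winv /= rev_cons ev_rcons IH lval_linv invgMG.
Qed.

Lemma ev_reduced w : exists2 w', reduced w' & ev w' = ev w.
Proof.
elim: w => [|l w [[|l' w'] rw' e]]; first by exists [::].
  by exists [:: l] => //=; rewrite -e.
have [el|nl] := eqVneq l' (linv l).
  exists w'; first exact: path_sorted rw'.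
  by rewrite /= -e el /= lval_linv mulKVg.
by exists (l :: l' :: w'); [rewrite /reduced /= nl; exact: rw' | rewrite /= -e].
Qed.

Lemma ev_in (H : set F) w : subgroup H -> (forall i, H (b i)) -> H (ev w).
Proof.
move=> [H1 HM HV] Hb; elim: w => //= -[i e] w IH; apply: HM => //.
by rewrite /lval; case: (e) => //=; apply: HV.
Qed.

Lemma ev_gen (H : set F) x :
    (forall A, subgroup A -> (forall i, A (b i)) -> H `<=` A) -> H x ->
  exists2 w, reduced w & ev w = x.
Proof.
move=> gen Hx; suff [w _ <-] : [set ev w | w in setT] x by exact: ev_reduced.
move: x Hx; apply: gen => [|i]; last by exists [:: (i, false)]; rewrite //= mulg1.
split; first by exists [::].
- by move=> _ _ [w _ <-] [w' _ <-]; exists (w ++ w'); rewrite ?ev_cat.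
- by move=> _ [w _ <-]; exists (winv w); rewrite ?ev_winv.
Qed.

Lemma ev_take w k l : onth w k = Some l -> ev (take k.+1 w) = ev (take k w) * lval l.
Proof.
elim: w k => [|l' w IH] [|k] //=; first by move=> [->]; rewrite take0 /= mulg1 mul1g.
by move=> /IH ->; rewrite mulgA.
Qed.

End Evaluation.

Section PathAction.
Variables (I : finType) (w : seq (I * bool)) (L : pred I).
Hypothesis rw : reduced w.
Hypothesis Lw : forall i e, L i ->
  onth w 0 <> Some (i, e) /\ onth w (size w).-1 <> Some (i, e).

(* A letter (i, false) read from the vertex k is an i-edge from k to k + 1, a
   letter (i, true) is an i-edge from k + 1 back to k; both ends of the path
   carry an additional i-loop when L i holds. *)
Let edge_out i k := onth w k == Some (i, false).
Let edge_in i k := (0 < k) && (onth w k.-1 == Some (i, true)).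
Let loop i k := L i && ((k == 0) || (k == size w)).

Let next i k : nat :=
  if edge_out i k then k.+1 else if edge_in i k then k.-1 else k.

Lemma onth_lt (l : I * bool) k : onth w k = Some l -> k < size w.
Proof. by elim: (w) k => [|l' w' IH] [|k] //= /IH. Qed.

Lemma onth_some k : k < size w -> exists l, onth w k = Some l.
Proof. by elim: (w) k => [|l' w' IH] [|k] //=; [move=> _; exists l' | move/IH]. Qed.

(** Two i-edges of the path with a common end would come from two consecutive
   letters that cancel. *)
Lemma path_next_inj i k k' :
    [|| edge_out i k, edge_in i k | loop i k] ->
    [|| edge_out i k', edge_in i k' | loop i k'] ->
  next i k = next i k' -> k = k'.
Proof.
suff W k1 k2 : [|| edge_out i k1, edge_in i k1 | loop i k1] ->
    [|| edge_out i k2, edge_in i k2 | loop i k2] ->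
    next i k1 = next i k2 -> k1 <= k2.
  by move=> h h' e; apply/eqP; rewrite eqn_leq !W.
rewrite /next; case: ifPn => [/eqP o1 _|_].
  case: ifPn => [_ _ e|_]; first lia.
  by case: ifPn => [/andP[k2_gt0 _] _ e|_ _ e]; lia.
case: ifPn => [/andP[k1_gt0 /eqP i1] _|_ /= /andP[Li h1]].
  case: ifPn => [/eqP o2 _ e|_].
    by rewrite e in i1; have := reduced_onth rw o2 i1; rewrite /linv eqxx.
  case: ifPn => [/andP[k2_gt0 _] _ e|_ /= /andP[Li h2] e]; first lia.
  case/orP: h2 => /eqP e2.
    by have [] := Lw true Li; rewrite -{1}e2 -e i1.
  by have := onth_lt i1; rewrite e e2 ltnn.
case: ifPn => [/eqP o2 _ e|_].
  case/orP: h1 => /eqP e1; first by rewrite e1 in e.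
  by have [_] := Lw false Li; rewrite -e1 e /= o2.
by case: ifPn => [/andP[k2_gt0 _] _ e|_ _ e]; lia.
Qed.

Lemma path_perms : exists p : I -> {perm 'I_(size w).+1},
  [/\ forall k i, onth w k = Some (i, false) -> p i (inord k) = inord k.+1,
      forall k i, onth w k = Some (i, true) -> p i (inord k.+1) = inord k &
      forall i, L i -> p i ord0 = ord0 /\ p i ord_max = ord_max].
Proof.
pose A i : {set 'I_(size w).+1} :=
  [set k : 'I_(size w).+1 | [|| edge_out i k, edge_in i k | loop i k]]%SET.
have next_lt i k : k < (size w).+1 -> next i k < (size w).+1.
  rewrite /next; case: ifP => [/eqP/onth_lt|_]; first by [].
  by case: ifP => // _; lia.
have [p pP] : {p : I -> {perm 'I_(size w).+1} |
    forall i, {in A i, p i =1 fun k => inord (next i k)}}.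
  suff /choice[p pP] : forall i, exists s : {perm 'I_(size w).+1},
      {in A i, s =1 fun k => inord (next i k)} by exists p.
  move=> i; apply: perm_extend => k k'; rewrite !finset.inE => Ak Ak' /(congr1 val).
  rewrite /= !inordK ?next_lt // => /(path_next_inj Ak Ak') e; exact: val_inj.
exists p; split=> [k i e|k i e|i Li].
- have lt := onth_lt e; have ltS := ltnW lt.
  by rewrite pP ?finset.inE /next inordK ?ltnS // /edge_out e eqxx.
- have lt := onth_lt e.
  have out : edge_out i k.+1 = false.
    apply/negP => /eqP o; have := reduced_onth rw e o.
    by rewrite /linv eqxx.
  by rewrite pP ?finset.inE /next inordK ?ltnS // out /edge_in /= e eqxx ?orbT.
have [L0 L1] := Lw false Li; have [L2 L3] := Lw true Li.
have notin k : k = 0 \/ k = size w -> edge_out i k = false /\ edge_in i k = false.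
  move=> ek; split; apply/negP; rewrite /edge_in.
    by case: ek => -> /eqP // /onth_lt; rewrite ltnn.
  by case: ek => -> // /andP[_ /eqP].
split; apply: val_inj; rewrite pP ?finset.inE /next /loop.
- by have [-> ->] := notin 0 (or_introl erefl); rewrite inord_val.
- by rewrite Li /= orbT.
- by have [-> ->] := notin _ (or_intror erefl); rewrite inord_val.
- by rewrite Li /= eqxx !orbT.
Qed.

End PathAction.

(** * Schreier bases adapted to a word or to a cyclic quotient *)

Section FreeWords.
Variables (F : groupType) (H : set F) (I : finType) (b : I -> F).
Hypothesis Hb : free_on H b.
Implicit Types w : seq (I * bool).

(** A reduced word, read from the start of its path, leads to the end. This is a
   finite permutation representation in which the word acts non-trivially. *)
Lemma path_action w (L : pred I) : reduced w ->
    (forall i e, L i -> onth w 0 <> Some (i, e) /\ onth w (size w).-1 <> Some (i, e)) ->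
  exists rho : F -> {perm 'I_(size w).+1}, [/\ mul_on H rho,
    forall k l, onth w k = Some l -> rho (lval b l) (inord k) = inord k.+1,
    forall k, k <= size w -> rho (ev b (take k w)) ord0 = inord k &
    forall i, L i -> rho (b i) ord0 = ord0 /\ rho (b i) ord_max = ord_max].
Proof.
move=> rw Lw; have [sH bH _ bext] := Hb; have [H1 HM HV] := sH.
have [p [p1 p2 p3]] := path_perms rw Lw.
have [rho rhoM rhob] := bext ({perm 'I_(size w).+1} : groupType) p.
have step k l : onth w k = Some l -> rho (lval b l) (inord k) = inord k.+1.
  case: l => i [] e; rewrite /lval /=; last by rewrite rhob p1.
  by rewrite (mul_onV sH rhoM) // rhob -(p2 _ _ e) permK.
have lvH l : H (lval b l) by case: l => i []; rewrite /lval //=; exact: HV.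
exists rho; split=> // [k|i Li]; last by rewrite rhob; exact: p3.
elim: k => [_|k IH lt].
  by rewrite take0 (mul_on1 sH rhoM) perm1; apply: val_inj; rewrite /= inordK.
have [l e] := onth_some lt.
rewrite (ev_take _ e) rhoM //; last exact: ev_in.
by rewrite permM IH ?step // ltnW.
Qed.

Lemma reduced_ev1 w : reduced w -> ev b w = 1 -> w = [::].
Proof.
move=> rw ew; have [sH _ _ _] := Hb.
have [//|rho [rhoM _ rhoT _]] := @path_action w pred0 rw.
have := rhoT _ (leqnn _); rewrite take_size ew (mul_on1 sH rhoM) perm1.
by move=> /(congr1 val); rewrite /= inordK // => /esym/size0nil.
Qed.

Lemma reduced_ev_inj w w' : reduced w -> reduced w' -> ev b w = ev b w' -> w = w'.
Proof.
elim: w w' => [|l w IH] [|l' w'] //.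
- by move=> _ rw' /esym e; rewrite (reduced_ev1 rw' e).
- by move=> rw _ e; rewrite (reduced_ev1 rw e).
move=> rw rw'; have [->|ll'] := eqVneq l l'.
  by move=> /= /mulgI e; congr cons; apply: IH (path_sorted rw) (path_sorted rw') e.
move=> e; have : ev b (winv (l :: w) ++ (l' :: w')) = 1.
  by rewrite ev_cat ev_winv e mulVg.
move/reduced_ev1; rewrite (reduced_cat _ _ l) reduced_winv rw rw' /=.
rewrite /winv /= rev_cons last_rcons linvK (eq_sym l') ll' orbT.
by move=> /(_ isT) /(congr1 size); rewrite size_cat /= addnS.
Qed.

Lemma free_b_neq1 i : b i <> 1.
Proof.
move=> e; have /reduced_ev1 : reduced [:: (i, false)] by [].
by rewrite /= mulg1 => /(_ e).
Qed.

Lemma free_b_inj i j : b i = b j -> i = j.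
Proof.
move=> e; have /(_ [:: (j, false)]) := @reduced_ev_inj [:: (i, false)].
by rewrite /= !mulg1 => /(_ isT isT e)[].
Qed.

Lemma free_bX_neq1 i n : b i ^+ n.+1 <> 1.
Proof.
have e : ev b (nseq n.+1 (i, false)) = b i ^+ n.+1.
  elim: n => [|n IH]; first by rewrite /= mulg1 expg1.
  by rewrite expgS -IH.
move=> e1; have /reduced_ev1 : reduced (nseq n.+1 (i, false)).
  rewrite /reduced; elim: (n) => //= m IH; rewrite IH andbT.
  by rewrite /linv xpair_eqE andbF.
by rewrite e => /(_ e1).
Qed.

(** The path of w is a spanning tree of the path action. When the end letters
   of w avoid i, both ends of the path carry an i-loop; these loops are edges
   outside the tree, so each of them yields a member of the Schreier basis. *)
Lemma two_loops w i : fi_subgroup H -> reduced w -> w != [::] ->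
    (forall e, onth w 0 <> Some (i, e) /\ onth w (size w).-1 <> Some (i, e)) ->
  exists U (J : finType) (c : J -> F) u v,
    [/\ fi_subgroup U, free_on U c, u <> v, c u = b i & c v = ev b w * b i * (ev b w)^-1].
Proof.
move=> fH rw wn wi; have [sH bH _ _] := Hb; have [H1 HM HV] := sH.
have Lw j e : pred1 i j -> onth w 0 <> Some (j, e) /\
    onth w (size w).-1 <> Some (j, e) by move=> /eqP ->.
have [rho [rhoM step rhoT loops]] := path_action rw Lw.
have [loop0 loop1] := loops i (eqxx i).
have size_gt0 : 0 < size w by rewrite lt0n size_eq0.
pose t (k : 'I_(size w).+1) := ev b (take k w).
pose E := [set e : 'I_(size w).+1 * I | (onth w e.1 == Some (e.2, false)) ||
  (0 < e.1) && (onth w e.1.-1 == Some (e.2, true))]%SET.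
have tree : schreier_tree H b ord0 rho t E (@nat_of_ord _).
  split=> [|s|s j|s s0]; rewrite /t.
  - by rewrite take0.
  - exact: ev_in.
  - rewrite finset.inE /= => /orP[/eqP e|/andP[s_gt0 /eqP e]].
      have lt := onth_lt e; have := step _ _ e; rewrite inord_val /lval /= => ->.
      by rewrite inordK // (ev_take _ e).
    have lt := onth_lt e; rewrite -{1}(prednK s_gt0) (ev_take _ e) /lval /= mulgVK.
    have := step _ _ e; rewrite prednK // inord_val /lval /= (mul_onV sH rhoM) //.
    by move=> /(congr1 (rho (b j))); rewrite permKV => <-; rewrite inordK // ltnW.
  have s_gt0 : 0 < s by rewrite lt0n; apply/eqP => e; apply: s0; exact: val_inj.
  have lt : s.-1 < size w by have := ltn_ord s; lia.
  have [[j e] el] := onth_some lt; have := step _ _ el.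
  have ts := ev_take b el; rewrite prednK // in ts *; rewrite inord_val => st.
  exists (inord s.-1), j; rewrite inordK ?ltnS; last exact: ltnW.
  split; first by rewrite prednK.
  rewrite !finset.inE /= inordK ?ltnS; last exact: ltnW.
  case: e el st ts => el; rewrite /lval /= => st ts; [right|left].
    rewrite s_gt0 el eqxx orbT; split=> //.
    by rewrite (mul_onV sH rhoM) // in st; rewrite -[in RHS]st permKV.
  by rewrite el eqxx; split.
have fr := schreier Hb rhoM tree.
have n0 : (ord0, i) \notin E.
  rewrite finset.inE /=; apply/negP => /orP[/eqP|//].
  by have [] := wi false.
have n1 : (ord_max, i) \notin E.
  rewrite finset.inE /=; apply/negP => /orP[/eqP/onth_lt|]; first by rewrite ltnn.
  by move=> /andP[_ /eqP]; have [] := wi true.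
pose u : {e | e \notin E} :=
  exist (fun e => is_true (e \notin E)) _ n0.
pose v : {e | e \notin E} :=
  exist (fun e => is_true (e \notin E)) _ n1.
exists (stabilizer H ord0 rho), [the finType of {e | e \notin E}],
  (fun e => schreier_gen b rho t (val e)), u, v.
split=> //; first exact: fi_stabilizer.
- by move=> /(congr1 val) [] e; rewrite -e in size_gt0.
- by rewrite /schreier_gen /= loop0 /t take0 /= !group_simp.
- by rewrite /schreier_gen /= loop1 /t take_size.
Qed.

End FreeWords.

Section CyclicCover.
Variables (F : groupType) (H : set F) (I : finType) (b : I -> F).
Hypotheses (Hb : free_on H b) (fH : fi_subgroup H).

Lemma ord_perm_cycle k (n : nat) : (perm (@ordS_inj k.+1) ^+ n) ord0 = inord (n %% k.+1).
Proof.
elim: n => [|n IH]; first by rewrite expg0 perm1 mod0n; apply: val_inj; rewrite /= inordK.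
rewrite expgSr permM IH permE; apply: val_inj.
by rewrite /= !inordK ?ltn_pmod // -addn1 modnDml addn1.
Qed.

(** The kernel of the map from H to the cyclic group of order k + 1 that sends
   [b j] to a generator and the other basis elements to 1, with the powers of
   [b j] as Schreier transversal. The index [v s i] is the copy of i on the sheet
   s, and [j0] is the loop that runs through all the sheets. *)
Lemma cyclic_cover k (j : I) : exists K (J : finType) (c : J -> F) (j0 : J)
    (v : 'I_k.+1 -> I -> J),
  [/\ fi_subgroup K, K `<=` H, free_on K c, c j0 = b j ^+ k.+1 &
  [/\ forall s i, i <> j -> c (v s i) = b j ^+ s * b i * (b j ^+ s)^-1,
      forall s i, i <> j -> v s i <> j0,
      forall s i s' i', i <> j -> i' <> j -> v s i = v s' i' -> s = s' /\ i = i' &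
      forall e, e = j0 \/ exists s i, i <> j /\ e = v s i]].
Proof.
have [sH bH _ bext] := Hb; have [H1 HM HV] := sH.
pose cyc := perm (@ordS_inj k.+1).
have [rho rhoM rhob] := bext ({perm 'I_k.+1} : groupType)
  (fun i => if i == j then cyc else 1).
have rhoj s : rho (b j) s = ordS s by rewrite rhob eqxx permE.
have rhoi i s : i <> j -> rho (b i) s = s.
  by move=> /eqP/negbTE ij; rewrite rhob ij perm1.
pose t (s : 'I_k.+1) := b j ^+ s.
pose E := [set e : 'I_k.+1 * I | (e.1 < k) && (e.2 == j)]%SET.
have ordSE (s : 'I_k.+1) : s < k -> ordS s = s.+1 :> nat.
  by move=> sk; rewrite /= modn_small.
have tree : schreier_tree H b ord0 rho t E (@nat_of_ord _).
  split=> [|s|s i|s s0]; rewrite /t.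
  - by rewrite expg0.
  - exact: subgroupX.
  - by rewrite finset.inE => /andP[/= sk /eqP ->]; rewrite rhoj ordSE // expgSr.
  have s_gt0 : 0 < s by rewrite lt0n; apply/eqP => e; apply: s0; exact: val_inj.
  have lt : s.-1 < k by have := ltn_ord s; lia.
  have e : (inord s.-1 : 'I_k.+1) = s.-1 :> nat by rewrite inordK // ltnW.
  exists (inord s.-1), j; rewrite e prednK //; split=> //; left.
  rewrite finset.inE /= e lt eqxx; split=> //.
    by apply: ord_inj; rewrite rhoj ordSE e ?prednK // -ltnS ltn_ord.
  by rewrite -expgSr prednK.
have fr := schreier Hb rhoM tree.
have n0 : (ord_max, j) \notin E by rewrite finset.inE /= ltnn.
have nv s i : i <> j -> (s, i) \notin E.
  by move=> /eqP/negbTE ij; rewrite finset.inE /= ij andbF.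
pose j0 : {e | e \notin E} :=
  exist (fun e => is_true (e \notin E)) _ n0.
pose v s i : {e | e \notin E} := insubd j0 (s, i).
have vE s i : i <> j -> val (v s i) = (s, i) by move=> ij; rewrite insubdK //; exact: nv.
exists (stabilizer H ord0 rho), [the finType of {e | e \notin E}],
  (fun e => schreier_gen b rho t (val e)), j0, v; split=> //.
- exact: fi_stabilizer.
- by move=> x [].
- rewrite /schreier_gen /= rhoj /t /= modnn expg0 invg1 mulg1.
  by rewrite -expgSr.
split.
- by move=> s i ij; rewrite /schreier_gen vE //= rhoi.
- by move=> s i ij /(congr1 val); rewrite vE // => -[_].
- by move=> s i s' i' ij ij' /(congr1 val); rewrite !vE // => -[].
move=> [[s i] eE]; have [ij|ij] := eqVneq i j; [left|right].
  apply: val_inj => /=; rewrite ij; congr pair; apply: val_inj => /=.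
  move: eE; rewrite finset.inE /= ij eqxx andbT -leqNgt => ks.
  by apply/eqP; rewrite eqn_leq ks -ltnS ltn_ord.
by exists s, i; split; [exact/eqP | apply: val_inj; rewrite vE //; exact/eqP].
Qed.

End CyclicCover.

Lemma fi_power (F : groupType) (W : set F) (x : F) :
  fi_subgroup W -> exists p, W (x ^+ p.+1).
Proof.
move=> [sW /(finite_indexP sW)[s sP]]; have [W1 WM WV] := sW.
have /choice[r rP] : forall k, exists r, r \in s /\ W (r^-1 * x ^+ k).
  by move=> k; have [r] := sP (x ^+ k); exists r.
pose rs := [seq r k | k <- iota 0 (size s).+1].
have /uniqPn : ~~ uniq rs.
  apply/negP => u; have := uniq_leq_size u (s2 := s).
  rewrite size_map size_iota ltnn => h; suff : false by [].
  by apply: h => y /mapP[k _ ->]; have [] := rP k.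
move=> /(_ 1)[i [j [ij]]]; rewrite size_map size_iota => js.
rewrite !(nth_map 0) ?size_iota // ?(ltn_trans ij js) // !nth_iota // ?(ltn_trans ij js) //.
rewrite !add0n => e; exists (j - i).-1; rewrite prednK ?subn_gt0 //.
have [_ Wi] := rP i; have [_] := rP j; rewrite -e => Wj.
have := WM _ _ (WV _ Wi) Wj; rewrite !group_simp.
by rewrite -{1}(subnKC (ltnW ij)) expgnDr mulKg.
Qed.

(** Every homomorphism from H to the symmetric group of a fixed degree is
   determined by the images of a finite basis, so the intersection of all their
   kernels has finite index, and it is invariant under every endomorphism. *)
Lemma characteristic_subgroup (F : groupType) (H W : set F) (I : finType) (b : I -> F) :
    free_on H b -> fi_subgroup H -> fi_subgroup W ->
  exists L, [/\ fi_subgroup L, L `<=` H, L `<=` W &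
    forall phi : F -> F, mul_on H phi -> (forall x, H x -> H (phi x)) ->
      forall x, L x -> L (phi x)].
Proof.
move=> Hb fH fW; have [sH bH _ bext] := Hb; have [H1 HM HV] := sH.
have WH : H `&` W `<=` H by move=> x [].
have [S [r [rho [rhoM _ eW]]]] := coset_action sH (fi_subgroupI fH fW) WH.
have /choice[f fP] : forall h : {ffun I -> {perm S}}, exists f : F -> {perm S},
    mul_on H f /\ forall i, f (b i) = h i.
  by move=> h; have [f fM fb] := bext ({perm S} : groupType) h; exists f.
exists [set x | H x /\ forall g : F -> {perm S}, mul_on H g -> g x = 1]; split.
- apply: (fi_fiber (c := fun x => [ffun h => f h x]) fH).
    split.
    + by split=> // g gM; exact: mul_on1 sH gM.
    + move=> x y [Hx ex] [Hy ey]; split=> [|g gM]; first exact: HM.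
      by rewrite gM // ex // ey // mulg1.
    + move=> x [Hx ex]; split=> [|g gM]; first exact: HV.
      by rewrite (mul_onV sH gM) // ex // invg1.
  move=> x y Hx Hy /ffunP e; split=> [|g gM]; first by apply: HM => //; exact: HV.
  rewrite gM //; last exact: HV.
  rewrite (mul_onV sH gM) //; pose h := [ffun i => g (b i)].
  have [fM fb] := fP h.
  have ge z : H z -> g z = f h z.
    by apply: (free_on_agree Hb gM fM) => i; rewrite fb ffunE.
  by rewrite !ge //; have := e h; rewrite !ffunE => ->; rewrite mulVg.
- by move=> x [].
- move=> x [Hx ex]; suff : (H `&` W) x by case.
  by rewrite eW; split=> //; rewrite ex // perm1.
move=> phi phiM phiH x [Hx ex]; split=> [|g gM]; first exact: phiH.
apply: (ex (g \o phi)) => y z Hy Hz /=.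
by rewrite phiM // gM //; exact: phiH.
Qed.

(** * Elements of the commensurator and the maps representing them *)

Section Represents.
Variable F : groupType.
Implicit Types (c d : Comm F) (W : set F) (f g : F -> F).

(** With explicit functions and domains, products and inverses in the
   commensurator become compositions and inverses of functions as soon as the
   domains are nested. *)
Definition represents c W f := exists phi : viso F,
  [/\ vclass phi = c, fi_subgroup W, W `<=` vdom phi &
      forall x, W x -> vfun phi x = f x].

Lemma rep_mul_on c W f : represents c W f -> mul_on W f.
Proof.
move=> [phi [_ [[_ WM _] _] Wd e]] x y Wx Wy.
by rewrite -!e //; [apply: vfunM; exact: Wd | exact: WM].
Qed.

Lemma rep_inj c W f x y : represents c W f -> W x -> W y -> f x = f y -> x = y.
Proof.
move=> [phi [_ _ Wd e]] Wx Wy; rewrite -!e //.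
by apply: vfun_inj; exact: Wd.
Qed.

Lemma rep_uniq c d W f g : represents c W f -> represents d W g ->
  (forall x, W x -> f x = g x) -> c = d.
Proof.
move=> [phi [<- fW Wd e]] [psi [<- _ Wd' e']] fg; apply/vclassP.
by exists W; split=> // x Wx; rewrite e // fg // e'.
Qed.

Lemma rep_mul c d W V f g : represents c W f -> represents d V g ->
  (forall x, V x -> W (g x)) -> represents (c * d) V (f \o g).
Proof.
move=> [phi [<- fW Wd ef]] [psi [<- fV Vd eg]] VW.
exists (vcomp phi psi); split=> //; first by rewrite vclassM.
  move=> x Vx; split; first exact: Vd.
  by split; [exact/vfun_cod/Vd | rewrite eg //; exact/Wd/VW].
by move=> x Vx /=; rewrite eg // ef //; exact: VW.
Qed.

Lemma rep_inv c W V f g : represents c W f -> fi_subgroup V ->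
  (forall y, V y -> W (g y) /\ f (g y) = y) -> represents c^-1 V g.
Proof.
move=> [phi [<- fW Wd ef]] fV h; exists (vinv phi); split=> //.
- by rewrite -comm_invE.
- move=> y Vy; have [Wg <-] := h y Vy; rewrite -ef //.
  exact/vfun_cod/Wd.
- move=> y Vy; have [Wg e] := h y Vy; rewrite -{1}e -ef //=.
  by rewrite vinv_funK //; exact: Wd.
Qed.

Lemma rep_free_eq c d W f g (I : Type) (b : I -> F) : free_on W b ->
  represents c W f -> represents d W g -> (forall i, f (b i) = g (b i)) -> c = d.
Proof.
move=> Wb rf rg e; apply: (rep_uniq rf rg).
exact: (free_on_agree Wb (rep_mul_on rf) (rep_mul_on rg)).
Qed.

Lemma inner_bij (g : F) : set_bij setT setT (fun x => g * x * g^-1).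
Proof.
split=> // [x y _ _ /mulIg/mulgI //|y _].
by exists (g^-1 * y * g); rewrite ?group_simp.
Qed.

Lemma inner_mul (g : F) :
  forall x y, setT x -> setT y -> g * (x * y) * g^-1 = g * x * g^-1 * (g * y * g^-1).
Proof. by move=> x y _ _; rewrite !group_simp. Qed.

Definition inner (g : F) : Comm F :=
  vclass (Viso (fi_subgroupT F) (fi_subgroupT F) (@inner_mul g) (inner_bij g)).

Lemma rep_inner (g : F) W :
  fi_subgroup W -> represents (inner g) W (fun x => g * x * g^-1).
Proof. by move=> fW; eexists; split; [reflexivity| | |]. Qed.

Lemma rep_one W : fi_subgroup W -> represents 1 W id.
Proof. by move=> fW; exists (vid F). Qed.

Lemma innerM x y : inner (x * y) = inner x * inner y.
Proof.
have fT := fi_subgroupT F.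
apply: (rep_uniq (rep_inner _ fT) (rep_mul (rep_inner x fT) (rep_inner y fT) _)) => //.
by move=> z _ /=; rewrite !group_simp.
Qed.

Lemma inner1 : inner 1 = 1.
Proof. by apply: (@mulgI _ (inner 1)); rewrite -innerM !mulg1. Qed.

Lemma innerV x : inner x^-1 = (inner x)^-1.
Proof. by apply: (@mulgI _ (inner x)); rewrite -innerM !mulgV inner1. Qed.

Lemma innerX x n : inner (x ^+ n) = inner x ^+ n.
Proof. by elim: n => [|n IH]; rewrite ?expg0 ?inner1 // !expgS innerM IH. Qed.

Lemma inner_conj c W f x :
  represents c W f -> W x -> c * inner x * c^-1 = inner (f x).
Proof.
move=> rf Wx; have fM := rep_mul_on rf; have [_ [_ fW _ _]] := rf.
have [sW _] := fW; have [W1 WM WV] := sW.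
apply: (@mulIg _ c); rewrite mulgVK.
have r1 := rep_mul rf (rep_inner x fW) (fun y Wy => WM _ _ (WM _ _ Wx Wy) (WV _ Wx)).
have r2 := rep_mul (rep_inner (f x) (fi_subgroupT F)) rf (fun _ _ => I).
apply: (rep_uniq r1 r2) => y Wy /=.
by rewrite (fM _ _ (WM _ _ Wx Wy) (WV _ Wx)) (mul_onV sW fM) // fM.
Qed.

Definition is_aut W f := [/\ fi_subgroup W, mul_on W f & set_bij W W f].

Lemma aut_class W f : is_aut W f -> exists2 c, AComm F c & represents c W f.
Proof.
move=> [fW fM fbij]; pose phi := Viso fW fW fM fbij.
exists (vclass phi); last by exists phi; split.
move=> A [sA AP]; apply: (AP (vclass phi)); exists W; first exact: fW.
by exists phi.
Qed.

Lemma subgroup_AComm : subgroup (AComm F).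
Proof.
split.
- by move=> A [[A1 _ _] _].
- move=> x y Ax Ay A [sA AP]; have [_ AM _] := sA.
  by apply: AM; [exact: Ax | exact: Ay].
- move=> x Ax A [sA AP]; have [_ _ AV] := sA.
  by apply: AV; exact: Ax.
Qed.

Lemma AComm_inner x : AComm F (inner x).
Proof.
have [c Ac rc] : exists2 c, AComm F c & represents c setT (fun y => x * y * x^-1).
  apply: aut_class; split; [exact: fi_subgroupT|exact: inner_mul|exact: inner_bij].
by rewrite (rep_uniq (rep_inner x (fi_subgroupT F)) rc _).
Qed.

End Represents.

(** * Elementary automorphisms of a free subgroup *)

Section Elementary.
Variables (F : groupType) (W : set F) (I : finType) (b : I -> F).
Hypotheses (Wb : free_on W b) (fW : fi_subgroup W).

Lemma free_on_stable (f : F -> F) :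
  mul_on W f -> (forall i, W (f (b i))) -> forall x, W x -> W (f x).
Proof.
have [sW bW bgen _] := Wb => fM fb x Wx.
suff [] : [set y | W y /\ W (f y)] x by [].
move: x Wx; apply: bgen => [|i]; last by split.
exact: (subgroup_preim sW fM sW).
Qed.

(** Two tuples that are inverse to each other as substitutions define mutually
   inverse automorphisms. *)
Lemma tuple_aut (h h' : I -> F) :
    (forall i, W (h i)) -> (forall i, W (h' i)) ->
    (forall f, mul_on W f -> (forall i, f (b i) = h i) -> forall i, f (h' i) = b i) ->
    (forall f, mul_on W f -> (forall i, f (b i) = h' i) -> forall i, f (h i) = b i) ->
  exists2 f, is_aut W f & forall i, f (b i) = h i.
Proof.
have [sW bW bgen bext] := Wb => Wh Wh' hh' h'h.
have [f fM fb] := bext F h; have [g gM gb] := bext F h'.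
have fW' : forall x, W x -> W (f x) by apply: free_on_stable => // i; rewrite fb.
have gW' : forall x, W x -> W (g x) by apply: free_on_stable => // i; rewrite gb.
have fg x : W x -> f (g x) = x.
  apply: (free_on_agree Wb (f := f \o g) (g := id)) x => //.
    by move=> x y Wx Wy /=; rewrite gM ?fM //; exact: gW'.
  by move=> i /=; rewrite gb hh'.
have gf x : W x -> g (f x) = x.
  apply: (free_on_agree Wb (f := g \o f) (g := id)) x => //.
    by move=> x y Wx Wy /=; rewrite fM ?gM //; exact: fW'.
  by move=> i /=; rewrite fb h'h.
exists f => //; split=> //; split=> [x /fW' //|x y|y Wy].
  by rewrite !inE => Wx Wy e; rewrite -(gf x) // e gf.
by exists (g y); [exact: gW' | exact: fg].
Qed.

Definition upd (i : I) (x : F) : I -> F := fun k => if k == i then x else b k.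

(** The elements of W that are words in the basis elements other than [b i], in
   the form that is needed to evaluate an automorphism that moves [b i] only. *)
Definition fixed_off (i : I) (x : F) := W x /\ forall f, mul_on W f ->
  (forall k, k <> i -> f (b k) = b k) -> f x = x.

Lemma fixed_off_b i k : k <> i -> fixed_off i (b k).
Proof. by have [_ bW _ _] := Wb => ki; split=> // f _; exact. Qed.

Lemma subgroup_fixed_off i : subgroup (fixed_off i).
Proof.
have [sW _ _ _] := Wb; have [W1 WM WV] := sW; split.
- by split=> // f fM _; exact: mul_on1 sW fM.
- move=> x y [Wx ex] [Wy ey]; split=> [|f fM fb]; first exact: WM.
  by rewrite fM // ex // ey.
- move=> x [Wx ex]; split=> [|f fM fb]; first exact: WV.
  by rewrite (mul_onV sW fM) // ex.
Qed.

Lemma transvection_aut i x y : fixed_off i x -> fixed_off i y ->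
  exists2 f, is_aut W f & forall k, f (b k) = upd i (x * b i * y) k.
Proof.
have [sW bW _ _] := Wb; have [W1 WM WV] := sW => ax ay.
have [_ fxM fxV] := subgroup_fixed_off i.
have key u v : fixed_off i u -> fixed_off i v ->
    (forall k, W (upd i (u * b i * v) k)) /\
    forall f, mul_on W f -> (forall k, f (b k) = upd i (u * b i * v) k) ->
      forall k, f (upd i (u^-1 * b i * v^-1) k) = b k.
  move=> au av; have [Wu _] := au; have [Wv _] := av.
  split=> [k|f fM fb k].
    rewrite /upd; case: ifP => // _; apply: (WM) => //; exact: (WM).
  have fx z : fixed_off i z -> f z = z.
    move=> [_ ez]; apply: ez => // l /eqP/negbTE li.
    by rewrite fb /upd li.
  rewrite {1}/upd; case: eqVneq => [->|ki]; last by rewrite fb /upd (negbTE ki).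
  have Wu' := WV _ Wu; have Wv' := WV _ Wv.
  rewrite fM //; last exact: WM.
  rewrite fM // (fx _ (fxV _ au)) (fx _ (fxV _ av)).
  by rewrite fb /upd eqxx !group_simp.
have [h1 h2] := key x y ax ay; have [h1' h2'] := key _ _ (fxV _ ax) (fxV _ ay).
apply: (@tuple_aut _ (upd i (x^-1 * b i * y^-1))) => // f fM fb k.
by have := h2' f fM fb k; rewrite !invgK.
Qed.

Lemma inversion_aut i :
  exists2 f, is_aut W f & forall k, f (b k) = upd i (b i)^-1 k.
Proof.
have [sW bW _ _] := Wb; have [W1 WM WV] := sW.
have key f : mul_on W f -> (forall k, f (b k) = upd i (b i)^-1 k) ->
    forall k, f (upd i (b i)^-1 k) = b k.
  move=> fM fb k; rewrite {1}/upd; case: eqVneq => [->|ki].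
    by rewrite (mul_onV sW fM) // fb /upd eqxx invgK.
  by rewrite fb /upd (negbTE ki).
have Wu k : W (upd i (b i)^-1 k) by rewrite /upd; case: ifP => // _; exact: WV.
exact: (@tuple_aut _ (upd i (b i)^-1)).
Qed.

Lemma perm_aut (s : {perm I}) :
  exists2 f, is_aut W f & forall k, f (b k) = b (s k).
Proof.
have [_ bW _ _] := Wb.
apply: (@tuple_aut _ (fun k => b (s^-1 k))) => // f fM fb k.
  by rewrite /= fb permKV.
by rewrite /= fb permK.
Qed.

End Elementary.

(** * Automorphisms seen in a double cover *)

Lemma double_cover (F : groupType) (H : set F) (I : finType) (b : I -> F) (j : I) :
    free_on H b -> fi_subgroup H ->
  exists K (J : finType) (c : J -> F) (j0 : J) (v0 v1 : I -> J),
  [/\ fi_subgroup K, K `<=` H, free_on K c, c j0 = b j * b j &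
  [/\ forall i, i <> j -> c (v0 i) = b i,
      forall i, i <> j -> c (v1 i) = b j * b i * (b j)^-1,
      forall i, i <> j -> v0 i <> j0 /\ v1 i <> j0,
      forall i i', i <> j -> i' <> j -> [/\ v0 i = v0 i' -> i = i',
        v1 i = v1 i' -> i = i' & v0 i <> v1 i'] &
      forall e, e = j0 \/ exists i, i <> j /\ (e = v0 i \/ e = v1 i)]].
Proof.
move=> Hb fH.
have [K [J [c [j0 [v [fK KH Kc cj0 [cv vj0 vinj ve]]]]]]] := cyclic_cover Hb fH 1 j.
exists K, J, c, j0, (v ord0), (v ord_max); split=> //.
split.
- by move=> i ij; rewrite cv // expg0 !group_simp.
- by move=> i ij; rewrite cv // expg1.
- by move=> i ij; split; exact: vj0.
- move=> i i' ij ij'; split.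
  + by move=> /(vinj _ _ _ _ ij ij')[].
  + by move=> /(vinj _ _ _ _ ij ij')[].
  + by move=> /(vinj _ _ _ _ ij ij')[].
move=> e; have [->|[s [i [ij ->]]]] := ve e; [by left | right].
exists i; split=> //; case: s => -[|[|//]] p; [left|right];
  by congr (v _ i); exact: val_inj.
Qed.

Section SheetMap.
Variables (F : groupType) (H : set F) (I : finType) (b : I -> F) (j : I).
Hypothesis Hb : free_on H b.
Variables (K : set F) (J : finType) (c : J -> F) (j0 : J) (v0 v1 : I -> J).
Hypotheses (fK : fi_subgroup K) (KH : K `<=` H) (Kc : free_on K c).
Hypotheses (cj0 : c j0 = b j * b j).
Hypothesis cv0 : forall i, i <> j -> c (v0 i) = b i.
Hypothesis cv1 : forall i, i <> j -> c (v1 i) = b j * b i * (b j)^-1.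
Hypothesis ve : forall e, e = j0 \/ exists i, i <> j /\ (e = v0 i \/ e = v1 i).

Lemma deck_v0 i : i <> j -> b j * c (v0 i) * (b j)^-1 = c (v1 i).
Proof. by move=> ij; rewrite cv0 ?cv1. Qed.

Lemma deck_v1 i : i <> j -> b j * c (v1 i) * (b j)^-1 = c j0 * c (v0 i) * (c j0)^-1.
Proof. by move=> ij; rewrite cv1 ?cv0 // cj0 !group_simp. Qed.

Lemma deck_j0 : b j * c j0 * (b j)^-1 = c j0.
Proof. by rewrite cj0 !group_simp. Qed.

Lemma deck_stable x : K x -> K (b j * x * (b j)^-1).
Proof.
have [sK cK cgen _] := Kc; have [K1 KM KV] := sK.
apply: (free_on_stable Kc (f := fun x => b j * x * (b j)^-1)).
  by move=> y z _ _; rewrite !group_simp.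
move=> e; have [->|[i [ij [->|->]]]] := ve e.
- by rewrite deck_j0.
- by rewrite deck_v0.
- by rewrite deck_v1 //; apply: (KM) => //; [exact: KM | exact: KV].
Qed.

(** Conjugation by [b j] exchanges the two sheets, so an automorphism of H that
   respects the two sheets is the product of the same automorphism of the
   first sheet with its conjugate. *)
Lemma sheet_factorization ct c0 (theta phi : F -> F) :
    represents ct H theta -> theta (b j) = b j ->
    represents c0 K phi -> phi (c j0) = c j0 ->
    (forall i, i <> j -> K (theta (b i)) /\ phi (c (v0 i)) = theta (b i)) ->
    (forall i, i <> j -> phi (c (v1 i)) = c (v1 i)) ->
    (forall i, i <> j -> phi (b j * theta (b i) * (b j)^-1) = b j * theta (b i) * (b j)^-1) ->
  ct = c0 * inner (b j) * c0 * (inner (b j))^-1.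
Proof.
move=> rt tj r0 p0 pv0 pv1 pt.
have [sK cK cgen _] := Kc; have [K1 KM KV] := sK.
have [sH bH _ _] := Hb; have [H1 HM HV] := sH.
have tM := rep_mul_on rt; have pM := rep_mul_on r0.
have pK x : K x -> K (phi x).
  apply: (free_on_stable Kc pM) => e; have [->|[i [ij [->|->]]]] := ve e.
  - by rewrite p0.
  - by have [? ->] := pv0 i ij.
  - by rewrite pv1.
apply: (@mulIg _ (inner (b j))); rewrite mulgVK.
have r1 := rep_mul rt (rep_inner (b j) fK) (fun x Kx => KH (deck_stable Kx)).
have r2 := rep_mul (rep_mul r0 (rep_inner (b j) fK) deck_stable) r0 pK.
apply: (rep_free_eq Kc r1 r2) => e /=.
have [->|[i [ij]]] := ve e.
  rewrite p0 deck_j0 p0 cj0 tM //; first by rewrite tj.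
have [Kt pt0] := pv0 i ij.
have tbi : theta (b j * b i * (b j)^-1) = b j * theta (b i) * (b j)^-1.
  rewrite tM; [|exact: HM|exact: HV].
  by rewrite tM // (mul_onV sH tM) // tj.
case=> ->.
  by rewrite deck_v0 // cv1 // tbi pt0 pt.
rewrite pv1 // deck_v1 // pM; [|exact: KM|exact: KV].
rewrite pM // (mul_onV sK pM) // p0 pt0 cj0 cv0 //.
have Hjj : H (b j * b j) by exact: HM.
rewrite tM; [|exact: HM|exact: HV].
by rewrite tM // (mul_onV sH tM) // tM // tj.
Qed.

End SheetMap.

Lemma aut_stable (F : groupType) (W : set F) f x : is_aut W f -> W x -> W (f x).
Proof. by move=> [_ _ [+ _ _]]; exact. Qed.

(** * Elementary automorphisms in a subgroup normalized by AComm *)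

Section ElementaryInN.
Variables (F : groupType) (N : set (Comm F)).
Hypothesis sN : subgroup N.
Hypothesis Nconj : forall s x, AComm F s -> N x -> N (s * x * s^-1).
Hypothesis Ninner : forall x, N (inner x).

Lemma N_commutator s x : AComm F s -> N x -> N (s * x * s^-1 * x^-1).
Proof.
have [N1 NM NV] := sN => As Nx.
by apply: NM; [exact: Nconj | exact: NV].
Qed.

Lemma N_involution s x : AComm F s -> s * s = 1 -> N (s * inner x * s * (inner x)^-1).
Proof.
move=> As ss; have {2}-> : s = s^-1 by apply/esym/mulg1_eq.
exact: N_commutator.
Qed.

Variables (H : set F) (I : finType) (b : I -> F).
Hypotheses (Hb : free_on H b) (fH : fi_subgroup H).

(** The restriction of theta to one sheet of the double cover is an involution,
   so the factorization over the two sheets is a commutator with [inner (b j)];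
   the same holds for [swap_in_N]. *)
Lemma inversion_in_N ct theta i j : i <> j -> represents ct H theta ->
  (forall k, theta (b k) = upd b i (b i)^-1 k) -> N ct.
Proof.
move=> ij rt tb.
have [K [J [c [j0 [v0 [v1 [fK KH Kc cj0 [cv0 cv1 vj0 vinj ve]]]]]]]] :=
  double_cover j Hb fH.
have [sK cK cgen _] := Kc; have [K1 KM KV] := sK.
have [phi aphi pc] := inversion_aut Kc fK (v0 i).
have [c0 Ac0 r0] := aut_class aphi; have pM := rep_mul_on r0.
have pfix e : e <> v0 i -> phi (c e) = c e by move=> /eqP/negbTE h; rewrite pc /upd h.
have pi : phi (c (v0 i)) = (c (v0 i))^-1 by rewrite pc /upd eqxx.
have tfix k : k <> i -> theta (b k) = b k by move=> /eqP/negbTE h; rewrite tb /upd h.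
have ti : theta (b i) = (b i)^-1 by rewrite tb /upd eqxx.
have [vi0 vi1] := vj0 i ij.
have -> : ct = c0 * inner (b j) * c0 * (inner (b j))^-1.
  apply: (sheet_factorization Hb fK KH Kc cj0 cv0 cv1 ve rt _ r0).
  - by apply: tfix => e; apply: ij.
  - by apply: pfix => e; apply: vi0.
  - move=> k kj; have [vik _ _] := vinj k i kj ij.
    have [->|/eqP ki] := eqVneq k i; last first.
      by rewrite tfix // -cv0 // pfix // => /vik.
    by rewrite ti pi -cv0 //; split=> //; exact: KV.
  - by move=> k kj; apply: pfix => e; have [_ _] := vinj i k ij kj; exact.
  - move=> k kj; have v1k : phi (c (v1 k)) = c (v1 k).
      by apply: pfix => e; have [_ _] := vinj i k ij kj; exact.
    have [e|/eqP ki] := eqVneq k i; last by rewrite tfix // -cv1.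
    have -> : b j * theta (b k) * (b j)^-1 = (c (v1 k))^-1.
      by rewrite e ti cv1 // !group_simp.
    by rewrite (mul_onV sK pM) // v1k.
apply: N_involution => //.
have rr := rep_mul r0 r0 (fun x => @aut_stable _ _ _ x aphi).
apply: (rep_free_eq Kc rr (rep_one fK)) => e /=.
have [->|/eqP h] := eqVneq e (v0 i); last by rewrite !pfix.
by rewrite pi (mul_onV sK pM) // pi invgK.
Qed.

Lemma swap_in_N ct theta i k j : i <> j -> k <> j -> represents ct H theta ->
  (forall l, theta (b l) = b (tperm i k l)) -> N ct.
Proof.
move=> ij kj rt tb.
have [K [J [c [j0 [v0 [v1 [fK KH Kc cj0 [cv0 cv1 vj0 vinj ve]]]]]]]] :=
  double_cover j Hb fH.
have [sK cK cgen _] := Kc; have [K1 KM KV] := sK.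
have [phi aphi pc] := perm_aut Kc fK (tperm (v0 i) (v0 k)).
have [c0 Ac0 r0] := aut_class aphi; have pM := rep_mul_on r0.
have [vi0 vi1] := vj0 i ij; have [vk0 vk1] := vj0 k kj.
have tj l : l <> j -> tperm i k l <> j by case: tpermP.
have v1fix l : l <> j -> phi (c (v1 l)) = c (v1 l).
  move=> lj; rewrite pc tpermD //; apply/eqP.
    by have [_ _] := vinj i l ij lj.
  by have [_ _] := vinj k l kj lj.
have -> : ct = c0 * inner (b j) * c0 * (inner (b j))^-1.
  apply: (sheet_factorization Hb fK KH Kc cj0 cv0 cv1 ve rt _ r0) => //.
  - by rewrite tb tpermD //; apply/eqP.
  - by rewrite pc tpermD //; apply/eqP.
  - move=> l lj; rewrite tb -cv0; last exact: tj.
    split=> //; rewrite pc; congr c.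
    have [e1 _ _] := vinj l i lj ij; have [e2 _ _] := vinj l k lj kj.
    case: (tpermP i k l) => [->|->|/eqP li /eqP lk]; rewrite ?tpermL ?tpermR //.
    by rewrite tpermD //; apply/eqP => /esym; [move/e1/eqP | move/e2/eqP]; apply/negP.
  - by move=> l lj; rewrite tb -cv1 ?v1fix //; exact: tj.
apply: N_involution => //.
have rr := rep_mul r0 r0 (fun x => @aut_stable _ _ _ x aphi).
apply: (rep_free_eq Kc rr (rep_one fK)) => e /=.
by rewrite !pc tpermK.
Qed.

(** Let c0 be the transvection of the first sheet and t = c j0 the loop through
   both sheets. The commutator D of c0 with [inner (b j)] multiplies [c (v0 i)]
   by [c (v0 k)], and does the inverse on the second sheet. Commuting D with
   the transvection la that multiplies t by the inverse of [c (v0 i)] leaves the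
   transvection mu that multiplies t by the inverse of [c (v0 k)]. So mu is in N,
   and exchanging t and [c (v0 i)] turns mu into the inverse of c0. *)
Lemma transvection_in_N ct theta i k j : i <> j -> k <> j -> i <> k ->
  represents ct H theta ->
  (forall l, theta (b l) = upd b i (b i * b k) l) -> N ct.
Proof.
have [N1 NM NV] := sN.
move=> ij kj ik rt tb.
have [K [J [c [j0 [v0 [v1 [fK KH Kc cj0 [cv0 cv1 vj0 vinj ve]]]]]]]] :=
  double_cover j Hb fH.
have [sK cK cgen _] := Kc; have [K1 KM KV] := sK.
have [vi0 vi1] := vj0 i ij; have [vk0 vk1] := vj0 k kj.
have [vik vik1 vik'] := vinj i k ij kj; have [vki _ vki'] := vinj k i kj ij.
have [_ _ vii'] := vinj i i ij ij; have [_ _ vkk'] := vinj k k kj kj.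
have transv e e' : e <> e' -> exists s f, [/\ AComm F s, is_aut K f, represents s K f,
    f (c e) = c e * (c e')^-1 & forall l, l <> e -> f (c l) = c l].
  move=> ee'; have [_ _ fxV] := subgroup_fixed_off Kc e.
  have h1 : fixed_off K c e 1 by have [] := subgroup_fixed_off Kc e.
  have h2 : fixed_off K c e (c e')^-1.
    by apply: (fxV); apply: fixed_off_b => // /esym.
  have [f af fc] := transvection_aut Kc fK h1 h2.
  have [s As rs] := aut_class af; exists s, f; split=> //.
    by rewrite fc /upd eqxx mul1g.
  by move=> l /eqP/negbTE le; rewrite fc /upd le.
have [p0 [c0 [Ac0 r0 p0i p0fix]]] : exists p0 c0, [/\ AComm F c0, represents c0 K p0,
    p0 (c (v0 i)) = c (v0 i) * c (v0 k) & forall l, l <> v0 i -> p0 (c l) = c l].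
  have h1 : fixed_off K c (v0 i) 1 by have [] := subgroup_fixed_off Kc (v0 i).
  have h2 : fixed_off K c (v0 i) (c (v0 k)).
    by apply: fixed_off_b => // /esym /vik.
  have [f af fc] := transvection_aut Kc fK h1 h2.
  have [s As rs] := aut_class af; exists f, s; split=> //.
    by rewrite fc /upd eqxx mul1g.
  by move=> l /eqP/negbTE le; rewrite fc /upd le.
have p0M := rep_mul_on r0.
have v0ki : v0 k <> v0 i by move=> /esym/vik.
have v1n0 l : l <> j -> v1 l <> v0 i.
  by move=> lj /esym; have [_ _] := vinj i l ij lj.
have Nc0 : N c0.
  (* d1 is the inverse of c0 carried to the second sheet. *)
  have [d1 [p1 [Ad1 ap1 r1 p1i p1fix]]] := transv (v1 i) (v1 k) (fun e => ik (vik1 e)).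
  have [la [pl [Al apl rl plj plfix]]] := transv j0 (v0 i) (fun e => vi0 (esym e)).
  have [mu [pm [Am apm rm pmj pmfix]]] := transv j0 (v0 k) (fun e => vk0 (esym e)).
  have p1M := rep_mul_on r1; have plM := rep_mul_on rl; have pmM := rep_mul_on rm.
  have p0K x : K x -> K (p0 x).
    apply: (free_on_stable Kc p0M) => e.
    have [->|/eqP/p0fix -> //] := eqVneq e (v0 i).
    by rewrite p0i; exact: KM.
  have dK x : K x -> K (b j * x * (b j)^-1) by apply: deck_stable Kc cj0 cv0 cv1 ve x.
  have ed1 : d1 = inner (b j) * c0^-1 * (inner (b j))^-1.
    have rI := rep_inner (b j) fK.
    suff e : d1 * inner (b j) * c0 = inner (b j).
      by rewrite -{1}e !group_simp.
    apply: (rep_free_eq Kc (rep_mul (rep_mul r1 rI dK) r0 p0K) rI) => e /=.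
    have [->|[l [lj [->|->]]]] := ve e.
    - rewrite p0fix; last by move/esym.
      by rewrite (deck_j0 cj0) p1fix //; move/esym.
    - have [vl0 vl1] := vj0 l lj; have [evl0 evl1 evl] := vinj l i lj ij.
      have [->|/eqP li] := eqVneq l i.
        rewrite p0i.
        have -> : b j * (c (v0 i) * c (v0 k)) * (b j)^-1 = c (v1 i) * c (v1 k).
          by rewrite !cv0 ?cv1 // !group_simp.
        rewrite p1M // p1i p1fix; last by move/esym/vik1.
        by rewrite (deck_v0 cv0 cv1) // mulgVK.
      rewrite p0fix; last by move/evl0.
      by rewrite (deck_v0 cv0 cv1) // p1fix // => /evl1.
    rewrite p0fix; last exact: v1n0.
    rewrite (deck_v1 cj0 cv0 cv1) //.
    have [_ _ vli] := vinj l i lj ij.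
    rewrite p1M // ?p1M ?(mul_onV sK p1M) //; [|exact: KM|exact: KV].
    by rewrite !p1fix //; move/esym.
  have ND : N (c0 * d1).
    rewrite ed1; have -> : c0 * (inner (b j) * c0^-1 * (inner (b j))^-1) =
      c0 * inner (b j) * c0^-1 * (inner (b j))^-1 by rewrite !group_simp.
    exact: N_commutator.
  have p1K x : K x -> K (p1 x) by exact: (aut_stable ap1).
  have plK x : K x -> K (pl x) by exact: (aut_stable apl).
  have rD := rep_mul r0 r1 p1K.
  have DK x : K x -> K ((p0 \o p1) x) by move=> /p1K/p0K.
  have emu : mu = (c0 * d1) * la * (c0 * d1)^-1 * la^-1.
    suff e : c0 * d1 * la = mu * la * (c0 * d1) by rewrite e !group_simp.
    apply: (rep_free_eq Kc (rep_mul rD rl plK) (rep_mul (rep_mul rm rl plK) rD DK)) => e /=.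
    have pl_v l : l <> j0 -> pm (pl (c l)) = c l by move=> lj; rewrite plfix // pmfix.
    have [->|/eqP ej] := eqVneq e j0.
      rewrite plj p1M ?(mul_onV sK p1M) //; last exact: KV.
      rewrite (p1fix j0); last by move/esym.
      rewrite p0M; [|exact: cK|by apply: (KV); apply: p1K].
      rewrite (p0fix j0); last by move/esym.
      rewrite (p1fix (v0 i)) // (mul_onV sK p0M) // p0i plj.
      by rewrite pmM ?(mul_onV sK pmM) //; [rewrite pmj pmfix // !group_simp | exact: KV].
    have [->|/eqP ei] := eqVneq e (v0 i).
      by rewrite plfix // p1fix // p0i plM // pmM //; rewrite ?pl_v //; exact: plK.
    have [->|/eqP ei1] := eqVneq e (v1 i).
      have Kv : K (c (v1 k))^-1 by exact: KV.
      have e0 : p0 (p1 (c (v1 i))) = c (v1 i) * (c (v1 k))^-1.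
        rewrite p1i p0M // (mul_onV sK p0M) // !p0fix //; exact: v1n0.
      rewrite plfix // e0 plM // (mul_onV sK plM) // pmM //; try exact: plK.
        by rewrite plfix // pmfix // (mul_onV sK pmM) plfix // pmfix.
      by apply: KV; exact: plK.
    by rewrite plfix // (p1fix _ ei1) (p0fix _ ei) pl_v.
  have Nmu : N mu.
    have -> : mu = (c0 * d1) * (la * (c0 * d1)^-1 * la^-1) by rewrite emu !mulgA.
    by apply: (NM) => //; apply: (Nconj Al); exact: NV.
  have [ps aps psc] := perm_aut Kc fK (tperm j0 (v0 i)).
  have [si Asi rsi] := aut_class aps; have psM := rep_mul_on rsi.
  have -> : c0 = si * mu^-1 * si^-1; last by apply: (Nconj Asi); exact: NV.
    suff e : c0 * si * mu = si by rewrite -{1}e !group_simp.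
  have psK x : K x -> K (ps x) by exact: (aut_stable aps).
  have pmK x : K x -> K (pm x) by exact: (aut_stable apm).
  apply: (rep_free_eq Kc (rep_mul (rep_mul r0 rsi psK) rm pmK) rsi) => e /=.
  have [->|/eqP ej] := eqVneq e j0.
    rewrite pmj psM ?(mul_onV sK psM) //; last exact: KV.
    rewrite !psc tpermL tpermD; [|by apply/eqP => /esym|by apply/eqP => /vik].
    rewrite p0M ?(mul_onV sK p0M) //; last exact: KV.
    by rewrite p0i p0fix // !group_simp.
  rewrite pmfix // !psc p0fix //; case: tpermP => // _ /esym.
  exact: vi0.
have -> : ct = c0 * inner (b j) * c0 * (inner (b j))^-1; last first.
  by apply: (NM); [apply: (NM) => //; exact: (NM) | exact: NV].
have tfix l : l <> i -> theta (b l) = b l by move=> /eqP/negbTE h; rewrite tb /upd h.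
have ti : theta (b i) = b i * b k by rewrite tb /upd eqxx.
apply: (sheet_factorization Hb fK KH Kc cj0 cv0 cv1 ve rt _ r0).
- by apply: tfix => /esym.
- by apply: p0fix => /esym.
- move=> l lj; have [e0 _ _] := vinj l i lj ij.
  have [->|/eqP li] := eqVneq l i.
    by rewrite ti p0i -!cv0 //; split=> //; exact: KM.
  by rewrite tfix // -cv0 // p0fix // => /e0.
- by move=> l lj; apply: p0fix; exact: v1n0.
move=> l lj; have [->|/eqP li] := eqVneq l i.
  have -> : b j * theta (b i) * (b j)^-1 = c (v1 i) * c (v1 k).
    by rewrite ti !cv1 // !group_simp.
  by rewrite p0M // !p0fix //; exact: v1n0.
by rewrite tfix // -cv1 // p0fix //; exact: v1n0.
Qed.

End ElementaryInN.

(** * Nielsen's theorem *)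

Lemma exists_minimal (T : Type) (P : T -> Prop) (m : T -> nat) :
  (exists x, P x) -> exists2 x, P x & forall y, P y -> m x <= m y.
Proof.
move=> [x Px].
have ex : exists n, `[< exists2 y, P y & m y = n >].
  by exists (m x); apply/asboolP; exists x.
case: (ex_minnP ex) => _ /asboolP[y Py <-] ymin; exists y => // z Pz.
by apply: ymin; apply/asboolP; exists z.
Qed.

Local Notation letter I := (Equality.sort I * bool)%type.

Section Cancellation.
Variable I : finType.
Implicit Types (l : letter I) (u v w : seq (letter I)).

Fixpoint canc_rev (ru v : seq (letter I)) : nat :=
  match ru, v with
  | x :: ru', y :: v' => if y == linv x then (canc_rev ru' v').+1 else 0
  | _, _ => 0
  end.

Definition canc u v := canc_rev (rev u) v.

Lemma cancP u v : reduced u -> reduced v -> exists a c d,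
  [/\ u = a ++ c, v = winv c ++ d, size c = canc u v & reduced (a ++ d)].
Proof.
rewrite /canc; elim/last_ind: u v => [|u x IH] v ru rv.
  by exists [::], [::], v.
case: v rv => [|y v] rv.
  by exists (rcons u x), [::], [::]; rewrite !cats0 rev_rcons.
rewrite rev_rcons /=; case: eqVneq => [e|ne]; last first.
  exists (rcons u x), [::], (y :: v); split; rewrite ?cats0 //.
  by rewrite (reduced_cat _ _ x) ru rv /= last_rcons ne orbT.
have [|a [c [d [eu ev ec rad]]]] := IH v _ (path_sorted rv).
  by move: ru; rewrite -cats1 => /reduced_catl.
exists a, (rcons c x), d; split=> //.
- by rewrite eu -rcons_cat.
- by rewrite /winv map_rcons rev_rcons /= -/(winv c) -ev -e.
- by rewrite size_rcons ec.
Qed.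

(** If half of u or more cancelled in u u, then two adjacent letters of u, or
   its middle letter and itself, would be inverse to each other. *)
Lemma canc_self u : reduced u -> u != [::] -> (canc u u).*2 < size u.
Proof.
move=> ru u_n0; have x0 : letter I by case: (u) u_n0.
have [a [c [d [eu eu' ec _]]]] := cancP ru ru.
rewrite -ec ltnNge; apply/negP => le_u.
have su : size u = size a + size c by rewrite -size_cat -eu.
have mirror t : t < size c -> nth x0 u t = linv (nth x0 u (size u - t.+1)).
  move=> lt; rewrite [in LHS]eu' nth_cat size_winv lt /winv nth_rev size_map //.
  rewrite (nth_map x0); last by rewrite subnSK // leq_subr.
  congr linv; rewrite [in RHS]eu nth_cat -eu.
  have -> : (size u - t.+1 < size a) = false by apply/negbTE; rewrite -leqNgt; lia.
  by congr (nth _ _ _); lia.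
have [m [b em]] : exists m (b : bool), size u = b + m.*2.
  by exists (size u)./2, (odd (size u)); rewrite odd_double_half.
have u_gt0 : 0 < size u by rewrite lt0n size_eq0.
case: b em => em.
  have := mirror m; rewrite em => /(_ _) /eqP.
  have -> : (1 + m.*2 - m.+1)%N = m by lia.
  by rewrite linv_neq => h; suff : false by []; apply: h; lia.
have /(sortedP x0) /(_ m.-1) := ru; rewrite em => h.
have lt : m.-1.+1 < false + m.*2 by lia.
have := h lt; rewrite (mirror m.-1); last by lia.
rewrite em linvK prednK; last by lia.
have -> : (false + m.*2 - m)%N = m by lia.
by rewrite eqxx.
Qed.

Lemma reduced_winv_self u : reduced (u ++ winv u) -> u = [::].
Proof.
elim/last_ind: u => // u x _; rewrite (reduced_cat _ _ x) => /and3P[_ _].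
rewrite /winv map_rcons rev_rcons last_rcons /= eqxx !orbF.
by rewrite -size_eq0 size_rcons.
Qed.

(* The word as a number in base the number of letters: lexicographic order. *)
Definition word_code (u : seq (letter I)) : nat :=
  foldl (fun a l => a * #|{: (letter I)}| + enum_rank l) 0 u.

Lemma word_code_inj u v : size u = size v -> word_code u = word_code v -> u = v.
Proof.
rewrite /word_code; elim/last_ind: u v => [|u x IH] v.
  by case: v.
case/lastP: v => [|v y]; first by rewrite size_rcons.
rewrite !size_rcons -!cats1 !foldl_cat /= => -[sz] e.
have B_gt0 : 0 < #|{: (letter I)}| by apply/card_gt0P; exists x.
have eu := congr1 (divn^~ #|{: (letter I)}|) e.
rewrite /= !divnMDl // !divn_small ?addn0 // in eu.
have ex := congr1 (modn^~ #|{: (letter I)}|) e.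
rewrite /= !modnMDl !modn_small // in ex.
by rewrite (IH v sz eu) (enum_rank_inj (val_inj ex)).
Qed.

Lemma word_code_lt u v w :
  word_code u < word_code v -> word_code (u ++ w) < word_code (v ++ w).
Proof.
rewrite /word_code !foldl_cat; elim: w (foldl _ 0 u) (foldl _ 0 v) => //= l w IH m n mn.
apply: IH; rewrite ltn_add2r ltn_mul2r mn andbT.
by apply/card_gt0P; exists l.
Qed.

(** The tie-break between words of equal length: the codes of the two halves,
   each read from its end of the word towards the middle. *)
Definition half_weight u : nat :=
  word_code (take (uphalf (size u)) u) + word_code (take (uphalf (size u)) (winv u)).

Lemma half_weight_winv u : half_weight (winv u) = half_weight u.
Proof. by rewrite /half_weight size_winv winvK addnC. Qed.

Lemma half_weight_lt u v w : size u = size v -> size v <= size w ->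
  word_code u < word_code v -> half_weight (u ++ w) < half_weight (v ++ w).
Proof.
move=> suv svw uv; rewrite /half_weight !winv_cat !size_cat suv.
set h := uphalf _; have h1 : size v <= h by rewrite /h; lia.
have h2 : h <= size w by rewrite /h; lia.
have tw x : take h (winv w ++ x) = take h (winv w).
  by rewrite takel_cat // size_winv.
rewrite !tw ltn_add2r !take_cat suv (ltnNge h) h1 /=; exact: word_code_lt.
Qed.

End Cancellation.

Section Nielsen.
Variables (F : groupType) (H : set F) (I : finType) (b : I -> F).
Hypothesis Hb : free_on H b.
Implicit Types (l : letter I) (y : I -> F).

Definition nf x : seq (letter I) := xget [::] [set w | reduced w /\ ev b w = x].

Lemma nfP x : H x -> reduced (nf x) /\ ev b (nf x) = x.
Proof.
have [_ _ bgen _] := Hb => Hx; have [w rw ew] := ev_gen bgen Hx.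
by apply: (@xgetPex _ [::] [set w | reduced w /\ ev b w = x]); exists w.
Qed.

Lemma nf_ev w : reduced w -> nf (ev b w) = w.
Proof.
move=> rw; have [sH bH _ _] := Hb.
have [r e] := nfP (ev_in w sH bH).
exact: (reduced_ev_inj Hb).
Qed.

Lemma nfV x : H x -> nf x^-1 = winv (nf x).
Proof.
by move=> /nfP[r {1}<-]; rewrite -ev_winv nf_ev // reduced_winv.
Qed.

Lemma sum_upd (m : F -> nat) y i x :
  \sum_k m (upd y i x k) + m (y i) = \sum_k m (y k) + m x.
Proof.
rewrite (bigD1 i) //= [X in _ = X + _](bigD1 i) //= /upd eqxx.
rewrite [X in m x + X + _](eq_bigr (fun k => m (y k))); last first.
  by move=> k /negbTE ->.
by lia.
Qed.

Variable P : (I -> F) -> Prop.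
Hypothesis Pex : exists y, P y.
Hypothesis PH : forall y i, P y -> H (y i).
Hypothesis Pn1 : forall y i, P y -> y i <> 1.
Hypothesis Pgen : forall y A, P y -> subgroup A -> (forall i, A (y i)) -> H `<=` A.
Hypothesis Pmul : forall y i k x, P y -> i <> k -> x = y k \/ x = (y k)^-1 ->
  P (upd y i (y i * x)) /\ P (upd y i (x * y i)).

Definition len x := size (nf x).
Definition weight x := half_weight (nf x).

Lemma lenV x : H x -> len x^-1 = len x.
Proof. by move=> Hx; rewrite /len nfV // size_winv. Qed.

Lemma weightV x : H x -> weight x^-1 = weight x.
Proof. by move=> Hx; rewrite /weight nfV // half_weight_winv. Qed.

Section Minimal.
Variable y : I -> F.
Hypothesis Py : P y.
Hypothesis min_len : forall y', P y' -> \sum_i len (y i) <= \sum_i len (y' i).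
Hypothesis min_weight : forall y', P y' -> \sum_i len (y' i) = \sum_i len (y i) ->
  \sum_i weight (y i) <= \sum_i weight (y' i).

Let U l := nf (lval y l).

Let sH : subgroup H. Proof. by have [] := Hb. Qed.

Let HU l : H (lval y l).
Proof.
have [_ _ HV] := sH; rewrite /lval.
by case: l.2; [apply: HV | ]; exact: PH.
Qed.

Let rU l : reduced (U l). Proof. by have [] := nfP (HU l). Qed.

Let evU l : ev b (U l) = lval y l. Proof. by have [] := nfP (HU l). Qed.

Let U_neq0 l : 0 < size (U l).
Proof.
rewrite lt0n size_eq0; apply/eqP => e.
have := evU l; rewrite e /= /lval; case: l.2 => h; last exact: (Pn1 Py (esym h)).
by apply: (Pn1 Py (i := l.1)); rewrite -[y _]invgK -h invg1.
Qed.

Let len_lval l : len (lval y l) = len (y l.1).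
Proof. by rewrite /lval; case: l.2 => //; rewrite lenV //; exact: PH. Qed.

Let weight_lval l : weight (lval y l) = weight (y l.1).
Proof. by rewrite /lval; case: l.2 => //; rewrite weightV //; exact: PH. Qed.

Lemma replace_left l l' : l.1 <> l'.1 -> exists x, [/\ P (upd y l.1 x),
  len x = len (lval y l * lval y l') & weight x = weight (lval y l * lval y l')].
Proof.
have [_ HM HV] := sH; move=> ll'.
have Hll : H (lval y l * lval y l') by exact: HM.
case: l ll' Hll => i [] /= ii Hll.
  exists ((lval y (i, true) * lval y l')^-1); rewrite lenV // weightV //; split=> //.
  rewrite invgMG {2}/lval /= invgK.
  suff [_ //] : P (upd y i (y i * (lval y l')^-1)) /\
     P (upd y i ((lval y l')^-1 * y i)).
  apply: (Pmul Py ii); rewrite /lval; case: l'.2; rewrite ?invgK; by [left|right].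
exists (lval y (i, false) * lval y l'); split=> //.
suff [//] : P (upd y i (y i * (lval y l'))) /\
     P (upd y i ((lval y l') * y i)).
apply: (Pmul Py ii); rewrite /lval; case: l'.2; by [left|right].
Qed.

Lemma replace_right l l' : l.1 <> l'.1 -> exists x, [/\ P (upd y l'.1 x),
  len x = len (lval y l * lval y l') & weight x = weight (lval y l * lval y l')].
Proof.
have [_ HM HV] := sH; move=> ll'.
have [x [Px lx wx]] := @replace_left (linv l') (linv l) (fun e => ll' (esym e)).
have e : lval y (linv l') * lval y (linv l) = (lval y l * lval y l')^-1.
  by rewrite invgMG !lval_linv.
by exists x; rewrite lx wx e lenV ?weightV //; exact: HM.
Qed.

Lemma len_replace i x : P (upd y i x) -> len (y i) <= len x.
Proof.
move=> /min_len; rewrite -(leq_add2r (len (y i))) sum_upd.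
by rewrite leq_add2l.
Qed.

Lemma weight_replace i x :
  P (upd y i x) -> len x = len (y i) -> weight (y i) <= weight x.
Proof.
move=> Pyx lx; rewrite -(leq_add2l (\sum_k weight (y k))) -(sum_upd weight y i x) leq_add2r.
apply: min_weight => //; apply: (@addIn (len (y i))).
by rewrite sum_upd lx.
Qed.

Lemma nf_product l l' : exists a c d,
  [/\ U l = a ++ c, U l' = winv c ++ d, size c = canc (U l) (U l') &
      nf (lval y l * lval y l') = a ++ d].
Proof.
have [a [c [d [e e' ec r]]]] := cancP (rU l) (rU l').
exists a, c, d; split=> //.
rewrite -!evU e e' !ev_cat ev_winv mulgA mulgK -ev_cat nf_ev //.
Qed.

(** Otherwise the product would be shorter than one of its factors, and could
   replace it in y. *)
Lemma canc_half_distinct l l' : l.1 <> l'.1 ->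
  (canc (U l) (U l')).*2 <= size (U l) /\ (canc (U l) (U l')).*2 <= size (U l').
Proof.
move=> ll'; have [a [c [d [e e' <- epr]]]] := nf_product l l'.
have pr : len (lval y l * lval y l') = size a + size d by rewrite /len epr size_cat.
have [x [Px lx _]] := replace_left ll'; have [x' [Px' lx' _]] := replace_right ll'.
have := len_replace Px; have := len_replace Px'.
rewrite lx lx' pr -!len_lval /len -/(U l) -/(U l').
by rewrite e e' !size_cat size_winv; lia.
Qed.

Lemma canc_half l l' : l' != linv l -> [/\ (canc (U l) (U l')).*2 <= size (U l),
  (canc (U l) (U l')).*2 <= size (U l') &
  l.1 = l'.1 -> (canc (U l) (U l')).*2 < size (U l) /\ (canc (U l) (U l')).*2 < size (U l')].
Proof.
move=> ll'; have [e|/eqP ne] := eqVneq l.1 l'.1; last first.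
  by have [] := canc_half_distinct ne.
have <- : l = l'.
  case: l l' e ll' => i e1 [i' e2] /= <-; rewrite /linv xpair_eqE eqxx /=.
  by case: e1 e2 => -[].
have := canc_self (rU l); rewrite -size_eq0 -lt0n U_neq0 => /(_ isT) h.
by split=> //; exact: ltnW.
Qed.

(** If nothing remained of U z, then U z = p q^-1 with p and q of the same length,
   p cancelling against the end of U x and q^-1 against the start of U t.
   Multiplying by z would trade q for p at the start of U t, or p^-1 for q^-1 at
   the end of U x, at constant length; the weight decreases in the first case
   when p has the smaller code, in the second case when q has. *)
Lemma canc_triple x z t : z != linv x -> t != linv z ->
  canc (U x) (U z) + canc (U z) (U t) < size (U z).
Proof.
move=> xz zt; have [h1 h2 h3] := canc_half xz; have [g1 g2 g3] := canc_half zt.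
rewrite ltnNge; apply/negP => le.
have xz' : x.1 <> z.1 by move=> /h3; lia.
have zt' : z.1 <> t.1 by move=> /g3; lia.
have [a [c [d [ex ez ec epr]]]] := nf_product x z.
have [a' [c' [d' [ez' et ec' epr']]]] := nf_product z t.
have sz : size (U z) = size c + size d by rewrite ez size_cat size_winv.
have sz' : size (U z) = size a' + size c' by rewrite ez' size_cat.
have /eqP : winv c ++ d = a' ++ c' by rewrite -ez.
have sca : size (winv c) = size a' by rewrite size_winv; lia.
rewrite eqseq_cat //.
move=> /andP[/eqP ea' /eqP ed]; subst a' d.
pose q := winv c'; have ec'q : c' = winv q by rewrite winvK.
have sc : size (winv c) = size q by rewrite /q !size_winv; lia.
have st : size (U t) = size q + size d' by rewrite et size_cat.
have sx : size (U x) = size a + size c by rewrite ex size_cat.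
have sq : size q = size c' by rewrite size_winv.
rewrite size_winv in sc.
case: (ltngtP (word_code (winv c)) (word_code q)) => cq.
- have [v [Pv lv wv]] := replace_right zt'.
  have lvt : len v = len (y t.1).
    by rewrite lv -len_lval /len epr' -/(U t) et !size_cat !size_winv sc sq.
  have := weight_replace Pv lvt; rewrite wv -weight_lval /weight epr' -/(U t) et -/q.
  rewrite leqNgt => /negP[].
  by apply: half_weight_lt; rewrite ?size_winv //; lia.
- have [v [Pv lv wv]] := replace_left xz'.
  have lvx : len v = len (y x.1).
    by rewrite lv -len_lval /len epr -/(U x) ex !size_cat sc sq.
  have := weight_replace Pv lvx; rewrite wv -weight_lval /weight epr -/(U x) ex.
  rewrite leqNgt => /negP[]; rewrite -half_weight_winv -(half_weight_winv (a ++ c)).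
  rewrite !winv_cat; apply: half_weight_lt => //; rewrite !size_winv; lia.
have e : winv c = q by apply: word_code_inj => //; rewrite size_winv.
have := rU z; rewrite ez' e ec'q => /reduced_winv_self q0.
by have := U_neq0 z; rewrite sz' e q0 -sq q0.
Qed.

(** By [canc_triple] every factor of a reduced product in y keeps a letter, so
   the product is at least as long as its number of factors. Here s is the
   part of the first factor that survives, and d the part that cancels. *)
Lemma minimal_product z w : reduced (z :: w) -> exists s w' d,
  [/\ 0 < size s, U z = s ++ d, reduced (s ++ w'),
      ev b (s ++ w') = ev y (z :: w) & size w <= size w' /\
      if w is z' :: _ then size d = canc (U z) (U z') else d = [::]].
Proof.
elim: w z => [|z w IH] x rxzw.
  by exists (U x), [::], [::]; rewrite !cats0 /= mulg1 evU; split.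
have /andP[xz rzw] := rxzw.
have [s [w' [d [s_gt0 eU rsw esw [sw hd]]]]] := IH z rzw.
have [a [e [f [ex ez ee rpr]]]] := nf_product x z.
have [h1 h2 _] := canc_half xz.
have sUz : size (U z) = size s + size d by rewrite eU size_cat.
have dbl n m : 0 < m -> n.*2 <= m -> n < m by lia.
have lt_es : size e < size s.
  case: (w) rzw hd => [|t w2] rzw hd.
    by apply: dbl => //; rewrite ee -(addn0 (size s)) -[0]/(size (Nil (letter I))) -hd -sUz.
  have /andP[zt _] := rzw.
  by rewrite -(ltn_add2r (size d)) -sUz ee hd; exact: canc_triple.
have es : s = winv e ++ drop (size e) s.
  rewrite -{1}(cat_take_drop (size e) s); congr cat.
  have := congr1 (take (size e)) ez; rewrite eU take_cat lt_es => ->.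
  by rewrite take_cat size_winv ltnn subnn take0 cats0.
set s0 := drop (size e) s in es.
have ef : f = s0 ++ d.
  have := ez; rewrite eU es -catA => /eqP; rewrite eqseq_cat // eqxx /=.
  by move=> /eqP.
have s0_gt0 : s0 != [::] by rewrite -size_eq0 size_drop -lt0n subn_gt0.
exists a, (s0 ++ w'), e; split=> //.
- by rewrite -(ltn_add2r (size e)) -size_cat -ex ee; exact: dbl.
- apply: reduced_glue => //.
    have [+ _] := nfP (x := lval y x * lval y z) (let: And3 _ HM _ := sH in HM _ _ (HU x) (HU z)).
    by rewrite rpr ef catA => /reduced_catl.
  by move: rsw; rewrite es -catA => /reduced_catr.
- rewrite -[RHS]/(lval y x * ev y (z :: w)) -esw -evU ex es !ev_cat ev_winv.
  by rewrite !mulgA mulgK.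
by split; rewrite // size_cat -[size _]/(size w).+1 -add1n leq_add // lt0n size_eq0.
Qed.

Lemma minimal_basis j : exists i, b j = y i \/ b j = (y i)^-1.
Proof.
have [_ bH _ _] := Hb.
have [w rw ew] := ev_gen (fun A => @Pgen y A Py) (bH j).
case: w rw ew => [|z w] rw ew; first by case: (free_b_neq1 Hb (esym ew)).
have [s [w' [d [s_gt0 eU rsw esw [sw hd]]]]] := minimal_product rw.
have e : s ++ w' = [:: (j, false)].
  by rewrite -[s ++ w']nf_ev // esw ew -[RHS]nf_ev //= mulg1.
have := congr1 size e; rewrite size_cat /= => sz.
have w0 : w = [::].
  apply: size0nil; apply/eqP; rewrite -leqn0; apply: leq_trans sw _.
  by rewrite -ltnS -sz -add1n leq_add2r.
exists z.1; move: ew; rewrite w0 /= mulg1 /lval.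
by case: z.2 => <-; [right|left].
Qed.

End Minimal.

(** Nielsen's method: a tuple of least total length, and among those of least
   total weight, is the given basis up to order and inversion. *)
Lemma nielsen : exists2 y, P y & forall j, exists i, b j = y i \/ b j = (y i)^-1.
Proof.
have [y0 Py0 min0] := exists_minimal (fun y => \sum_i len (y i)) Pex.
have [|y [Py ly] min] := @exists_minimal _
  (fun y => P y /\ \sum_i len (y i) = \sum_i len (y0 i)) (fun y => \sum_i weight (y i)).
  by exists y0.
exists y => // j; apply: minimal_basis => // [y' Py'|y' Py' e].
  by rewrite ly; exact: min0.
by apply: min; rewrite e.
Qed.

End Nielsen.

(** * Automorphism groups in a subgroup normalized by AComm *)

Lemma is_aut_comp (F : groupType) (W : set F) (f g : F -> F) :
  is_aut W f -> is_aut W g -> is_aut W (f \o g).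
Proof.
move=> af ag; have [fW fM fb] := af; have [_ gM gb] := ag.
split=> //; last exact: set_bij_comp gb fb.
by move=> x y Wx Wy /=; rewrite gM // fM //; exact: (aut_stable ag).
Qed.

Section AutomorphismsInN.
Variables (F : groupType) (N : set (Comm F)).
Hypothesis sN : subgroup N.
Hypothesis Nconj : forall s x, AComm F s -> N x -> N (s * x * s^-1).
Hypothesis Ninner : forall x, N (inner x).
Variables (H : set F) (I : finType) (b : I -> F).
Hypotheses (Hb : free_on H b) (fH : fi_subgroup H) (I3 : 2 < #|I|).

Lemma third_index (i k : I) : exists j, i <> j /\ k <> j.
Proof.
have : 0 < #|~: [set i; k]%SET|.
  rewrite -(ltn_add2l #|[set i; k]%SET|) cardsC addn0.
  by apply: leq_ltn_trans I3; rewrite cards2; case: eqP.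
move=> /card_gt0P[j]; rewrite !inE negb_or => /andP[/eqP ji /eqP jk].
by exists j; split=> e; [apply: ji|apply: jk].
Qed.

(** Inverses give the division by [b k], and conjugation by the inversion of
   [b i] exchanges left and right multiplication. *)
Lemma all_transvections_in_N i k x : i <> k -> x = b k \/ x = (b k)^-1 ->
  (exists f t, [/\ is_aut H f, represents t H f, N t & forall l, f (b l) = upd b i (b i * x) l]) /\
  (exists f t, [/\ is_aut H f, represents t H f, N t & forall l, f (b l) = upd b i (x * b i) l]).
Proof.
have [N1 NM NV] := sN; have [sH bH _ _] := Hb; have [H1 HM HV] := sH.
move=> ik; have [j [ij kj]] := third_index i k.
have [_ _ fxV] := subgroup_fixed_off Hb i.
have f1 : fixed_off H b i 1 by have [] := subgroup_fixed_off Hb i.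
have fk : fixed_off H b i (b k) by apply: fixed_off_b => // /esym.
have right z : z = b k \/ z = (b k)^-1 ->
    exists f t, [/\ is_aut H f, represents t H f, N t & forall l, f (b l) = upd b i (b i * z) l].
  have [f af fb] := transvection_aut Hb fH f1 fk.
  rewrite mul1g in fb; have [t _ rt] := aut_class af.
  have Nt : N t by apply: (transvection_in_N sN Nconj Ninner Hb fH ij kj ik rt).
  case=> ->; first by exists f, t.
  have [g ag gb] := transvection_aut Hb fH f1 (fxV _ fk).
  rewrite mul1g in gb; have [t' _ rt'] := aut_class ag.
  exists g, t'; split=> //; have -> : t' = t^-1; last exact: NV.
  apply/esym/mulg1_eq; have fM := rep_mul_on rt.
  apply: (rep_free_eq Hb (rep_mul rt rt' (fun x => @aut_stable _ _ _ x ag)) (rep_one fH)).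
  move=> l /=; rewrite gb /upd; case: eqVneq => [->|li]; last by rewrite fb /upd (negbTE li).
  rewrite fM ?(mul_onV sH fM) //; last exact: HV.
  by rewrite !fb /upd eqxx; case: eqP => [e|_]; [case: ik | rewrite mulgK].
move=> hx; split; first exact: right.
have hx' : x^-1 = b k \/ x^-1 = (b k)^-1 by case: hx => ->; rewrite ?invgK; [right|left].
have [f [t [af rt Nt fb]]] := right _ hx'.
have [e ae eb] := inversion_aut Hb fH i; have [s _ rs] := aut_class ae.
have Ns : N s by exact: (inversion_in_N sN Nconj Ninner Hb fH ij rs eb).
exists (e \o (f \o e)), (s * (t * s)); split.
- by apply: is_aut_comp => //; exact: is_aut_comp.
- have efS y := @aut_stable _ _ _ y ae.
  exact: rep_mul rs (rep_mul rt rs efS) (fun y Hy => aut_stable af (efS y Hy)).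
- by apply: (NM) => //; exact: NM.
have fM := rep_mul_on rt; have eM := rep_mul_on rs.
have Hx : H x by case: hx => ->; [|exact: HV].
have ex : e x = x.
  have ek : e (b k) = b k by rewrite eb /upd; case: eqP => // /esym.
  by case: hx => ->; rewrite ?(mul_onV sH eM) // ek.
move=> l /=; rewrite eb {1}/upd; case: (eqVneq l i) => [->|li]; last first.
  by rewrite fb /upd (negbTE li) eb /upd (negbTE li).
rewrite (mul_onV sH fM) // fb /upd eqxx invgMG invgK eM //; last exact: HV.
by rewrite ex (mul_onV sH eM) // eb /upd eqxx invgK.
Qed.

Lemma perm_in_N (s : {perm I}) : exists f p, [/\ is_aut H f, represents p H f, N p &
  forall l, f (b l) = b (s l)].
Proof.
have [N1 NM NV] := sN; have [ts -> _] := prod_tpermP s.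
elim: ts => [|[i k] ts [f [p [af rp Np fb]]]].
  rewrite big_nil; exists id, 1; split=> //; [|exact: rep_one|by move=> l; rewrite perm1].
  by split=> //; split=> // x Hx; exists x.
rewrite big_cons; have [j [ij kj]] := third_index i k.
have [g ag gb] := perm_aut Hb fH (tperm i k); have [q _ rq] := aut_class ag.
exists (f \o g), (p * q); split.
- exact: is_aut_comp.
- exact: rep_mul rp rq (fun y => @aut_stable _ _ _ y ag).
- by apply: (NM) => //; exact: (swap_in_N sN Nconj Ninner Hb fH ij kj rq gb).
by move=> l /=; rewrite gb fb permM.
Qed.

Lemma signs_in_N (A : {set I}) : exists f p, [/\ represents p H f, N p &
  forall l, f (b l) = if l \in A then (b l)^-1 else b l].
Proof.
have [N1 NM NV] := sN; have [sH bH _ _] := Hb; have [H1 HM HV] := sH.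
have [n] := ubnP #|A|; elim: n A => // n IH A /ltnSE cA.
have [->|[i iA]] := set_0Vmem A.
  exists id, 1; split=> //; first exact: rep_one.
  by move=> l; rewrite finset.inE.
have [|f [p [rp Np fb]]] := IH (A :\ i)%SET; first by rewrite [#|A|](cardsD1 i) iA in cA.
have [j [ij _]] := third_index i i.
have [e ae eb] := inversion_aut Hb fH i; have [s _ rs] := aut_class ae.
exists (f \o e), (p * s); split.
- exact: rep_mul rp rs (fun y => @aut_stable _ _ _ y ae).
- by apply: (NM) => //; exact: (inversion_in_N sN Nconj Ninner Hb fH ij rs eb).
move=> l /=; rewrite eb /upd; have fM := rep_mul_on rp.
case: (eqVneq l i) => [->|li].
  by rewrite (mul_onV sH fM) // fb !finset.inE eqxx iA.
by rewrite fb !finset.inE li.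
Qed.

(** Nielsen's theorem applies to the tuples of the automorphisms congruent to
   alpha modulo N: one of them permutes the basis up to inversion, and such
   automorphisms are in N. *)
Lemma aut_in_N c alpha : is_aut H alpha -> represents c H alpha -> N c.
Proof.
have [N1 NM NV] := sN; have [sH bH bgen _] := Hb; have [H1 HM HV] := sH.
move=> aa ra.
pose P (y : I -> F) := exists f s, [/\ is_aut H f, represents s H f,
  (forall i, f (b i) = y i) & N (c^-1 * s)].
have [|||||y Py yb] := @nielsen _ _ _ _ Hb P.
- by exists (alpha \o b), alpha, c; split=> //; rewrite mulVg.
- by move=> y i [f [s [af _ <- _]]]; exact: (aut_stable af).
- move=> y i [f [s [_ rs <- _]]] e; apply: (free_b_neq1 Hb (i := i)).
  by apply: (rep_inj rs) => //; rewrite e (mul_on1 sH (rep_mul_on rs)).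
- move=> y A [f [s [af rs fb _]]] sA Ay x Hx; have [_ _ [_ _ fsurj]] := af.
  have [x' Hx' <-] := fsurj x Hx; suff [] : [set z | H z /\ A (f z)] x' by [].
  move: x' Hx'; apply: bgen => [|i]; last by rewrite /= fb.
  exact: (subgroup_preim sH (rep_mul_on rs) sA).
- move=> y i k x [f [s [af rs fb Ns]]] ik hx; have fM := rep_mul_on rs.
  have [z [hz fz Hz]] : exists z, [/\ z = b k \/ z = (b k)^-1, f z = x & H z].
    case: hx => ->; first by exists (b k); split; [left| |].
    by exists (b k)^-1; split; [right|rewrite (mul_onV sH fM) // fb|exact: HV].
  have [[g [t [ag rt Nt gb]]] [g' [t' [ag' rt' Nt' gb']]]] := all_transvections_in_N ik hz.
  split.
    exists (f \o g), (s * t); split.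
    + exact: is_aut_comp.
    + exact: rep_mul rs rt (fun y => @aut_stable _ _ _ y ag).
    + move=> l /=; rewrite gb /upd; case: eqP => _; last exact: fb.
      by rewrite fM // fz fb.
    + by rewrite mulgA; exact: NM.
  exists (f \o g'), (s * t'); split.
  + exact: is_aut_comp.
  + exact: rep_mul rs rt' (fun y => @aut_stable _ _ _ y ag').
  + move=> l /=; rewrite gb' /upd; case: eqP => _; last exact: fb.
    by rewrite fM // fz fb.
  + by rewrite mulgA; exact: NM.
have [f [s [af rs fb Ns]]] := Py; have fM := rep_mul_on rs.
have [g gP] := choice yb.
have bV_neq j j' : b j <> (b j')^-1.
  move=> e; have /(_ [:: (j', true)] isT isT) := @reduced_ev_inj _ _ _ _ Hb [:: (j, false)].
  by rewrite /= /lval /= !mulg1 => /(_ e).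
have ginj : injective g.
  move=> j j' e; have h := gP j; have h' := gP j'; rewrite e in h.
  case: h h' => h [] h'.
  - by apply: (free_b_inj Hb); rewrite h h'.
  - by case: (@bV_neq j' j); rewrite h h'.
  - by case: (@bV_neq j j'); rewrite h h'.
  - by apply: (free_b_inj Hb); rewrite h h'.
have [f2 [p [ap rp Np f2b]]] := perm_in_N (perm ginj).
have [f3 [q [rq Nq f3b]]] := signs_in_N [set j | b j != y (g j)]%SET.
have esp : s * p = q.
  apply: (rep_free_eq Hb (rep_mul rs rp (fun y => @aut_stable _ _ _ y ap)) rq).
  move=> j /=; rewrite f2b permE fb f3b finset.inE.
  by case: eqVneq => [//|/eqP ne] /=; case: (gP j) => // ->; rewrite invgK.
have Ns' : N s by rewrite -(mulgK p s) esp; apply: (NM) => //; exact: NV.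
by have := NM _ _ Ns' (NV _ Ns); rewrite invgMG invgK mulKVg.
Qed.

End AutomorphismsInN.

(** * Subgroups normalized by AComm contain AComm *)

Section InnerInN.
Variables (F : groupType) (N : set (Comm F)).
Hypothesis sN : subgroup N.
Hypothesis Nconj : forall s x, AComm F s -> N x -> N (s * x * s^-1).

(** A transvection carries [c a] to [c a * c e]. *)
Lemma inner_free_in_N (U : set F) (J : finType) (c : J -> F) a :
  free_on U c -> fi_subgroup U -> N (inner (c a)) -> forall x, U x -> N (inner x).
Proof.
move=> Uc fU Na; have [N1 NM NV] := sN; have [sU cU cgen _] := Uc.
have sNi : subgroup [set x : F | N (inner x)].
  split=> [|x y Nx Ny|x Nx] /=; first by rewrite inner1.
    by rewrite innerM; exact: NM.
  by rewrite innerV; exact: NV.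
apply: cgen => //= e; have [-> //|/eqP ea] := eqVneq e a.
have f1 : fixed_off U c a 1 by have [] := subgroup_fixed_off Uc a.
have [f af fc] := transvection_aut Uc fU f1 (fixed_off_b Uc ea).
have [s As rs] := aut_class af.
have := Nconj As Na; rewrite (inner_conj rs) // fc /upd eqxx mul1g innerM.
by move=> Nae; have := NM _ _ (NV _ Na) Nae; rewrite mulKg.
Qed.

End InnerInN.

Section FreeGroup.
Variables (F : groupType) (I : finType) (b : I -> F).
Hypothesis Fb : free_on setT b.
Variables (i0 i1 : I).
Hypothesis i01 : i0 <> i1.

(** Conjugating by a letter of i0 that cancels at neither end works unless both
   end letters of w already are letters of i0. *)
Lemma conjugate_word (w : seq (I * bool)) : reduced w -> w != [::] ->
  exists w' x, [/\ reduced w', w' != [::], ev b w' = x * ev b w * x^-1 &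
    forall e, onth w' 0 <> Some (i1, e) /\ onth w' (size w').-1 <> Some (i1, e)].
Proof.
move=> rw wn.
case: w rw wn => // l w rw _; set v := l :: w in rw *.
have onth_last (u : seq (I * bool)) m : onth (rcons u m) (size (rcons u m)).-1 = Some m.
  by rewrite size_rcons /=; elim: u => //= ? u ->.
have [[a]|[al ma]] : (exists a, [/\ a.1 = i0, l != linv a & last l w != a]) \/
    (l.1 = i0 /\ (last l w).1 = i0).
  have [h|h] := boolP ((l != (i0, true)) && (last l w != (i0, false))).
    by left; exists (i0, false); move/andP: h => [].
  have [h'|h'] := boolP ((l != (i0, false)) && (last l w != (i0, true))).
    by left; exists (i0, true); move/andP: h' => [].
  right; move: (l) (last l w) h h' => [k e] [k' e']; rewrite !xpair_eqE /=.
  by case: (eqVneq k i0) => [->|_]; case: (eqVneq k' i0) => [->|_];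
    case: (e); case: (e').
- move=> [ai la ma]; exists (a :: rcons v (linv a)), (lval b a); split=> //.
  + rewrite /reduced /= la -cats1 cat_path /= -/(reduced v).
    move: rw; rewrite /reduced /= => ->.
    by rewrite andbT /= (inj_eq (inv_inj (@linvK I))) eq_sym.
  + by rewrite -cats1 /= ev_cat /= mulg1 lval_linv !mulgA.
  + move=> e; split; first by move=> [] /= ea; rewrite ea in ai; case: i01.
    by rewrite -rcons_cons onth_last => -[e' _]; rewrite ai in e'.
exists v, 1; split=> //; first by rewrite mul1g invg1 mulg1.
move=> e; split; first by move=> [] /= ea; rewrite ea in al; case: i01.
by rewrite /v lastI onth_last => -[] ea; rewrite ea in ma; case: i01.
Qed.

(** A conjugate of h carries one member of a free basis of a finite index
   subgroup to another one; this is the form in which h <> 1 is used. *)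
Lemma moved_basis_element h : h <> 1 -> exists x U (J : finType) (c : J -> F) u v,
  [/\ fi_subgroup U, free_on U c, u <> v, c u = b i1 &
      c v = x * h * x^-1 * b i1 * (x * h * x^-1)^-1].
Proof.
have [_ _ bgen _] := Fb => h1.
have [w rw ew] := ev_gen bgen (Logic.I : setT h).
have wn : w != [::] by apply/eqP => w0; apply: h1; rewrite -ew w0.
have [w' [x [rw' wn' ew' w'i]]] := conjugate_word rw wn.
have [U [J [c [u [v [fU Uc uv cu cv]]]]]] := two_loops Fb (fi_subgroupT F) rw' wn' w'i.
by exists x, U, J, c, u, v; rewrite -ew -ew'.
Qed.

(** A conjugate of h that centralizes a finite index subgroup would identify
   equal powers of two distinct basis elements. *)
Lemma inner_eq1 (h : F) : inner h = 1 -> h = 1.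
Proof.
move=> ih; apply: contrapT => /moved_basis_element.
move=> [x [U [J [c [u [v [fU Uc uv cu cv]]]]]]].
set h' := x * h * x^-1 in cv.
have ih' : inner h' = 1 by rewrite !innerM ih mulg1 innerV mulgV.
have /vclassP[W [fW _ _ hW]] : inner h' = vclass (vid F) by rewrite ih'.
have [p Wp] := fi_power (b i1) fW.
have := hW _ Wp; rewrite /= => e.
have evn (k : J) n : ev c (nseq n (k, false)) = c k ^+ n.
  by elim: n => [|n IH]; rewrite ?expg0 // expgS -IH.
have rn (k : J) n : reduced (nseq n (k, false)).
  case: n => // n; rewrite /reduced; elim: n => //= m IH.
  by rewrite IH andbT /linv xpair_eqE andbF.
have ecv : c v ^+ p.+1 = c u ^+ p.+1.
  have -> : c v = (c u) ^ h'^-1 by rewrite conjgE invgK cv cu mulgA.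
  by rewrite -conjXg conjgE invgK mulgA cu.
have /(congr1 (head (u, true))) /= := reduced_ev_inj Uc (rn v p.+1) (rn u p.+1)
  (etrans (evn v p.+1) (etrans ecv (esym (evn u p.+1)))).
by move=> [] e'; apply: uv.
Qed.

Section NormalSubgroup.
Variable N : set (Comm F).
Hypothesis sN : subgroup N.
Hypothesis Nconj : forall s x, AComm F s -> N x -> N (s * x * s^-1).

(** N contains [inner (c v * (c u)^-1)], a commutator, and a transvection of U
   carries [c v * (c u)^-1] to [c v]; so N contains [inner] of U. The passage from
   U to the whole group extracts a root: a power of [b i0] in U is a basis
   element of a cyclic cover that shares the basis element [b i1] with F. *)
Lemma all_inner_in_N h : h <> 1 -> N (inner h) -> forall x, N (inner x).
Proof.
have [N1 NM NV] := sN.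
move=> /moved_basis_element[x [U [J [c [u [v [fU Uc uv cu cv]]]]]]] Nh.
set h' := x * h * x^-1 in cv.
have Nh' : N (inner h').
  by rewrite !innerM innerV; apply: Nconj => //; exact: AComm_inner.
have Nvu : N (inner (c v * (c u)^-1)).
  have -> : inner (c v * (c u)^-1) =
      inner h' * (inner (c u) * (inner h')^-1 * (inner (c u))^-1).
    by rewrite cv -cu !innerM !innerV !innerM !innerV -!mulgA.
  by apply: (NM) => //; apply: Nconj; [exact: AComm_inner | exact: NV].
have [sU cU _ _] := Uc; have [U1 UM UV] := sU.
have f1 : fixed_off U c v 1 by have [] := subgroup_fixed_off Uc v.
have [f af fc] := transvection_aut Uc fU f1 (fixed_off_b Uc uv).
have [s As rs] := aut_class af; have fM := rep_mul_on rs.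
have Nv : N (inner (c v)).
  have -> : c v = f (c v * (c u)^-1).
    rewrite fM ?(mul_onV sU fM) //; last exact: UV.
    by rewrite !fc /upd eqxx; case: eqP => // _; rewrite mul1g mulgK.
  rewrite -(inner_conj rs); last by apply: UM => //; exact: UV.
  exact: Nconj.
have NU := inner_free_in_N sN Nconj Uc fU Nv.
have [p Up] := fi_power (b i0) fU.
have [K [J' [c' [j0 [v' [fK _ Kc cj0 [cv' _ _ _]]]]]]] :=
  cyclic_cover Fb (fi_subgroupT F) p i0.
have Nj0 : N (inner (c' j0)) by rewrite cj0; exact: NU.
have [_ c'K _ _] := Kc.
have Ni1 : N (inner (b i1)).
  have -> : b i1 = c' (v' ord0 i1).
    by rewrite cv'; [rewrite expg0 invg1 mulg1 mul1g | move/esym].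
  by apply: (inner_free_in_N sN Nconj Kc fK Nj0); exact: c'K.
by move=> y; apply: (inner_free_in_N sN Nconj Fb (fi_subgroupT F) Ni1).
Qed.

Lemma proper_fi_subgroup : exists2 W : set F, fi_subgroup W & W <> setT.
Proof.
have [_ _ _ bext] := Fb.
have [rho rhoM rhob] := bext ({perm bool} : groupType) (fun _ => tperm false true).
exists (stabilizer setT false rho); first exact: fi_stabilizer (fi_subgroupT F) rhoM.
move=> e; have : [set: F] (b i0) by [].
by rewrite -e => -[_]; rewrite rhob tpermL.
Qed.

(** An automorphism of H restricts to a characteristic subgroup L inside a proper
   subgroup of finite index: L has rank at least 3, as Nielsen's theorem in the
   form of [aut_in_N] requires. *)
Lemma AComm_sub_N h : h <> 1 -> N (inner h) -> AComm F `<=` N.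
Proof.
move=> h1 Nh; have Ninner := all_inner_in_N h1 Nh.
move=> a; apply; split=> // {}a [H fH [phi [edom ecod] <-]].
have [J [c [Hc _]]] := free_fi_subgroup Fb fH (fun _ _ => Logic.I).
have [W fW WT] := proper_fi_subgroup.
have [L [fL LH LW Lchar]] := characteristic_subgroup Hc fH fW.
have [J' [c' [Lc J3]]] := free_fi_subgroup Fb fL (fun _ _ => Logic.I).
have {}J3 : 2 < #|J'|.
  apply: J3; last by move=> e; apply: WT; apply/seteqP; split=> // x _; apply: LW; rewrite e.
  by apply/card_gt1P; exists i0, i1; split=> //; exact/eqP.
have phiM : mul_on H (vfun phi) by move=> x y Hx Hy; apply: vfunM; rewrite edom.
have psiM : mul_on H (vinv_fun phi) by move=> x y Hx Hy; apply: vinvM; rewrite ecod.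
have phiL x : L x -> L (vfun phi x).
  by apply: Lchar => // y Hy; rewrite -ecod; apply: vfun_cod; rewrite edom.
have psiL x : L x -> L (vinv_fun phi x).
  apply: Lchar => // y Hy; have [] := @vinv_funP _ phi y; first by rewrite ecod.
  by rewrite edom.
have rep : represents (vclass phi) L (vfun phi).
  by exists phi; split=> // x /LH; rewrite edom.
have aut : is_aut L (vfun phi).
  split=> //; first exact: rep_mul_on rep.
  split=> [x /phiL//|x y|y Ly]; first by rewrite !inE; exact: rep_inj rep.
  exists (vinv_fun phi y); first exact: psiL.
  by have [] := @vinv_funP _ phi y; first by rewrite ecod; exact: LH.
exact: (aut_in_N sN Nconj Ninner Lc fL J3 aut rep).
Qed.

End NormalSubgroup.

(** If f represents c and moves g, then the commutator of c with [inner g] is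
   [inner (f g * g^-1)]. *)
Lemma meets_inner (N : set (Comm F)) : subgroup N ->
  (forall s x, AComm F s -> N x -> N (s * x * s^-1)) -> N <> [set 1] ->
  exists2 h, h <> 1 & N (inner h).
Proof.
move=> sN Nconj Nn1; have [N1 NM NV] := sN.
have [c Nc c1] : exists2 c, N c & c <> 1.
  apply: contrapT => h; apply: Nn1; apply/seteqP; split=> [c Nc|_ -> //].
  by apply: contrapT => c1; apply: h; exists c.
have [g [dg ng]] : exists g,
    vdom (generic_quotient.repr c) g /\ vfun (generic_quotient.repr c) g <> g.
  apply: contrapT => h; apply: c1; rewrite -(vclass_repr c); apply/vclassP.
  exists (vdom (generic_quotient.repr c)); split=> //; first exact: vdom_fi.
  by move=> x dx; apply: contrapT => ne; apply: h; exists x.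
exists (vfun (generic_quotient.repr c) g * g^-1); first by move=> /divg1_eq.
have rc : represents c (vdom (generic_quotient.repr c)) (vfun (generic_quotient.repr c)).
  by exists (generic_quotient.repr c); split=> //; [exact: vclass_repr | exact: vdom_fi].
rewrite innerM innerV -(inner_conj rc) //.
have -> : c * inner g * c^-1 * (inner g)^-1 = c * (inner g * c^-1 * (inner g)^-1).
  by rewrite !mulgA.
by apply: (NM) => //; apply: Nconj; [exact: AComm_inner | exact: NV].
Qed.

Lemma AComm_sub_normal (N : set (Comm F)) : subgroup N ->
  (forall s x, AComm F s -> N x -> N (s * x * s^-1)) -> N <> [set 1] -> AComm F `<=` N.
Proof.
move=> sN Nconj /(meets_inner sN Nconj)[h h1 Nh].
exact: AComm_sub_N Nh.
Qed.

(** The domain of s need not be invariant under an automorphism of H, but it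
   contains a subgroup that is characteristic in H. *)
Lemma AComm_normal s x : AComm F x -> AComm F (s * x * s^-1).
Proof.
have [A1 AM AV] := subgroup_AComm F.
have sB : subgroup [set x | AComm F (s * x * s^-1)].
  split=> [|u v Au Av|u Au] /=; first by rewrite mulg1 mulgV.
    have -> : s * (u * v) * s^-1 = (s * u * s^-1) * (s * v * s^-1).
      by rewrite !mulgA mulgVK.
    exact: AM.
  have -> : s * u^-1 * s^-1 = (s * u * s^-1)^-1 by rewrite !group_simp.
  exact: AV.
move=> Ax; apply: (Ax [set x | AComm F (s * x * s^-1)]).
split=> // {x Ax} a [H fH [phi [edom ecod] <-]] /=.
pose psi := generic_quotient.repr s; have es : vclass psi = s := vclass_repr s.
have [J [c [Hc _]]] := free_fi_subgroup Fb fH (fun _ _ => Logic.I).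
have [L [fL LH Ld Lchar]] := characteristic_subgroup Hc fH (vdom_fi psi).
have phiM : mul_on H (vfun phi) by move=> x y Hx Hy; apply: vfunM; rewrite edom.
have phi'M : mul_on H (vinv_fun phi) by move=> x y Hx Hy; apply: vinvM; rewrite ecod.
have phiL x : L x -> L (vfun phi x).
  by apply: Lchar => // y Hy; rewrite -ecod; apply: vfun_cod; rewrite edom.
have phi'L x : L x -> L (vinv_fun phi x).
  apply: Lchar => // y Hy; have [] := @vinv_funP _ phi y; first by rewrite ecod.
  by rewrite edom.
pose M := vcod psi `&` vinv_fun psi @^-1` L.
have fM : fi_subgroup M.
  by apply: fi_subgroup_preim => //; [exact: vcod_fi | exact: vinvM].
have ML y : M y -> L (vinv_fun psi y) by case.
have LM x : L x -> M (vfun psi x).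
  move=> Lx; split; first exact/vfun_cod/Ld.
  by rewrite /= vinv_funK //; exact: Ld.
have rpsi : represents s L (vfun psi) by exists psi; split.
have rpsi' : represents s^-1 M (vinv_fun psi).
  apply: (rep_inv rpsi fM) => y [cy Ly]; split=> //.
  by have [] := vinv_funP cy.
have rphi : represents (vclass phi) L (vfun phi).
  by exists phi; split=> // x /LH; rewrite edom.
have phiML y : M y -> L ((vfun phi \o vinv_fun psi) y) by move=> /ML/phiL.
have r := rep_mul rpsi (rep_mul rphi rpsi' ML) phiML.
have aut : is_aut M (vfun psi \o (vfun phi \o vinv_fun psi)).
  split=> //; first exact: rep_mul_on r.
  split=> [y /phiML/LM//|x y|y My].
    by rewrite !inE; exact: rep_inj r.
  have Ly := ML _ My; have Ly' := phi'L _ Ly.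
  exists (vfun psi (vinv_fun phi (vinv_fun psi y))); first exact: LM.
  rewrite /= vinv_funK; last exact: Ld.
  have [|_ ->] := @vinv_funP _ phi (vinv_fun psi y); first by rewrite ecod; exact: LH.
  by case: My => cy _; have [] := vinv_funP cy.
have [d Ad rd] := aut_class aut.
have -> : s * vclass phi * s^-1 = d by rewrite -mulgA; exact: (rep_uniq r rd).
exact: Ad.
Qed.

End FreeGroup.

(** * Counting the non-solvable factors of a finite group *)

Section FiniteGroups.

(* Finite sets take precedence over classical sets in this section. *)
Import mathcomp.boot.fintype mathcomp.boot.finset.


Lemma solvable_quotientP (gT : finGroupType) (G N : {group gT}) : N <| G ->
  reflect (exists n, G^`(n) \subset N) (solvable (G / N)).
Proof.
move=> nN; have nGN := normal_norm nN.
have nd n : G^`(n) \subset 'N(N) by apply: subset_trans nGN; exact: der_sub.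
apply: (iffP (derivedP _)) => -[n h]; exists n.
  by rewrite -quotient_sub1 ?nd // quotient_der //; apply/trivgP.
by apply/trivgP; rewrite /= -quotient_der // quotient_sub1 ?nd.
Qed.

Lemma der_der (gT : finGroupType) (G : {group gT}) m n : (G^`(n))^`(m) = G^`(m + n).
Proof. by elim: m => //= m IH; rewrite addSn !dergSn IH. Qed.

(** [nonsolvable_series G m]: some subnormal series of G has at least m
   non-solvable factors. The bottom of the series is arbitrary, and the
   inequality makes the predicate downward closed. *)
Inductive nonsolvable_series (gT : finGroupType) (G : {group gT}) : nat -> Prop :=
| NonsolvableNil : nonsolvable_series G 0
| NonsolvableStep (N : {group gT}) m n : N <| G -> nonsolvable_series N n ->
    m <= n + ~~ solvable (G / N) -> nonsolvable_series G m.

Lemma series_lt_card (gT : finGroupType) (G : {group gT}) n :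
  nonsolvable_series G n -> n < #|G|.
Proof.
elim=> {G n} [G|G N m n nN _ IH le]; first exact: cardG_gt0.
have [sNG|nNG] := boolP (N \proper G).
  apply: leq_ltn_trans (proper_card sNG); apply: leq_trans IH.
  by apply: leq_trans le _; rewrite -addn1 leq_add2l leq_b1.
have e : N :=: G.
  by apply/eqP; rewrite eqEsubset normal_sub //; move: nNG; rewrite properE normal_sub //= negbK.
move: le; rewrite e trivg_quotient solvable1 addn0 => le.
by rewrite -e; exact: leq_ltn_trans IH.
Qed.

Section Morphism.
Variables (aT rT : finGroupType) (D : {group aT}) (f : {morphism D >-> rT}).

(** Intersect a series of G with the kernel and project it. A factor of G is
   solvable when its traces in the kernel and in the image both are, since an
   extension of solvable groups is solvable. *)
Lemma series_morphim_split (G : {group aT}) m : G \subset D ->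
  nonsolvable_series G m -> exists a b,
  [/\ nonsolvable_series (G :&: 'ker f)%G a, nonsolvable_series (f @* G)%G b & m <= a + b].
Proof.
move=> + sm; elim: sm => {G m} [G GD|G N m n nN _ IH le GD].
  by exists 0, 0; split=> //; exact: NonsolvableNil.
have ND := subset_trans (normal_sub nN) GD.
have [a [b [sa sb le']]] := IH ND.
have nK : N :&: 'ker f <| G :&: 'ker f.
  have := normalGI (subsetIl G ('ker f)) nN.
  by rewrite setIAC (setIidPr (normal_sub nN)).
have nf : f @* N <| f @* G by exact: morphim_normal.
exists (a + ~~ solvable ((G :&: 'ker f) / (N :&: 'ker f))),
  (b + ~~ solvable ((f @* G) / (f @* N))).
split.
- exact: (NonsolvableStep (N := (N :&: 'ker f)%G) nK sa).
- exact: (NonsolvableStep (N := (f @* N)%G) nf sb).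
suff : ~~ solvable (G / N) ->
    ~~ solvable ((G :&: 'ker f) / (N :&: 'ker f)) \/ ~~ solvable ((f @* G) / (f @* N)).
  move: le le'; case: (solvable (G / N)) => /= le le'; first by lia.
  by move=> /(_ isT)[] -> /=; lia.
move=> ns; apply/orP; rewrite -negb_and; apply: contra ns.
move=> /andP[/(solvable_quotientP nK)[i hi] /(solvable_quotientP nf)[j hj]].
apply/(solvable_quotientP nN); exists (i + j); rewrite -der_der.
have nGN := normal_norm nN.
have jG : G^`(j) \subset G by exact: der_sub.
have ndj : G^`(j) \subset 'N(N) by exact: subset_trans nGN.
have nKN : G :&: 'ker f \subset 'N(N) by apply: subset_trans nGN; exact: subsetIl.
have sub : G^`(j) / N \subset (G :&: 'ker f) / N.
  have <- : (G :&: 'ker f) * N / N = (G :&: 'ker f) / N by exact: quotientMidr.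
  apply: quotientS.
  rewrite (group_modr _ (normal_sub nN)) subsetI jG /= -morphimSK; last first.
    exact: subset_trans GD.
  by rewrite morphim_der.
rewrite -quotient_sub1; last by apply: subset_trans ndj; exact: der_sub.
rewrite quotient_der //; apply: subset_trans (dergS i sub) _.
rewrite -quotient_der // quotient_sub1; first exact: subset_trans hi (subsetIl _ _).
by apply: subset_trans nKN; exact: der_sub.
Qed.

(** Pull a series of the image back to G, and continue it in the kernel. *)
Lemma series_morphim_join (G : {group aT}) a b : G \subset D ->
  nonsolvable_series (G :&: 'ker f)%G a -> nonsolvable_series (f @* G)%G b ->
  nonsolvable_series G (a + b).
Proof.
move=> + sa sb; move e: (f @* G)%G sb => Q sb.
elim: sb G e sa => {Q b} [Q|Q M m n nM _ IH le] G e sa GD.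
  apply: (NonsolvableStep (N := (G :&: 'ker f)%G) _ sa); last by rewrite addn0 leq_addr.
  exact: normalGI GD (ker_normal f).
have sMQ := normal_sub nM; have eQ : f @* G = Q by rewrite -e.
have sQD : Q \subset f @* D by rewrite -eQ morphimS.
pose G1 := (G :&: f @*^-1 M)%G.
have nG1 : G1 <| G.
  apply: (@normalGI _ (f @*^-1 Q)%G); first by rewrite -sub_morphim_pre // eQ.
  by rewrite morphpre_normal // (subset_trans sMQ).
have eM : (f @* G1)%G = M.
  by apply: val_inj; rewrite /= morphim_setIpre eQ; apply/setIidPr.
have eK : (G1 :&: 'ker f)%G = (G :&: 'ker f)%G.
  apply: val_inj; rewrite /= -setIA; congr (_ :&: _).
  by apply/setIidPr; exact: ker_sub_pre.
have s1 : nonsolvable_series G1 (a + n).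
  by apply: IH => //; rewrite ?eK //; exact: subset_trans (subsetIl _ _) GD.
apply: (NonsolvableStep nG1 s1); rewrite -addnA leq_add2l; apply: leq_trans le _.
rewrite leq_add2l; case: (boolP (solvable (G / G1))) => [h|_]; last exact: leq_b1.
suff -> : solvable (Q / M) by [].
have /(solvable_quotientP nG1)[k hk] := h; apply/(solvable_quotientP nM); exists k.
have := morphimS f hk; rewrite morphim_der // -/(gval (f @* G1)%G).
by rewrite -[f @* G1]/(gval (f @* G1)%G) eM eQ.
Qed.

End Morphism.

Definition nonsolvable_length (gT : finGroupType) (G : {group gT}) : nat :=
  \max_(n < #|G| | `[<nonsolvable_series G n>]) n.

Section Length.
Variable gT : finGroupType.
Implicit Type G : {group gT}.

Lemma series_length G : nonsolvable_series G (nonsolvable_length G).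
Proof.
rewrite /nonsolvable_length.
apply: (big_ind (fun n => nonsolvable_series G n)) => [|m n sm sn|n /asboolP //].
  exact: NonsolvableNil.
by rewrite /maxn; case: ifP.
Qed.

Lemma series_le_length G n : nonsolvable_series G n -> n <= nonsolvable_length G.
Proof.
move=> sn; have lt := series_lt_card sn.
by apply: (@leq_bigmax_cond _ _ (@nat_of_ord _) (Ordinal lt)); apply/asboolP.
Qed.

Lemma length_solvable G : solvable G -> nonsolvable_length G = 0.
Proof.
suff h n : nonsolvable_series G n -> solvable G -> n = 0.
  exact/h/series_length.
elim=> {G n} // G N m n nN _ IH le sG.
move: le; rewrite IH ?quotient_sol // ?leqn0; first by move=> /eqP.
exact: solvableS (normal_sub nN) sG.
Qed.

Lemma length_nonsolvable G : ~~ solvable G -> 0 < nonsolvable_length G.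
Proof.
move=> nG; apply: series_le_length.
have n1 : 1%G <| G by exact: normal1.
apply: (NonsolvableStep n1 (NonsolvableNil _)).
rewrite add0n; suff -> : ~~ solvable (G / 1%G) by [].
apply: contra nG => /(solvable_quotientP n1)[n h].
by apply/derivedP; exists n; apply/trivgP.
Qed.

End Length.

Lemma length_morphim (aT rT : finGroupType) (D : {group aT}) (f : {morphism D >-> rT})
    (G : {group aT}) : G \subset D ->
  nonsolvable_length G = nonsolvable_length (G :&: 'ker f) + nonsolvable_length (f @* G).
Proof.
move=> GD; apply/eqP; rewrite eqn_leq; apply/andP; split.
  have [a [b [sa sb le]]] := series_morphim_split f GD (series_length G).
  by apply: leq_trans le _; rewrite leq_add // series_le_length.
exact: series_le_length (series_morphim_join GD (series_length _) (series_length _)).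
Qed.

(** The kernel of f in G is also its kernel in V, so it contributes the same
   amount to the lengths of G and of V. *)
Lemma length_morphim_diff (aT rT : finGroupType) (D : {group aT})
    (f : {morphism D >-> rT}) (G V : {group aT}) :
    G \subset D -> V \subset G -> G :&: 'ker f \subset V ->
  nonsolvable_length G + nonsolvable_length (f @* V) =
  nonsolvable_length V + nonsolvable_length (f @* G).
Proof.
move=> GD VG kV; have VD := subset_trans VG GD.
have e : (G :&: 'ker f)%G = (V :&: 'ker f)%G.
  apply: val_inj; apply/eqP; rewrite eqEsubset /= subsetI kV subsetIr /=.
  exact: setSI.
rewrite (length_morphim f GD) (length_morphim f VD) e.
by rewrite -!addnA; congr (_ + _); rewrite addnC.
Qed.

End FiniteGroups.

(** * A homomorphism from the commensurator to the integers *)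

Section Image.
Variables (F : groupType) (gT : finGroupType).
Implicit Types (W : set F) (pi : F -> gT).

Definition image_group pi W : {group gT} :=
  <<[set y | `[<exists2 x, W x & pi x = y>]]%SET>>%G.

Lemma mem_image_group pi W y : subgroup W -> mul_on W pi ->
  reflect (exists2 x, W x & pi x = y) (y \in image_group pi W).
Proof.
move=> sW pM; have [W1 WM WV] := sW.
have gS : group_set [set y | `[<exists2 x, W x & pi x = y>]]%SET.
  apply/group_setP; split=> [|u v]; rewrite !finset.inE.
    by apply/asboolP; exists 1; rewrite // (mul_on1 sW pM).
  move=> /asboolP[x Wx <-] /asboolP[z Wz <-]; apply/asboolP.
  by exists (x * z); [exact: WM | rewrite pM].
rewrite /image_group /= (gen_set_id gS) finset.inE.
exact: asboolP.
Qed.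

Lemma image_group_sub pi W (G : {group gT}) :
  (forall x, W x -> pi x \in G) -> image_group pi W \subset G.
Proof.
move=> h; rewrite gen_subG; apply/fintype.subsetP => y; rewrite finset.inE.
by move=> /asboolP[x Wx <-]; exact: h.
Qed.

End Image.

Section Independence.
Variables (F : groupType) (H W : set F).
Hypotheses (sH : subgroup H) (sW : subgroup W) (WH : W `<=` H).

Lemma length_image_morphim (gT rT : finGroupType) (p : F -> gT)
    (f : {morphism [set: gT]%SET >-> rT}) :
    mul_on H p -> (forall x, H x -> f (p x) = 1 -> W x) ->
  nonsolvable_length (image_group p H) + nonsolvable_length (image_group (f \o p) W) =
  nonsolvable_length (image_group p W) + nonsolvable_length (image_group (f \o p) H).
Proof.
move=> pM k1; have inT x : x \in [set: gT]%SET by rewrite finset.inE.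
have imf V : subgroup V -> V `<=` H ->
    (f @* image_group p V)%G = image_group (f \o p) V.
  move=> sV VH; have pV := mul_onS VH pM.
  have fpV : mul_on V (f \o p) by move=> x y Vx Vy; rewrite /= pV // morphM.
  apply: val_inj => /=; apply/finset.setP => y; apply/morphimP/mem_image_group => //.
    by move=> [u _ /(mem_image_group _ sV pV)[x Vx <-] ->]; exists x.
  move=> [x Vx <-]; exists (p x) => //.
  by apply/(mem_image_group _ sV pV); exists x.
rewrite -(imf H sH) // -(imf W sW) //.
apply: length_morphim_diff.
- exact: finset.subsetT.
- apply: image_group_sub => x Wx.
  by apply/(mem_image_group _ sH pM); exists x => //; exact: WH.
apply/fintype.subsetP => u /setIP[/(mem_image_group _ sH pM)[x Hx <-]].
move=> /kerP /= /(_ (inT _)) u1.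
by apply/(mem_image_group _ sW (mul_onS WH pM)); exists x => //; exact: k1.
Qed.

(** Compare both maps with their product map into the direct product. *)
Lemma length_image_independent (gT1 gT2 : finGroupType) (p1 : F -> gT1) (p2 : F -> gT2) :
    mul_on H p1 -> mul_on H p2 ->
    (forall x, H x -> p1 x = 1 -> W x) -> (forall x, H x -> p2 x = 1 -> W x) ->
  nonsolvable_length (image_group p1 H) + nonsolvable_length (image_group p2 W) =
  nonsolvable_length (image_group p2 H) + nonsolvable_length (image_group p1 W).
Proof.
move=> p1M p2M k1 k2; pose p x := (p1 x, p2 x).
have pM : mul_on H p by move=> x y Hx Hy; rewrite /p p1M // p2M.
have := @length_image_morphim _ _ p [morphism of @fst gT1 gT2] pM k1.
have := @length_image_morphim _ _ p [morphism of @snd gT1 gT2] pM k2.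
have -> : [morphism of @fst gT1 gT2] \o p = p1 by [].
have -> : [morphism of @snd gT1 gT2] \o p = p2 by [].
by lia.
Qed.

End Independence.

Section NonsolvableIndex.
Variable F : groupType.
Implicit Types (U V W : set F).

Lemma finite_quotient W : fi_subgroup W -> exists (S : finType) (rho : F -> {perm S}),
  mul_on setT rho /\ forall x, rho x = 1 -> W x.
Proof.
move=> fW; have [S [r [rho [rhoM _ e]]]] := coset_action (subgroupT F) fW (fun _ _ => Logic.I).
by exists S, rho; split=> // x ex; rewrite e; split=> //; rewrite ex perm1.
Qed.

Definition length_drop (gT : finGroupType) (p : F -> gT) U W : int :=
  ((nonsolvable_length (image_group p U))%:Z - (nonsolvable_length (image_group p W))%:Z)%R.

(** A variant of the logarithm of the index that counts non-solvable factors
   only; unlike the index, it is not determined by the rank of W. *)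
Definition nonsolvable_index W : int :=
  xget 0%R [set n | exists (S : finType) (rho : F -> {perm S}),
    [/\ mul_on setT rho, (forall x, rho x = 1 -> W x) & n = length_drop rho setT W]].

Lemma length_drop_independent U W (gT1 gT2 : finGroupType) (p1 : F -> gT1) (p2 : F -> gT2) :
    subgroup U -> subgroup W -> W `<=` U -> mul_on U p1 -> mul_on U p2 ->
    (forall x, U x -> p1 x = 1 -> W x) -> (forall x, U x -> p2 x = 1 -> W x) ->
  length_drop p1 U W = length_drop p2 U W.
Proof.
move=> sU sW WU p1M p2M k1 k2; rewrite /length_drop.
by have := length_image_independent sU sW WU p1M p2M k1 k2; lia.
Qed.

Lemma nonsolvable_indexE W (gT : finGroupType) (p : F -> gT) : fi_subgroup W ->
  mul_on setT p -> (forall x, p x = 1 -> W x) -> nonsolvable_index W = length_drop p setT W.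
Proof.
move=> fW pM pk; have [S [rho [rhoM rk]]] := finite_quotient fW.
have [S' [rho' [rM' rk' ->]]] : [set n | exists (S : finType) (rho : F -> {perm S}),
    [/\ mul_on setT rho, (forall x, rho x = 1 -> W x) & n = length_drop rho setT W]]
      (nonsolvable_index W).
  by apply: xgetPex; exists (length_drop rho setT W), S, rho.
have [sW _] := fW.
by apply: length_drop_independent => // x _; [exact: rk' | exact: pk].
Qed.

(** The drop between two nested subgroups depends only on the inclusion, since
   it can be computed in any finite quotient of the larger one. *)
Lemma nonsolvable_index_diff U W (gT : finGroupType) (p : F -> gT) :
    fi_subgroup U -> fi_subgroup W -> W `<=` U -> mul_on U p ->
    (forall x, U x -> p x = 1 -> W x) ->
  (nonsolvable_index W - nonsolvable_index U)%R = length_drop p U W.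
Proof.
move=> fU fW WU pM pk; have [S [rho [rhoM rk]]] := finite_quotient fW.
have [sU _] := fU; have [sW _] := fW.
rewrite (nonsolvable_indexE fW rhoM rk) (nonsolvable_indexE fU rhoM (fun x h => WU _ (rk x h))).
have <- : length_drop rho U W = length_drop p U W.
  apply: length_drop_independent => //; first exact: mul_onS rhoM.
  by move=> x _; exact: rk.
by rewrite /length_drop; lia.
Qed.

Lemma image_viso (phi : viso F) W : fi_subgroup W -> W `<=` vdom phi ->
  fi_subgroup (vfun phi @` W).
Proof.
move=> fW Wd; have -> : vfun phi @` W = vcod phi `&` vinv_fun phi @^-1` W.
  apply/seteqP; split=> y.
    by move=> [x Wx <-]; split; [exact/vfun_cod/Wd | rewrite /= vinv_funK //; exact: Wd].
  by move=> [/vinv_funP[_ e] Wy]; exists (vinv_fun phi y).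
by apply: fi_subgroup_preim => //; [exact: vcod_fi | exact: vinvM].
Qed.

(** The change of [nonsolvable_index] under a virtual isomorphism; by
   [viso_char_restrict] it can be computed on any smaller domain. *)
Definition viso_char (phi : viso F) : int :=
  (nonsolvable_index (vcod phi) - nonsolvable_index (vdom phi))%R.

(** A finite quotient of the codomain pulls back along phi to one of the domain,
   so the drops from domain to W and from codomain to the image of W agree. *)
Lemma viso_char_restrict (phi : viso F) W : fi_subgroup W -> W `<=` vdom phi ->
  viso_char phi = (nonsolvable_index (vfun phi @` W) - nonsolvable_index W)%R.
Proof.
move=> fW Wd; have fV := image_viso fW Wd.
have [S [rho [rhoM rk]]] := finite_quotient fV.
have Vc : vfun phi @` W `<=` vcod phi by move=> _ [x Wx <-]; exact/vfun_cod/Wd.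
have e1 := nonsolvable_index_diff (vcod_fi phi) fV Vc (mul_onS (fun _ _ => Logic.I) rhoM)
  (fun x _ => rk x).
have pM : mul_on (vdom phi) (rho \o vfun phi).
  by move=> x y dx dy; rewrite /= vfunM // rhoM.
have pk x : vdom phi x -> (rho \o vfun phi) x = 1 -> W x.
  move=> dx /rk[y Wy] e; rewrite -(vfun_inj (Wd _ Wy) dx e) //.
have e2 := nonsolvable_index_diff (vdom_fi phi) fW Wd pM pk.
have imE A B : vfun phi @` A = B -> image_group (rho \o vfun phi) A = image_group rho B.
  move=> <-; apply: val_inj => /=; congr (<<_>>); apply/finset.setP => y; rewrite !finset.inE.
  apply/asboolP/asboolP => [[x Ax <-]|[_ [x Ax <-] <-]]; last by exists x.
  by exists (vfun phi x) => //; exists x.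
have dc : vfun phi @` vdom phi = vcod phi.
  apply/seteqP; split=> y; first by move=> [x dx <-]; exact: vfun_cod.
  by move=> /vfun_surj[x dx <-]; exists x.
have e3 : length_drop (rho \o vfun phi) (vdom phi) W =
    length_drop rho (vcod phi) (vfun phi @` W).
  by rewrite /length_drop (imE _ _ dc) (imE W _ erefl).
by rewrite /viso_char; move: e1 e2; rewrite e3; lia.
Qed.

Lemma viso_char_equiv (phi psi : viso F) :
  viso_equiv phi psi -> viso_char phi = viso_char psi.
Proof.
move=> [W [fW W1 W2 e]].
rewrite (viso_char_restrict fW W1) (viso_char_restrict fW W2).
by have -> : vfun phi @` W = vfun psi @` W by apply: eq_imagel.
Qed.

Definition comm_char (c : Comm F) : int := viso_char (generic_quotient.repr c).

Lemma comm_charE phi : comm_char (vclass phi) = viso_char phi.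
Proof. by apply/viso_char_equiv/vclassP; exact: vclass_repr. Qed.

Lemma comm_charM c d : comm_char (c * d) = (comm_char c + comm_char d)%R.
Proof.
rewrite -(vclass_repr c) -(vclass_repr d) vclassM !comm_charE.
set f := generic_quotient.repr c; set g := generic_quotient.repr d.
have fD := vcomp_dom_fi f g; have Dg : vcomp_dom f g `<=` vdom g by move=> x [].
have fX := fi_subgroupI (vcod_fi g) (vdom_fi f).
have Xf : vcod g `&` vdom f `<=` vdom f by move=> x [].
rewrite (viso_char_restrict fX Xf) (viso_char_restrict fD Dg).
have -> : vfun g @` vcomp_dom f g = vcod g `&` vdom f.
  apply/seteqP; split=> y; first by move=> [x [_ +] <-].
  by move=> [/vfun_surj[x dx <-] dy]; exists x => //; split=> //; split=> //; exact: vfun_cod.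
by rewrite /viso_char /= -/(vcomp_cod f g); lia.
Qed.

Lemma comm_char1 : comm_char 1 = 0%R.
Proof. by have := comm_charM 1 1; rewrite mulg1; lia. Qed.

Lemma comm_charV c : comm_char c^-1 = (- comm_char c)%R.
Proof. by have := comm_charM c c^-1; rewrite mulgV comm_char1; lia. Qed.

Lemma comm_charX c n : comm_char (c ^+ n) = (n%:Z * comm_char c)%R.
Proof.
elim: n => [|n IH]; first by rewrite expg0 comm_char1; lia.
by rewrite expgS comm_charM IH; lia.
Qed.

(** An automorphism of a finite index subgroup has the same domain and
   codomain. *)
Lemma comm_char_AComm c : AComm F c -> comm_char c = 0%R.
Proof.
move=> Ac; apply: (Ac [set c | comm_char c = 0%R]); split.
  split=> [|u v /= hu hv|u /= hu] /=; first exact: comm_char1.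
    by rewrite comm_charM hu hv.
  by rewrite comm_charV hu.
move=> _ [H _ [phi [ed ec] <-]] /=.
by rewrite comm_charE /viso_char ed ec; lia.
Qed.

End NonsolvableIndex.

(** * An element of infinite order modulo AComm *)

Lemma free_viso (F : groupType) (U V : set F) (J K : finType) (c : J -> F) (d : K -> F) :
    fi_subgroup U -> fi_subgroup V -> free_on U c -> free_on V d -> #|J| = #|K| ->
  exists phi : viso F, vdom phi = U /\ vcod phi = V.
Proof.
move=> fU fV Uc Vd eJK.
have [sU cU cgen cext] := Uc; have [sV dV dgen dext] := Vd.
pose g j := d (enum_val (cast_ord eJK (enum_rank j))).
pose h k := c (enum_val (cast_ord (esym eJK) (enum_rank k))).
have [f fM fc] := cext F g; have [f' fM' fd] := dext F h.
have fUV x : U x -> V (f x).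
  move=> Ux; suff [] : [set y | U y /\ V (f y)] x by [].
  move: x Ux; apply: cgen => [|i]; first exact: (subgroup_preim sU fM sV).
  by split=> //; rewrite fc; exact: dV.
have fVU x : V x -> U (f' x).
  move=> Vx; suff [] : [set y | V y /\ U (f' y)] x by [].
  move: x Vx; apply: dgen => [|i]; first exact: (subgroup_preim sV fM' sU).
  by split=> //; rewrite fd; exact: cU.
have ff' x : V x -> f (f' x) = x.
  apply: (free_on_agree Vd (f := f \o f') (g := id)) x => //.
    by move=> x y Vx Vy /=; rewrite fM' // fM //; exact: fVU.
  by move=> k /=; rewrite fd fc /g enum_valK cast_ordKV enum_rankK.
have f'f x : U x -> f' (f x) = x.
  apply: (free_on_agree Uc (f := f' \o f) (g := id)) x => //.
    by move=> x y Ux Uy /=; rewrite fM // fM' //; exact: fUV.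
  by move=> k /=; rewrite fc fd /h enum_valK cast_ordK enum_rankK.
have fbij : set_bij U V f.
  split=> [x /fUV//|x y|y Vy]; first by rewrite !inE => Ux Uy e; rewrite -(f'f x) // e f'f.
  by exists (f' y); [exact: fVU | exact: ff'].
by exists (Viso fU fV fM fbij).
Qed.

Section FiveCycle.

Let cyc : {perm 'I_5} := perm (@ordS_inj 5).

Lemma cycX (s : 'I_5) : (cyc ^+ s) ord0 = s.
Proof. by rewrite ord_perm_cycle modn_small // inord_val. Qed.

(** Conjugates of the transposition by powers of the 5-cycle link all points by
   transpositions of G. *)
Lemma generate_Sym5 (G : {group {perm 'I_5}}) :
  cyc \in G -> tperm ord0 (cyc ord0) \in G -> G :=: [set: {perm 'I_5}]%SET.
Proof.
move=> Gc Gt.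
have Gsym i j : tperm i j \in G -> tperm j i \in G by rewrite tpermC.
have Gtrans i j k : tperm i j \in G -> tperm j k \in G -> tperm i k \in G.
  move=> ij jk; have [->//|ni] := eqVneq i j; have [->|nk] := eqVneq i k.
    by rewrite tperm1 group1.
  have := groupJ ij jk; rewrite tpermJ tpermL tpermD //; first by rewrite eq_sym.
  by rewrite eq_sym.
have G0 n : tperm ord0 ((cyc ^+ n) ord0) \in G.
  elim: n => [|n IH]; first by rewrite expg0 perm1 tperm1 group1.
  apply: Gtrans IH _; have := groupJ Gt (groupX n Gc).
  by rewrite tpermJ expgS permM.
have Gall i j : tperm i j \in G.
  by apply: (Gtrans _ ord0); [apply: Gsym|]; rewrite -1?(cycX i) -1?(cycX j); exact: G0.
apply/eqP; rewrite finset.eqEsubset finset.subsetT /=; apply/fintype.subsetP => s _.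
have [ts -> _] := prod_tpermP s.
by apply: group_prod => t _; exact: Gall.
Qed.

Lemma Sym5_nonsolvable : ~~ solvable [set: {perm 'I_5}]%SET.
Proof.
apply/negP => sol.
have sA : solvable 'Alt_('I_5) by apply: solvableS sol; exact: finset.subsetT.
have simA : gseries.simple 'Alt_('I_5) by apply: simple_Alt5; rewrite card_ord.
have := simple_sol_prime sA simA.
have : (2 * #|'Alt_('I_5)|)%N = 120%N by rewrite card_Alt ?card_ord.
by move=> e; have -> : #|'Alt_('I_5)| = 60 by lia.
Qed.

Lemma point_stabilizer_solvable : solvable 'C_[set: {perm 'I_5}]%SET[ord0 | 'P].
Proof.
apply: Burnside_p_a_q_b.
have := card_orbit_stab 'P [set: {perm 'I_5}]%SET ord0.
have -> : #|orbit 'P [set: {perm 'I_5}]%SET ord0| = 5.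
  rewrite -[RHS]card_ord; apply: eq_card => s; rewrite inE; apply/orbitP.
  by exists (cyc ^+ s); [rewrite finset.inE | rewrite /= apermE cycX].
have -> : #|[set: {perm 'I_5}]%SET| = 120 by rewrite -/('Sym_('I_5)) card_Sym card_ord.
by move/eqP; rewrite -[120%N]/(5 * 24)%N eqn_pmul2l // => /eqP ->.
Qed.

Variables (F : groupType) (I : finType) (b : I -> F).
Hypothesis Fb : free_on setT b.
Variables (i0 i1 : I).
Hypothesis i01 : i0 <> i1.

(** A point stabilizer for the symmetric group of degree 5 and a subgroup with
   cyclic quotient of order 5 have the same index, so they are isomorphic, but
   only the first drop loses a non-solvable factor. *)
Lemma comm_char_nontrivial : exists c : Comm F, comm_char c <> 0%R.
Proof.
have [_ _ bgen bext] := Fb; have fT := fi_subgroupT F.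
have i10 : (i1 == i0) = false by apply/eqP => /esym.
have [rho rhoM rhob] := bext ({perm 'I_5} : groupType)
  (fun i => if i == i0 then cyc else if i == i1 then tperm ord0 (cyc ord0) else 1).
have [sg sgM sgb] := bext ({perm 'I_5} : groupType) (fun i => if i == i0 then cyc else 1).
have trans (r : F -> {perm 'I_5}) : mul_on setT r -> r (b i0) = cyc ->
    forall s, exists2 x, setT x & r x ord0 = s.
  move=> rM r0 s; exists (b i0 ^+ s) => //.
  by have [_ ->] := mul_onX (subgroupT F) rM s (Logic.I : setT (b i0)); rewrite r0 cycX.
have rho0 : rho (b i0) = cyc by rewrite rhob eqxx.
have sg0 : sg (b i0) = cyc by rewrite sgb eqxx.
have [t [E [dep [tree cE]]]] := schreier_tree_exists Fb rhoM (trans _ rhoM rho0).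
have [t' [E' [dep' [tree' cE']]]] := schreier_tree_exists Fb sgM (trans _ sgM sg0).
have Ufree := schreier Fb rhoM tree; have Vfree := schreier Fb sgM tree'.
set U := stabilizer _ _ rho in Ufree; set V := stabilizer _ _ sg in Vfree.
have fU : fi_subgroup U by exact: fi_stabilizer.
have fV : fi_subgroup V by exact: fi_stabilizer.
have [|phi [dphi cphi]] := free_viso fU fV Ufree Vfree.
  by rewrite !card_schreier_index; move: cE cE'; rewrite card_ord => -[->] [->].
exists (vclass phi); rewrite comm_charE /viso_char dphi cphi.
have rU x : rho x = 1 -> U x by move=> e; split=> //; rewrite e perm1.
have rV x : sg x = 1 -> V x by move=> e; split=> //; rewrite e perm1.
rewrite (nonsolvable_indexE fU rhoM rU) (nonsolvable_indexE fV sgM rV) /length_drop.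
have cyc_sub : image_group sg setT \subset <[cyc]>.
  apply: (@image_group_sub _ _ _ _ <[cyc]>%G) => x Tx.
  suff [] : [set x | setT x /\ sg x \in <[cyc]> ] x by [].
  move: x Tx; apply: bgen => [|i]; last first.
    by split=> //; rewrite sgb; case: ifP => _; rewrite ?cycle_id ?group1.
  apply: (subgroup_preim (subgroupT F) sgM (A := [set y | y \in <[cyc]> ])).
  by split=> [|x y|x] /=; [exact: group1 | exact: groupM | rewrite groupV].
have cyc_sol (G : {group {perm 'I_5}}) : G \subset <[cyc]> -> nonsolvable_length G = 0.
  by move=> s; apply: length_solvable; apply: abelian_sol; apply: abelianS s (cycle_abelian _).
have imS : image_group sg V \subset image_group sg setT.
  apply: image_group_sub => x _; apply/(mem_image_group _ (subgroupT F) sgM).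
  by exists x.
rewrite (cyc_sol _ cyc_sub) (cyc_sol _ (fintype.subset_trans imS cyc_sub)).
have eG : image_group rho setT :=: [set: {perm 'I_5}]%SET.
  apply: generate_Sym5; apply/(mem_image_group _ (subgroupT F) rhoM).
    by exists (b i0).
  by exists (b i1) => //; rewrite rhob i10 eqxx.
have nG : 0 < nonsolvable_length (image_group rho setT).
  by apply: length_nonsolvable; rewrite eG; exact: Sym5_nonsolvable.
have -> : nonsolvable_length (image_group rho U) = 0.
  apply: length_solvable; apply: solvableS point_stabilizer_solvable.
  apply: image_group_sub => x [_ ex]; rewrite inE finset.inE /=.
  by apply/astab1P; rewrite /= apermE.
by lia.
Qed.

End FiveCycle.

Lemma nonabelian_two_generators (F : groupType) (I : finType) (b : I -> F) :
  free_on setT b -> nonabelian F -> exists i0 i1 : I, i0 <> i1.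
Proof.
move=> [_ _ bgen _] nab; apply: contrapT => h; apply: nab.
have I1 (i j : I) : i = j by apply: contrapT => ij; apply: h; exists i, j.
have cent (y : F) : subgroup [set x | commute x y].
  split=> [|u v cu cv|u cu] /=; first exact/commute_sym/commute1.
    by apply/commute_sym/commuteM; exact: commute_sym.
  by apply/commute_sym/commuteV; exact: commute_sym.
have cb x i : commute x (b i).
  apply: (bgen _ (cent (b i))) => // j /=; rewrite (I1 j i); exact: commute_refl.
by move=> x y; apply: (bgen _ (cent y)) => // i /=; exact/commute_sym.
Qed.

Lemma normal_in_conj (G : groupType) (S N : set G) s x :
  normal_in S N -> S s^-1 -> N x -> N (s * x * s^-1).
Proof.
by move=> [_ _ Nc] Ss Nx; have := Nc _ _ Ss Nx; rewrite conjgE invgK mulgA.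
Qed.

Theorem theoremA (F : groupType)
    (hfree : free_of_finite_rank F) (hnab : nonabelian F) :
  (simple (AComm F) /\ monolithic (Comm F) /\ AComm F = monolith (Comm F)) /\
  (~ finite_index (AComm F) /\ ~ virtually_simple (Comm F)).
Proof.
have [n [b /free_on_basis Fb]] := hfree.
have [i0 [i1 i01]] := nonabelian_two_generators Fb hnab.
have sA := subgroup_AComm F; have [A1 AM AV] := sA.
have conjA s x : AComm F x -> AComm F (s * x * s^-1) by exact: (AComm_normal Fb).
have An1 : AComm F <> [set 1].
  move=> e; have := AComm_inner (b i0); rewrite e => /(inner_eq1 Fb i01).
  exact: (free_b_neq1 Fb).
have AsubN N : normal_in setT N -> N <> [set 1] -> AComm F `<=` N.
  move=> nN; have [sN _ _] := nN; apply: (AComm_sub_normal Fb i01 sN) => s x _.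
  exact: (normal_in_conj nN (x := x) (s := s) Logic.I).
have nA : normal_in setT (AComm F).
  by split=> // s x _ Ax; have := conjA s^-1 x Ax; rewrite invgK conjgE mulgA.
have eA : AComm F = monolith (Comm F).
  apply/seteqP; split=> x; first by move=> Ax N [nN Nn1]; exact: AsubN.
  by apply; split.
have infA : ~ finite_index (AComm F).
  move=> fA; have [c hc] := comm_char_nontrivial Fb i01.
  have [p /comm_char_AComm] := fi_power c (conj sA fA).
  by rewrite comm_charX; lia.
split; split=> //.
- split=> // N nN; have [sN NA _] := nN.
  have [|Nn1] := pselect (N = [set 1]); [by left | right].
  apply/seteqP; split=> //; apply: (AComm_sub_normal Fb i01 sN) => // s x As.
  exact: (normal_in_conj nN (AV _ As)).
- by split=> //; rewrite /monolithic -eA.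
move=> [S [[sS Sn1 Ssim] fS]].
have nSA : normal_in S (S `&` AComm F).
  split; [exact: subgroupI | by move=> x [] |].
  have [_ SM SV] := sS; move=> s x Ss [Sx Ax]; split.
    by rewrite conjgE; apply: (SM) => //; [exact: SV | exact: SM].
  by have := conjA s^-1 x Ax; rewrite invgK conjgE mulgA.
case: (Ssim _ nSA) => [e|e].
  have [p Sp] := fi_power (inner (b i0)) (conj sS fS).
  have : (S `&` AComm F) (inner (b i0 ^+ p.+1)).
    by split; [rewrite innerX | exact: AComm_inner].
  by rewrite e => /(inner_eq1 Fb i01); exact: (free_bX_neq1 Fb).
apply: infA; have SA : S `<=` AComm F by rewrite -e => x [].
have [s sP] := (finite_indexP sS).1 fS.
by apply/(finite_indexP sA); exists s => g; have [r rs Sr] := sP g; exists r => //; exact: SA.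
Qed.
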